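(* A state $\phi$ of $\mathcal T(\mathbb N\rtimes\mathbb N^\times)$ is a ground state for $\sigma$ if and only if, for all $m,n\in\mathbb N$ and $a,b\in\mathbb N^\times$, $$\phi(s^mv_av_b^*s^{*n})=0\quad\text{whenever }a\ne1\text{ or }b\ne1.$$
   Context: $\mathbb N=\{0,1,2,\dots\}$; $\mathbb N^\times$ is the multiplicative semigroup of positive integers; $\mathbb N\rtimes\mathbb N^\times$ has product $(m,a)(n,b)=(m+an,ab)$. $\mathcal T(\mathbb N\rtimes\mathbb N^\times)$ is the $C^*$-algebra generated by the isometries $T_ye_x=e_{yx}$ on $\ell^2(\mathbb N\rtimes\mathbb N^\times)$; $s:=T_{(1,1)}$, $v_a:=T_{(0,a)}$. The dynamics $\sigma:\mathbb R\to\operatorname{Aut}\mathcal T(\mathbb N\rtimes\mathbb N^\times)$ satisfies $\sigma_t(s)=s$, $\sigma_t(v_p)=p^{it}v_p$ for $p$ prime. An element $c$ is analytic if $t\mapsto\sigma_t(c)$ extends to an entire function $z\mapsto\sigma_z(c)$. A ground state is a state $\phi$ such that for all analytic $c,d$ the entire function $z\mapsto\phi(d\,\sigma_z(c))$ is bounded on the upper half-plane; it suffices to check this for $c,d$ of the form $s^mv_av_b^*s^{*n}$, which span a dense subspace. *)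

(* Defs.v *)
From HB Require Import structures.
From mathcomp Require Import all_boot all_order all_algebra.
From mathcomp Require Import complex ring lra.
From mathcomp Require Import all_classical all_reals all_analysis.

Set Implicit Arguments.
Unset Strict Implicit.
Unset Printing Implicit Defensive.
Import Order.TTheory GRing.Theory Num.Theory numFieldNormedType.Exports.

Local Open Scope classical_set_scope.
Local Open Scope ring_scope.
Local Open Scope complex_scope.

Local Notation Re := (@complex.Re _).
Local Notation Im := (@complex.Im _).
Local Notation normc := Normc.normc.

Section Summation.
Variables (R : realType) (I : choiceType).
Implicit Types (u v : I -> R) (f g : I -> R[i]).

(* Unordered sums of absolutely summable families *)
Definition rsummable u := summable [set: I] (EFin \o u).

Definition nnsum u : R := fine (\esum_(i in [set: I]) (u i)%:E).

Definition rsum u : R :=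
  nnsum (fun i => Num.max (u i) 0) - nnsum (fun i => Num.max (- u i) 0).

Definition csummable f :=
  rsummable (Re \o f) /\ rsummable (Im \o f).

Definition csum f : R[i] :=
  rsum (Re \o f) +i* rsum (Im \o f).

Lemma rsummable_le u v :
  (forall i, `|u i| <= `|v i|) -> rsummable v -> rsummable u.
Proof.
move=> uv; apply: le_lt_trans; apply: le_esum => i _ /=.
by rewrite !lee_fin.
Qed.

Lemma rsummableD u v : rsummable u -> rsummable v -> rsummable (u \+ v).
Proof. by move=> su sv; have := summableD su sv. Qed.

Lemma esumZ u c : 0 <= c -> (forall i, 0 <= u i) ->
  \esum_(i in [set: I]) (c * u i)%:E = (c%:E * \esum_(i in [set: I]) (u i)%:E)%E.
Proof.
move=> c0 u0.
have key (d : R) (w : I -> R) : 0 <= d -> (forall i, 0 <= w i) ->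
  (\esum_(i in [set: I]) (d * w i)%:E <= d%:E * \esum_(i in [set: I]) (w i)%:E)%E.
  move=> d0 w0; apply: ge_ereal_sup => _ [X [finX XI]] <-.
  under eq_fsbigr do rewrite EFinM.
  rewrite fsbig_finite//= -ge0_sume_distrr//; last first.
    by move=> i _; rewrite lee_fin.
  apply: lee_wpmul2l; first by rewrite lee_fin.
  rewrite -fsbig_finite//=.
  by apply: ereal_sup_ubound; exists X.
apply/eqP; rewrite eq_le key//=.
have [->|cN0] := eqVneq c 0.
  by rewrite mul0e; apply: esum_ge0 => i _; rewrite mul0r.
have c_gt0 : 0 < c by rewrite lt_neqAle eq_sym cN0.
rewrite -lee_pdivlMl//.
apply: le_trans (key _ _ _ _); last 2 first.
- by rewrite invr_ge0.
- by move=> i; rewrite mulr_ge0.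
by apply: le_esum => i _; rewrite mulrA mulVf// mul1r.
Qed.

Lemma rsummableZ u c : rsummable u -> rsummable (fun i => c * u i).
Proof.
rewrite /rsummable /summable => su.
rewrite (eq_esum (b := fun i => (`|c| * `|u i|)%:E)); last first.
  by move=> i _ /=; rewrite normrM.
rewrite esumZ//.
by rewrite (lte_mul_pinfty _ _ su)// lee_fin.
Qed.

Lemma nnsumE u : (forall i, 0 <= u i) -> rsummable u ->
  \esum_(i in [set: I]) (u i)%:E = (nnsum u)%:E.
Proof.
move=> u0; rewrite /rsummable summableE => su; rewrite /nnsum fineK//.
by move: su; rewrite (eq_esum (b := EFin \o u))// => i _ /=; rewrite ger0_norm.
Qed.

Lemma nnsum_ge0 u : (forall i, 0 <= u i) -> 0 <= nnsum u.
Proof. by move=> u0; apply/fine_ge0/esum_ge0 => i _; rewrite lee_fin. Qed.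

Lemma nnsumD u v : (forall i, 0 <= u i) -> (forall i, 0 <= v i) ->
  rsummable u -> rsummable v -> nnsum (u \+ v) = nnsum u + nnsum v.
Proof.
move=> u0 v0 su sv; apply: EFin_inj; rewrite -nnsumE/=; last 2 first.
- by move=> i; rewrite addr_ge0.
- exact: rsummableD.
by rewrite EFinD -!nnsumE// -esumD// => i _; rewrite lee_fin.
Qed.

Lemma nnsumZ u c : 0 <= c -> (forall i, 0 <= u i) -> rsummable u ->
  nnsum (fun i => c * u i) = c * nnsum u.
Proof.
move=> c0 u0 su; apply: EFin_inj; rewrite -nnsumE; last 2 first.
- by move=> i; rewrite mulr_ge0.
- exact: rsummableZ.
by rewrite esumZ// EFinM -nnsumE.
Qed.

Lemma le_nnsum u v : (forall i, 0 <= u i <= v i) -> rsummable v ->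
  nnsum u <= nnsum v.
Proof.
move=> uv sv; have u0 i : 0 <= u i by have /andP[] := uv i.
have v0 i : 0 <= v i by have /andP[/le_trans h /h] := uv i.
have su : rsummable u.
  by apply: rsummable_le sv => i; rewrite !ger0_norm//; have /andP[] := uv i.
rewrite -lee_fin -!nnsumE//; apply: le_esum => i _; rewrite lee_fin.
by have /andP[] := uv i.
Qed.

Lemma nnsum_ge u i : (forall i, 0 <= u i) -> rsummable u -> u i <= nnsum u.
Proof.
move=> u0 su; rewrite -lee_fin -nnsumE//; apply: esum_ge.
by exists [set i]; [split|rewrite fsbig_set1].
Qed.

Lemma rsummable_pos u : rsummable u -> rsummable (fun i => Num.max (u i) 0).
Proof.
apply: rsummable_le => i; rewrite ger0_norm ?le_max ?lexx ?orbT//.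
by rewrite ge_max ler_norm normr_ge0.
Qed.

Lemma rsummableN u : rsummable u -> rsummable (fun i => - u i).
Proof. by apply: rsummable_le => i; rewrite normrN. Qed.

Lemma rsum_nnsum u v w : (forall i, 0 <= v i) -> (forall i, 0 <= w i) ->
  rsummable v -> rsummable w -> (forall i, u i = v i - w i) ->
  rsum u = nnsum v - nnsum w.
Proof.
move=> v0 w0 sv sw uE.
have su : rsummable u.
  have -> : u = v \+ (fun i => - w i) by apply/funext.
  by apply: rsummableD => //; exact: rsummableN.
have m0 (x : R) : 0 <= Num.max x 0 by rewrite le_max lexx orbT.
have : nnsum ((fun i => Num.max (u i) 0) \+ w) =
       nnsum ((fun i => Num.max (- u i) 0) \+ v).
  congr nnsum; apply/funext => i /=; rewrite uE.
  by case: (leP (v i - w i) 0); case: (leP (- (v i - w i)) 0); lra.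
rewrite !nnsumD//; try exact: rsummable_pos.
  by rewrite /rsum; lra.
exact/rsummable_pos/rsummableN.
Qed.

Lemma rsumE u : (forall i, 0 <= u i) -> rsummable u -> rsum u = nnsum u.
Proof.
move=> u0 su; rewrite (rsum_nnsum (v := u) (w := fun=> 0))//.
- rewrite (_ : nnsum (fun=> 0) = 0) ?subr0//.
  by rewrite /nnsum esum1.
- by rewrite /rsummable /summable esum1// => i _ /=; rewrite normr0.
- by move=> i; rewrite subr0.
Qed.

Lemma rsumD u v : rsummable u -> rsummable v ->
  rsum (u \+ v) = rsum u + rsum v.
Proof.
move=> su sv.
have m0 (x : R) : 0 <= Num.max x 0 by rewrite le_max lexx orbT.
rewrite (rsum_nnsum
  (v := (fun i => Num.max (u i) 0) \+ (fun i => Num.max (v i) 0))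
  (w := (fun i => Num.max (- u i) 0) \+ (fun i => Num.max (- v i) 0))).
- rewrite !nnsumD//; try exact: rsummable_pos; try exact/rsummable_pos/rsummableN.
  by rewrite /rsum; lra.
- by move=> i; rewrite addr_ge0.
- by move=> i; rewrite addr_ge0.
- by apply: rsummableD; exact: rsummable_pos.
- by apply: rsummableD; exact/rsummable_pos/rsummableN.
- move=> i /=; case: (leP (u i) 0); case: (leP (- u i) 0);
  case: (leP (v i) 0); case: (leP (- v i) 0); lra.
Qed.

Lemma rsumN u : rsummable u -> rsum (fun i => - u i) = - rsum u.
Proof.
move=> su; rewrite /rsum opprB; congr (_ - nnsum _).
by apply/funext => i; rewrite opprK.
Qed.

Lemma rsumZ u c : rsummable u -> rsum (fun i => c * u i) = c * rsum u.
Proof.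
have pos d w : 0 <= d -> rsummable w -> rsum (fun i => d * w i) = d * rsum w.
  have m0 (x : R) : 0 <= Num.max x 0 by rewrite le_max lexx orbT.
  move=> d0 sw; rewrite (rsum_nnsum (v := fun i => d * Num.max (w i) 0)
    (w := fun i => d * Num.max (- w i) 0)).
  - rewrite !nnsumZ// ?mulrBr//; first exact/rsummable_pos/rsummableN.
    exact/rsummable_pos.
  - by move=> i; rewrite mulr_ge0.
  - by move=> i; rewrite mulr_ge0.
  - exact/rsummableZ/rsummable_pos.
  - exact/rsummableZ/rsummable_pos/rsummableN.
  - move=> i; rewrite -mulrBr; congr (_ * _).
    by case: (leP (w i) 0); case: (leP (- w i) 0); lra.
move=> su; have [c0|/ltW c0] := leP 0 c; first exact: pos.
rewrite (_ : (fun i => c * u i) = (fun i => - ((- c) * u i))); last first.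
  by apply/funext => i; rewrite mulNr opprK.
rewrite rsumN; last exact: rsummableZ.
by rewrite pos ?oppr_ge0// mulNr opprK.
Qed.

Lemma csummableD f g : csummable f -> csummable g -> csummable (f \+ g).
Proof.
have ReD : Re \o (f \+ g) = (Re \o f) \+ (Re \o g).
  by apply/funext => i /=; case: (f i) (g i) => [a b] [c d].
have ImD : Im \o (f \+ g) = (Im \o f) \+ (Im \o g).
  by apply/funext => i /=; case: (f i) (g i) => [a b] [c d].
by move=> [rf jf] [rg jg]; split; rewrite ?ReD ?ImD; exact: rsummableD.
Qed.

Lemma csumD f g : csummable f -> csummable g ->
  csum (f \+ g) = csum f + csum g.
Proof.
move=> [rf jf] [rg jg].
have ReD : Re \o (f \+ g) = (Re \o f) \+ (Re \o g).
  by apply/funext => i /=; case: (f i) (g i) => [a b] [c d].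
have ImD : Im \o (f \+ g) = (Im \o f) \+ (Im \o g).
  by apply/funext => i /=; case: (f i) (g i) => [a b] [c d].
by rewrite /csum ReD ImD !rsumD.
Qed.

Lemma csumZ f c : csummable f -> csum (fun i => c * f i) = c * csum f.
Proof.
case: c => x y [rf jf].
rewrite /csum; set A := Re \o f; set B := Im \o f.
rewrite (_ : Re \o _ = (fun i => x * A i) \+ (fun i => - y * B i)); last first.
  by apply/funext => i /=; rewrite /A/B/=; case: (f i) => a b /=; rewrite mulNr.
rewrite (_ : Im \o _ = (fun i => x * B i) \+ (fun i => y * A i)); last first.
  by apply/funext => i /=; rewrite /A/B/=; case: (f i) => a b /=.
rewrite !rsumD; try exact: rsummableZ.
by rewrite !rsumZ//; simpc.
Qed.

Lemma csum_conj f : csummable f -> csum (fun i => conjc (f i)) = conjc (csum f).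
Proof.
move=> [rf jf]; rewrite /csum /=.
rewrite (_ : Re \o _ = Re \o f); last first.
  by apply/funext => i /=; case: (f i).
rewrite (_ : Im \o _ = (fun i => - (Im \o f) i)) ?rsumN//.
by apply/funext => i /=; case: (f i).
Qed.

End Summation.

Section L2.
Variables (R : realType) (I : choiceType).

Definition sqsummable (f : I -> R[i]) := rsummable (fun i => normc (f i) ^+ 2).

Definition l2_pred : {pred I -> R[i]} := fun f => `[< sqsummable f >].

Record l2 := L2 { l2fun :> I -> R[i]; l2funP : l2fun \in l2_pred }.

HB.instance Definition _ := [isSub for l2fun].
HB.instance Definition _ := [Choice of l2 by <:].

Lemma normc2 (z : R[i]) : normc z ^+ 2 = Re z ^+ 2 + Im z ^+ 2.
Proof. by case: z => a b; rewrite /= sqr_sqrtr// addr_ge0// sqr_ge0. Qed.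

Lemma normc_ge0 (z : R[i]) : 0 <= normc z.
Proof. by case: z => a b; rewrite /= sqrtr_ge0. Qed.

Lemma normcC (z : R[i]) : `|z| = (normc z)%:C.
Proof. by case: z. Qed.

Lemma sqsummableZ c f : sqsummable f -> sqsummable (fun i => c * f i).
Proof.
move=> sf; rewrite /sqsummable.
under eq_fun do rewrite Normc.normcM exprMn.
exact: rsummableZ.
Qed.

Lemma sqsummableD f g : sqsummable f -> sqsummable g ->
  sqsummable (fun i => f i + g i).
Proof.
move=> sf sg.
have h : rsummable (fun i => 2 * (normc (f i) ^+ 2 + normc (g i) ^+ 2)).
  by apply: rsummableZ; exact: rsummableD.
apply: rsummable_le h => i; rewrite !normc2 !ger0_norm.
- case: (f i) (g i) => [a b] [c d] /=.
  have := sqr_ge0 (a - c); have := sqr_ge0 (b - d); rewrite !expr2; lra.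
- by rewrite mulr_ge0// !addr_ge0// sqr_ge0.
- by rewrite addr_ge0// sqr_ge0.
Qed.

Lemma l2_submod_closed : submod_closed l2_pred.
Proof.
split=> [|c f g /asboolP sf /asboolP sg]; apply/asboolP; last first.
  exact: (sqsummableD (sqsummableZ c sf) sg).
rewrite /sqsummable /rsummable /summable esum1// => i _ /=.
by rewrite expr0n /= addr0 sqrtr0 expr0n normr0.
Qed.

HB.instance Definition _ :=
  GRing.SubChoice_isSubLmodule.Build R[i] (I -> R[i]) l2_pred l2
    l2_submod_closed.

Lemma conjcD (a b : R[i]) : conjc (a + b) = conjc a + conjc b.
Proof. exact: rmorphD. Qed.

Lemma conjcM (a b : R[i]) : conjc (a * b) = conjc a * conjc b.
Proof. exact: rmorphM. Qed.

Lemma conjcN (a : R[i]) : conjc (- a) = - conjc a.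
Proof. exact: rmorphN. Qed.

Implicit Types x y z : l2.

Lemma l2P x : sqsummable x.
Proof. exact/asboolP/l2funP. Qed.

Lemma l2D x y i : (x + y) i = x i + y i. Proof. by []. Qed.
Lemma l2N x i : (- x) i = - x i. Proof. by []. Qed.
Lemma l20 i : (0 : l2) i = 0. Proof. by []. Qed.
Lemma l2Z c x i : (c *: x) i = c * x i. Proof. by []. Qed.

Lemma l2_ext x y : (forall i, x i = y i) -> x = y.
Proof. by move=> xy; apply/val_inj/funext. Qed.

(* Linear in the first variable *)
Definition inner x y : R[i] := csum (fun i => x i * conjc (y i)).

Arguments inner : simpl never.

Definition l2norm x : R := Num.sqrt (nnsum (fun i => normc (x i) ^+ 2)).

Lemma csummable_inner x y : csummable (fun i => x i * conjc (y i)).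
Proof.
have h := rsummableD (l2P x) (l2P y).
have le (a b c d : R) :
    `|a * c + b * d| <= `|a ^+ 2 + b ^+ 2 + (c ^+ 2 + d ^+ 2)|.
  have h1 := sqr_ge0 (a - c); have h2 := sqr_ge0 (b - d).
  have h3 := sqr_ge0 (a + c); have h4 := sqr_ge0 (b + d).
  rewrite !expr2 in h1 h2 h3 h4 *; rewrite ler_norml.
  rewrite (@ger0_norm _ (_ + _)); last by rewrite -!expr2 !addr_ge0// sqr_ge0.
  by apply/andP; split; lra.
split; apply: rsummable_le h => i /=; rewrite !normc2.
  case: (x i) (y i) => [a b] [c d] /=.
  by rewrite (_ : _ - _ = a * c + b * d); [exact: le|ring].
case: (x i) (y i) => [a b] [c d] /=.
rewrite (_ : _ + b * c = a * (- d) + b * c); last by ring.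
by rewrite (addrC (c ^+ 2)) -(sqrrN d); exact: le.
Qed.

Lemma innerDl x y z : inner (x + y) z = inner x z + inner y z.
Proof.
rewrite /inner -csumD; [|exact: csummable_inner..].
by congr csum; apply/funext => i /=; rewrite mulrDl.
Qed.

Lemma innerZl c x y : inner (c *: x) y = c * inner x y.
Proof.
rewrite /inner -csumZ; last exact: csummable_inner.
by congr csum; apply/funext => i /=; rewrite mulrA.
Qed.

Lemma innerC x y : inner y x = conjc (inner x y).
Proof.
rewrite /inner -csum_conj; last exact: csummable_inner.
by congr csum; apply/funext => i /=; rewrite conjcM conjcK mulrC.
Qed.

Lemma innerDr x y z : inner x (y + z) = inner x y + inner x z.
Proof. by rewrite innerC innerDl conjcD -!innerC. Qed.

Lemma innerZr c x y : inner x (c *: y) = conjc c * inner x y.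
Proof. by rewrite innerC innerZl conjcM -innerC. Qed.

Lemma inner0l y : inner 0 y = 0.
Proof. by rewrite -(scale0r (0 : l2)) innerZl mul0r. Qed.

Lemma innerNl x y : inner (- x) y = - inner x y.
Proof. by rewrite -scaleN1r innerZl mulN1r. Qed.

Lemma innerNr x y : inner x (- y) = - inner x y.
Proof. by rewrite innerC innerNl conjcN -innerC. Qed.

Lemma nnsum_normc_ge0 x : 0 <= nnsum (fun i => normc (x i) ^+ 2).
Proof. by apply: nnsum_ge0 => i; rewrite sqr_ge0. Qed.

Lemma l2norm_ge0 x : 0 <= l2norm x.
Proof. exact: sqrtr_ge0. Qed.

Lemma l2normE x : inner x x = (l2norm x ^+ 2)%:C.
Proof.
rewrite /l2norm sqr_sqrtr ?nnsum_normc_ge0// /inner /csum.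
rewrite (_ : Re \o _ = (fun i => normc (x i) ^+ 2)); last first.
  by apply/funext => i; rewrite normc2 /=; case: (x i) => a b /=; ring.
rewrite (_ : Im \o _ = (fun i => 0 * normc (x i) ^+ 2)); last first.
  by apply/funext => i; rewrite /=; case: (x i) => a b /=; ring.
rewrite rsumZ ?mul0r; last exact: l2P.
by rewrite rsumE//; [move=> i; rewrite sqr_ge0|exact: l2P].
Qed.

Lemma l2norm_eq0 x : l2norm x = 0 -> x = 0.
Proof.
move=> x0; apply: l2_ext => i; apply: Normc.eq0_normc; apply/eqP.
rewrite -sqrf_eq0; apply/eqP/le_anti; rewrite sqr_ge0 andbT.
have := @nnsum_ge _ _ (fun i => normc (x i) ^+ 2) i
  (fun i => sqr_ge0 (normc (x i))) (l2P x).
by move: x0 => /(congr1 (fun t => t ^+ 2));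
  rewrite sqr_sqrtr ?nnsum_normc_ge0// expr0n/= => ->.
Qed.

Lemma inner_eq0 x : (forall y, inner x y = 0) -> x = 0.
Proof.
move=> /(_ x); rewrite l2normE => -[] /eqP.
by rewrite sqrf_eq0 => /eqP; exact: l2norm_eq0.
Qed.

Lemma l2normZ c x : l2norm (c *: x) = normc c * l2norm x.
Proof.
apply/eqP; rewrite -(@eqrXn2 _ 2)//; last 2 first.
- exact: l2norm_ge0.
- by rewrite mulr_ge0 ?normc_ge0 ?l2norm_ge0.
apply/eqP/complexI; rewrite exprMn -l2normE innerZl innerZr mulrA l2normE.
rewrite [RHS]rmorphM/=; congr (_ * _).
by rewrite normc2; case: (c) => a b /=; simpc; congr (_ +i* _); ring.
Qed.

Lemma inner_le x y : normc (inner x y) <= l2norm x * l2norm y.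
Proof.
have [/l2norm_eq0 ->|yN0] := eqVneq (l2norm y) 0.
  by rewrite -(scale0r (0 : l2)) innerZr conjc0 mul0r Normc.normc0
     mulr_ge0// l2norm_ge0.
have y_gt0 : 0 < l2norm y by rewrite lt_neqAle eq_sym yN0 l2norm_ge0.
set N := l2norm y in yN0 y_gt0 *.
set w := inner x y.
set z := (N ^+ 2)%:C *: x - w *: y.
have : inner z z = (N ^+ 2)%:C * ((N ^+ 2)%:C * (l2norm x ^+ 2)%:C - w * conjc w).
  rewrite /z innerDl !innerDr !innerNl !innerNr !innerZl !innerZr.
  rewrite !l2normE -/N (innerC x y) -/w conjc_real; ring.
have -> : w * conjc w = (normc w ^+ 2)%:C.
  by rewrite normc2; case: (w) => a b /=; simpc; congr (_ +i* _); ring.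
rewrite l2normE -!rmorphM -rmorphB -rmorphM => /complexI zE.
have : 0 <= N ^+ 2 * (N ^+ 2 * l2norm x ^+ 2 - normc w ^+ 2).
  by rewrite -zE sqr_ge0.
rewrite pmulr_rge0 ?exprn_gt0// subr_ge0 -exprMn mulrC.
by rewrite ler_pXn2r// nnegrE ?normc_ge0// mulr_ge0// l2norm_ge0.
Qed.

Lemma l2normD x y : l2norm (x + y) <= l2norm x + l2norm y.
Proof.
rewrite -(@ler_pXn2r _ 2)// ?nnegrE ?addr_ge0 ?l2norm_ge0//.
rewrite -lecR -l2normE innerDl !innerDr !l2normE (innerC x y).
have := inner_le x y; set w := inner x y.
have : Re w <= normc w.
  by rewrite (le_trans (ler_norm _))// -lecR -normcC; exact: normc_ge_Re.
case: w => a b; simpc => /= ab le; rewrite sqrrD; lra.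
Qed.

Lemma l2norm0 : l2norm 0 = 0.
Proof. by rewrite -(scale0r (0 : l2)) l2normZ Normc.normc0 mul0r. Qed.

End L2.

Section BoundedOperators.
Variables (R : realType) (I : choiceType).
Local Notation H := (l2 R I).

(* Every bounded operator on a Hilbert space has an adjoint; bundling it makes
   the involution of B(l2) definitional. The adjoint is determined by the
   operator (lemma bop_ext). *)
Record bop := Bop {
  bop_fun :> H -> H;
  bop_adj : H -> H;
  bop_linear : linear bop_fun;
  bop_bounded : exists M : R, forall x, l2norm (bop_fun x) <= M * l2norm x;
  bop_adjE : forall x y, inner (bop_fun x) y = inner x (bop_adj y) }.

Implicit Types A B : bop.

HB.instance Definition _ := gen_eqMixin bop.
HB.instance Definition _ := gen_choiceMixin bop.

Lemma inner_inj (x y : H) : (forall z, inner z x = inner z y) -> x = y.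
Proof.
move=> xy; apply/eqP; rewrite -subr_eq0; apply/eqP/inner_eq0 => z.
by rewrite innerC innerDr innerNr xy subrr conjc0.
Qed.

Lemma bop_ext A B : (forall x, A x = B x) -> A = B.
Proof.
case: A B => [f fa fl fb fE] [g ga gl gb gE] /= fg.
have {}fg : f = g by apply/funext.
subst g; have fga : fa = ga.
  by apply/funext => y; apply: inner_inj => x; rewrite -fE -gE.
subst ga; congr Bop; exact: Prop_irrelevance.
Qed.

Lemma bopD A x y : A (x + y) = A x + A y.
Proof. by have := bop_linear A 1 x y; rewrite !scale1r. Qed.

Lemma bop0 A : A 0 = 0.
Proof. by apply: (addrI (A 0)); rewrite -bopD !addr0. Qed.

Lemma bopZ A c x : A (c *: x) = c *: A x.
Proof. by have := bop_linear A c x 0; rewrite bop0 !addr0. Qed.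

Lemma bop_bounded_ge0 A :
  exists2 M : R, 0 <= M & forall x, l2norm (A x) <= M * l2norm x.
Proof.
have [M AM] := bop_bounded A; exists `|M| => // x.
by rewrite (le_trans (AM x))// ler_wpM2r ?l2norm_ge0// ler_norm.
Qed.

Lemma star_linear A : linear (bop_adj A).
Proof.
move=> c x y; apply: inner_inj => z.
by rewrite -bop_adjE !innerDr !innerZr !bop_adjE.
Qed.

Lemma star_bounded A :
  exists M : R, forall x, l2norm (bop_adj A x) <= M * l2norm x.
Proof.
have [M M0 AM] := bop_bounded_ge0 A; exists M => x.
set y := bop_adj A x.
have [->|yN0] := eqVneq (l2norm y) 0; first by rewrite mulr_ge0// l2norm_ge0.
have y_gt0 : 0 < l2norm y by rewrite lt_neqAle eq_sym yN0 l2norm_ge0.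
rewrite -(ler_pM2l y_gt0) -expr2.
have -> : l2norm y ^+ 2 = normc (inner (A y) x).
  by rewrite bop_adjE l2normE /= expr0n addr0 sqrtr_sqr ger0_norm// sqr_ge0.
rewrite (le_trans (inner_le _ _))// mulrA ler_wpM2r ?l2norm_ge0//.
by rewrite mulrC (le_trans (AM y))// mulrC.
Qed.

Lemma star_adjE A x y : inner (bop_adj A x) y = inner x (A y).
Proof. by rewrite innerC -bop_adjE -innerC. Qed.

Definition star A : bop := Bop (star_linear A) (star_bounded A) (star_adjE A).

Fact zero_linear : linear (fun _ : H => 0 : H).
Proof. by move=> c x y; rewrite scaler0 addr0. Qed.
Fact zero_bounded :
  exists M : R, forall x : H, l2norm (0 : H) <= M * l2norm x.
Proof. by exists 0 => x; rewrite l2norm0 mul0r. Qed.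
Fact zero_adjE (x y : H) : inner 0 y = inner x 0.
Proof. by rewrite inner0l innerC inner0l conjc0. Qed.
Definition bop_zero := Bop zero_linear zero_bounded zero_adjE.

Fact one_linear : linear (fun x : H => x). Proof. by []. Qed.
Fact one_bounded :
  exists M : R, forall x : H, l2norm x <= M * l2norm x.
Proof. by exists 1 => x; rewrite mul1r. Qed.
Definition bop_one := Bop one_linear one_bounded (fun _ _ => erefl).

Fact opp_linear A : linear (fun x => - A x).
Proof. by move=> c x y; rewrite bop_linear opprD scalerN. Qed.
Fact opp_bounded A : exists M : R, forall x, l2norm (- A x) <= M * l2norm x.
Proof.
have [M _ AM] := bop_bounded_ge0 A; exists M => x.
by rewrite -scaleN1r l2normZ normcN Normc.normc1 mul1r.
Qed.
Fact opp_adjE A x y : inner (- A x) y = inner x (- bop_adj A y).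
Proof. by rewrite innerNl innerNr bop_adjE. Qed.
Definition bop_opp A := Bop (opp_linear A) (opp_bounded A) (opp_adjE A).

Fact add_linear A B : linear (fun x => A x + B x).
Proof. by move=> c x y; rewrite !bop_linear scalerDr addrACA. Qed.
Fact add_bounded A B :
  exists M : R, forall x, l2norm (A x + B x) <= M * l2norm x.
Proof.
have [M _ AM] := bop_bounded_ge0 A; have [N _ BN] := bop_bounded_ge0 B.
exists (M + N) => x; rewrite (le_trans (l2normD _ _))// mulrDl.
exact: lerD.
Qed.
Fact add_adjE A B x y :
  inner (A x + B x) y = inner x (bop_adj A y + bop_adj B y).
Proof. by rewrite innerDl innerDr !bop_adjE. Qed.
Definition bop_add A B :=
  Bop (add_linear A B) (add_bounded A B) (add_adjE A B).

Fact scale_linear c A : linear (fun x => c *: A x).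
Proof. by move=> d x y; rewrite bop_linear scalerDr !scalerA mulrC. Qed.
Fact scale_bounded c A :
  exists M : R, forall x, l2norm (c *: A x) <= M * l2norm x.
Proof.
have [M _ AM] := bop_bounded_ge0 A; exists (normc c * M) => x.
by rewrite l2normZ -mulrA ler_wpM2l// normc_ge0.
Qed.
Fact scale_adjE c A x y :
  inner (c *: A x) y = inner x (conjc c *: bop_adj A y).
Proof. by rewrite innerZl innerZr conjcK bop_adjE. Qed.
Definition bop_scale c A :=
  Bop (scale_linear c A) (scale_bounded c A) (scale_adjE c A).

Fact mul_linear A B : linear (fun x => A (B x)).
Proof. by move=> c x y; rewrite !bop_linear. Qed.
Fact mul_bounded A B :
  exists M : R, forall x, l2norm (A (B x)) <= M * l2norm x.
Proof.
have [M M0 AM] := bop_bounded_ge0 A; have [N _ BN] := bop_bounded_ge0 B.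
by exists (M * N) => x; rewrite (le_trans (AM _))// -mulrA ler_wpM2l.
Qed.
Fact mul_adjE A B x y :
  inner (A (B x)) y = inner x (bop_adj B (bop_adj A y)).
Proof. by rewrite !bop_adjE. Qed.
Definition bop_mul A B :=
  Bop (mul_linear A B) (mul_bounded A B) (mul_adjE A B).

Fact bop_addA : associative bop_add.
Proof. by move=> A B C; apply: bop_ext => x /=; rewrite addrA. Qed.
Fact bop_addC : commutative bop_add.
Proof. by move=> A B; apply: bop_ext => x /=; rewrite addrC. Qed.
Fact bop_add0 : left_id bop_zero bop_add.
Proof. by move=> A; apply: bop_ext => x /=; rewrite add0r. Qed.
Fact bop_addN : left_inverse bop_zero bop_opp bop_add.
Proof. by move=> A; apply: bop_ext => x /=; rewrite addNr. Qed.

HB.instance Definition _ :=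
  GRing.isZmodule.Build bop bop_addA bop_addC bop_add0 bop_addN.

Fact bop_mulA : associative bop_mul.
Proof. by move=> A B C; apply: bop_ext. Qed.
Fact bop_mul1l : left_id bop_one bop_mul.
Proof. by move=> A; apply: bop_ext. Qed.
Fact bop_mul1r : right_id bop_one bop_mul.
Proof. by move=> A; apply: bop_ext. Qed.
Fact bop_mulDl : left_distributive bop_mul bop_add.
Proof. by move=> A B C; apply: bop_ext. Qed.
Fact bop_mulDr : right_distributive bop_mul bop_add.
Proof. by move=> A B C; apply: bop_ext => x /=; rewrite bopD. Qed.

HB.instance Definition _ := GRing.Zmodule_isPzRing.Build bop
  bop_mulA bop_mul1l bop_mul1r bop_mulDl bop_mulDr.

Fact bop_scaleA c d A : bop_scale c (bop_scale d A) = bop_scale (c * d) A.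
Proof. by apply: bop_ext => x /=; rewrite scalerA. Qed.
Fact bop_scale1 : left_id 1 bop_scale.
Proof. by move=> A; apply: bop_ext => x /=; rewrite scale1r. Qed.
Fact bop_scaleDr : right_distributive bop_scale +%R.
Proof. by move=> c A B; apply: bop_ext => x /=; rewrite scalerDr. Qed.
Fact bop_scaleDl A : {morph bop_scale^~ A : c d / c + d}.
Proof. by move=> c d; apply: bop_ext => x /=; rewrite scalerDl. Qed.

HB.instance Definition _ := GRing.Zmodule_isLmodule.Build R[i] bop
  bop_scaleA bop_scale1 bop_scaleDr bop_scaleDl.

Lemma bop_addE A B x : (A + B) x = A x + B x. Proof. by []. Qed.
Lemma bop_oppE A x : (- A) x = - A x. Proof. by []. Qed.
Lemma bop_scaleE c A x : (c *: A) x = c *: A x. Proof. by []. Qed.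
Lemma bop_mulE A B x : (A * B) x = A (B x). Proof. by []. Qed.
Lemma bop_oneE x : (1 : bop) x = x. Proof. by []. Qed.

Definition opnorm A : R := sup [set l2norm (A x) | x in [set x | l2norm x <= 1]].

Fact opnorm_has_sup A :
  has_sup [set l2norm (A x) | x in [set x | l2norm x <= 1]].
Proof.
split; first by exists (l2norm (A 0)), 0 => //=; rewrite l2norm0 ler01.
have [M M0 AM] := bop_bounded_ge0 A; exists M => _ [x /= x1 <-].
by rewrite (le_trans (AM x))// ler_piMr.
Qed.

Lemma opnorm_ge0 A : 0 <= opnorm A.
Proof.
apply: ub_le_sup; first by have [] := opnorm_has_sup A.
by exists 0; rewrite /= ?l2norm0 ?ler01// bop0 l2norm0.
Qed.

Lemma opnormP A x : l2norm (A x) <= opnorm A * l2norm x.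
Proof.
have [/l2norm_eq0 ->|xN0] := eqVneq (l2norm x) 0.
  by rewrite bop0 l2norm0 mulr0.
have x_gt0 : 0 < l2norm x by rewrite lt_neqAle eq_sym xN0 l2norm_ge0.
have nV : normc (l2norm x)^-1%:C = (l2norm x)^-1.
  by rewrite /= expr0n addr0 sqrtr_sqr ger0_norm// invr_ge0 l2norm_ge0.
rewrite -ler_pdivrMr// mulrC -nV -l2normZ -bopZ.
apply: ub_le_sup; first by have [] := opnorm_has_sup A.
by exists ((l2norm x)^-1%:C *: x) => //=; rewrite l2normZ nV mulVf.
Qed.

Lemma opnorm_le A M : 0 <= M -> (forall x, l2norm (A x) <= M * l2norm x) ->
  opnorm A <= M.
Proof.
move=> M0 AM; apply: ge_sup; first by have [] := opnorm_has_sup A.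
by move=> _ [x /= x1 <-]; rewrite (le_trans (AM x))// ler_piMr.
Qed.

Lemma opnormD A B : opnorm (A + B) <= opnorm A + opnorm B.
Proof.
apply: opnorm_le => [|x]; first by rewrite addr_ge0// opnorm_ge0.
rewrite (le_trans (l2normD _ _))// mulrDl.
by apply: lerD; exact: opnormP.
Qed.

Lemma opnorm_eq0 A : opnorm A = 0 -> A = 0.
Proof.
move=> A0; apply: bop_ext => x; apply: l2norm_eq0; apply/le_anti.
by rewrite l2norm_ge0 andbT; have := opnormP A x; rewrite A0 mul0r.
Qed.

Lemma opnormZ_le c A : opnorm (c *: A) <= normc c * opnorm A.
Proof.
apply: opnorm_le => [|x]; first by rewrite mulr_ge0 ?normc_ge0 ?opnorm_ge0.
by rewrite l2normZ -mulrA ler_wpM2l ?normc_ge0// opnormP.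
Qed.

Lemma opnormZ c A : opnorm (c *: A) = normc c * opnorm A.
Proof.
have [->|cN0] := eqVneq c 0.
  rewrite scale0r Normc.normc0 mul0r; apply/le_anti; rewrite opnorm_ge0 andbT.
  by apply: opnorm_le => // x; rewrite l2norm0 mul0r.
apply/le_anti; rewrite opnormZ_le /=.
have c_gt0 : 0 < normc c.
  rewrite lt_neqAle normc_ge0 andbT eq_sym; apply: contra_neq cN0.
  exact: Normc.eq0_normc.
rewrite mulrC -ler_pdivlMr// mulrC -Normc.normcV.
by apply: le_trans (opnormZ_le _ _); rewrite scalerA mulVf// scale1r.
Qed.

Definition bop_norm A : R[i] := (opnorm A)%:C.

Fact bop_normD A B : bop_norm (A + B) <= bop_norm A + bop_norm B.
Proof. by rewrite /bop_norm -rmorphD lecR opnormD. Qed.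
Fact bop_normZ c A : bop_norm (c *: A) = `|c| * bop_norm A.
Proof. by rewrite /bop_norm opnormZ rmorphM normcC. Qed.
Fact bop_norm_eq0 A : bop_norm A = 0 -> A = 0.
Proof. by move=> /complexI/opnorm_eq0. Qed.

HB.instance Definition _ := normed_module.Lmodule_isNormed.Build R[i] bop
  bop_normD bop_normZ bop_norm_eq0.

End BoundedOperators.

Section ShiftsAndDiagonals.
Variables (R : realType) (I : choiceType).
Local Notation H := (l2 R I).

Lemma nnsum_reindex (h : I -> I) (u : I -> R) : injective h ->
  (forall j, ~ (exists i, h i = j) -> u j = 0) ->
  \esum_(j in [set: I]) (u j)%:E = \esum_(i in [set: I]) (u (h i))%:E.
Proof.
move=> hI u0.
have hI' : set_inj [set: I] h by move=> x y _ _; exact: hI.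
rewrite -(esum_image [set: I] h (fun j => (u j)%:E) hI') [RHS]esum_mkcond.
apply: eq_esum => j _; case: ifPn => //.
rewrite notin_setE => jh; rewrite u0//.
by move=> [i hij]; apply: jh; exists i.
Qed.

Definition push (h : I -> I) (f : I -> R[i]) (j : I) : R[i] :=
  if pselect (exists i, h i = j) is left P then f (projT1 (cid P)) else 0.

Lemma push_at h f i : injective h -> push h f (h i) = f i.
Proof.
move=> hI; rewrite /push; case: pselect => [P|[]]; last by exists i.
by case: cid => k /= /hI ->.
Qed.

Lemma push_out h f j : ~ (exists i, h i = j) -> push h f j = 0.
Proof. by rewrite /push; case: pselect. Qed.

Lemma rsummable_reindex (h : I -> I) (u : I -> R) : injective h ->
  (forall j, ~ (exists i, h i = j) -> u j = 0) ->
  rsummable u <-> rsummable (u \o h).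
Proof.
move=> hI u0; rewrite /rsummable /summable.
by rewrite (@nnsum_reindex h (fun j => `|u j|))// => j /u0 ->; rewrite normr0.
Qed.

Lemma rsum_reindex (h : I -> I) (u : I -> R) : injective h ->
  (forall j, ~ (exists i, h i = j) -> u j = 0) -> rsum u = rsum (u \o h).
Proof.
move=> hI u0; rewrite /rsum /nnsum; congr (fine _ - fine _).
  by apply: (@nnsum_reindex h) => // j /u0 ->; rewrite maxxx.
by apply: (@nnsum_reindex h) => // j /u0 ->; rewrite oppr0 maxxx.
Qed.

Variables (h : I -> I) (hI : injective h).

Fact push_subproof (f : H) : push h f \in @l2_pred R I.
Proof.
apply/asboolP; apply/(rsummable_reindex hI).
  by move=> j /push_out ->; rewrite Normc.normc0 expr0n.
rewrite (_ : _ \o h = fun i => normc (f i) ^+ 2); first exact: l2P.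
by apply/funext => i /=; rewrite push_at.
Qed.

Definition l2push (f : H) : H := L2 (push_subproof f).

Fact pull_subproof (f : H) : (f \o h) \in @l2_pred R I.
Proof.
apply/asboolP; set u := push h (fun i => f (h i)).
have : rsummable (fun j => normc (u j) ^+ 2).
  apply: rsummable_le (l2P f) => j.
  have [[i <-]|nj] := pselect (exists i, h i = j).
    by rewrite /u push_at.
  by rewrite /u push_out// Normc.normc0 expr0n normr0.
rewrite (rsummable_reindex hI); last first.
  by move=> j nj; rewrite /u push_out// Normc.normc0 expr0n.
rewrite (_ : _ \o h = fun i => normc ((f \o h) i) ^+ 2)//.
by apply/funext => i /=; rewrite /u push_at.
Qed.

Definition l2pull (f : H) : H := L2 (pull_subproof f).

Fact l2push_linear : linear l2push.
Proof.
move=> c x y; apply: l2_ext => j.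
rewrite l2D l2Z /= /push; case: pselect => // _.
by rewrite mulr0 addr0.
Qed.

Fact l2push_norm x : l2norm (l2push x) = l2norm x.
Proof.
congr Num.sqrt; congr fine.
rewrite (nnsum_reindex hI); last first.
  by move=> j /push_out /= ->; rewrite Normc.normc0 expr0n.
by apply: eq_esum => i _ /=; rewrite push_at.
Qed.

Fact l2push_bounded : exists M : R, forall x, l2norm (l2push x) <= M * l2norm x.
Proof. by exists 1 => x; rewrite l2push_norm mul1r. Qed.

Fact l2push_adjE x y : inner (l2push x) y = inner x (l2pull y).
Proof.
rewrite /inner /csum; congr (_ +i* _); rewrite (rsum_reindex hI).
- by congr rsum; apply/funext => i /=; rewrite push_at.
- by move=> j /push_out /= ->; rewrite mul0r.
- by congr rsum; apply/funext => i /=; rewrite push_at.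
- by move=> j /push_out /= ->; rewrite mul0r.
Qed.

Definition shift_op : bop R I := Bop l2push_linear l2push_bounded l2push_adjE.

Lemma shift_out (f : H) j : ~ (exists i, h i = j) -> shift_op f j = 0.
Proof. exact: push_out. Qed.

Lemma shift_at (f : H) i : shift_op f (h i) = f i.
Proof. exact: push_at. Qed.

Lemma star_shift_at (f : H) i : star shift_op f i = f (h i).
Proof. by []. Qed.

Fact basis_subproof i : (fun j : I => (j == i)%:R : R[i]) \in @l2_pred R I.
Proof.
apply/asboolP; rewrite /sqsummable /rsummable /summable.
rewrite (_ : esum _ _ = \esum_(j in [set i]) (1 : R)%:E).
  by rewrite esum_set1 ?ltry// lee_fin.
rewrite [RHS]esum_mkcond; apply: eq_esum => j _ /=.
have [->|/eqP ji] := eqVneq j i.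
  by rewrite mem_set//= expr1n expr0n addr0 sqrtr1 expr1n normr1.
by rewrite memNset//= expr0n addr0 sqrtr0 expr0n normr0.
Qed.

Definition ebasis i : H := L2 (basis_subproof i).

Lemma shift_ebasis i : shift_op (ebasis i) = ebasis (h i).
Proof.
apply: l2_ext => j.
have [[k <-]|nj] := pselect (exists i, h i = j).
  by rewrite shift_at /= (inj_eq hI).
rewrite shift_out//=; case: eqP => // ji.
by exfalso; apply: nj; exists i.
Qed.

Variables (w : I -> R[i]) (w1 : forall i, normc (w i) = 1).

Fact diag_subproof (f : H) : (fun i => w i * f i) \in @l2_pred R I.
Proof.
apply/asboolP; apply: rsummable_le (l2P f) => i.
by rewrite Normc.normcM w1 mul1r.
Qed.

Definition l2diag (f : H) : H := L2 (diag_subproof f).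

Fact diagC_subproof (f : H) : (fun i => conjc (w i) * f i) \in @l2_pred R I.
Proof.
apply/asboolP; apply: rsummable_le (l2P f) => i.
rewrite Normc.normcM (_ : normc (conjc (w i)) = 1) ?mul1r//.
by rewrite -(w1 i); case: (w i) => a b /=; rewrite sqrrN.
Qed.

Definition l2diagC (f : H) : H := L2 (diagC_subproof f).

Fact l2diag_linear : linear l2diag.
Proof.
move=> c x y; apply: l2_ext => j.
by rewrite l2D l2Z /= mulrDr mulrCA.
Qed.

Fact l2diag_norm x : l2norm (l2diag x) = l2norm x.
Proof.
congr Num.sqrt; congr nnsum; apply/funext => i /=.
by rewrite Normc.normcM w1 mul1r.
Qed.

Fact l2diag_bounded : exists M : R, forall x, l2norm (l2diag x) <= M * l2norm x.
Proof. by exists 1 => x; rewrite l2diag_norm mul1r. Qed.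

Fact l2diag_adjE x y : inner (l2diag x) y = inner x (l2diagC y).
Proof.
congr csum; apply/funext => i /=.
by rewrite conjcM conjcK mulrA (mulrC (x i)).
Qed.

Definition diag_op : bop R I := Bop l2diag_linear l2diag_bounded l2diag_adjE.

End ShiftsAndDiagonals.

Section CstarSystems.
Variables (R : realType) (I : choiceType).
Local Notation B := (bop R I).
Implicit Types (A : set B) (sigma : R -> B -> B) (phi : B -> R[i]).

Definition cstar_subalgebra A :=
  [/\ forall (c : R[i]) x y, A x -> A y -> A (c *: x + y),
      forall x y, A x -> A y -> A (x * y),
      forall x, A x -> A (star x)
    & closed A].

Definition cstar_generated (G : set B) : set B := smallest cstar_subalgebra G.

(* Maps and functionals on a C*-subalgebra A are given by functions on B(l2);
   only their values on A matter. *)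
Record cstar_dynamics A sigma : Prop := CstarDynamics {
  dyn_stable : forall t x, A x -> A (sigma t x);
  dyn_linear : forall t (c : R[i]) x y, A x -> A y ->
    sigma t (c *: x + y) = c *: sigma t x + sigma t y;
  dyn_mul : forall t x y, A x -> A y ->
    sigma t (x * y) = sigma t x * sigma t y;
  dyn_star : forall t x, A x -> sigma t (star x) = star (sigma t x);
  dyn_zero : forall x, A x -> sigma 0 x = x;
  dyn_add : forall t u x, A x -> sigma (t + u) x = sigma t (sigma u x);
  dyn_continuous : forall x, A x -> continuous (fun t => sigma t x) }.

(* For a positive functional on a unital C*-algebra, norm one means phi 1 = 1;
   the unit of the Toeplitz algebra is the identity operator T_(0,1). *)
Record is_state A phi : Prop := IsState {
  state_linear : forall (c : R[i]) x y, A x -> A y ->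
    phi (c *: x + y) = c * phi x + phi y;
  state_ge0 : forall x, A x -> 0 <= phi (star x * x);
  state_one : phi 1 = 1 }.

(* Complex differentiability in operator norm; derivatives of an A-valued f stay
   in A, which is closed. *)
Definition entire (f : R[i] -> B) :=
  forall z : R[i], derivable (f : R[i]^o -> B) z 1.

Definition entire_extension A sigma (c : B) (f : R[i] -> B) :=
  [/\ forall z, A (f z), forall t : R, f t%:C = sigma t c & entire f].

Definition analytic A sigma (c : B) :=
  A c /\ exists f, entire_extension A sigma c f.

Definition ground_state A sigma phi :=
  is_state A phi /\
  forall c d f, analytic A sigma c -> analytic A sigma d ->
    entire_extension A sigma c f ->
    exists M : R, forall z : R[i], 0 < Im z -> normc (phi (d * f z)) <= M.

End CstarSystems.

Record posnat := Posnat { posnat_val :> nat; posnat_gt0 : (0 < posnat_val)%N }.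

HB.instance Definition _ := [isSub for posnat_val].
HB.instance Definition _ := [Choice of posnat by <:].

Definition posnat1 : posnat := @Posnat 1 isT.

Fact posnatM_gt0 (a b : posnat) : (0 < a * b)%N.
Proof. by rewrite muln_gt0 !posnat_gt0. Qed.

Definition posnatM (a b : posnat) : posnat := Posnat (posnatM_gt0 a b).

Definition posnat_prime (p : nat) (pP : prime p) : posnat :=
  Posnat (prime_gt0 pP).

(* The semigroup N x| N^x: carrier and product (m,a)(n,b) = (m + a n, a b) *)
Definition affine : choiceType := (nat * posnat)%type.

Definition affineM (x y : affine) : affine :=
  ((x.1 + x.2 * y.1)%N, posnatM x.2 y.2).

Lemma affineM_inj (y : affine) : injective (affineM y).
Proof.
case: y => m a [n b] [k c] /= [] /addnI /eqP.
rewrite eqn_pmul2l ?posnat_gt0// => /eqP -> /eqP.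
by rewrite eqn_pmul2l ?posnat_gt0// => /eqP/val_inj ->.
Qed.

Section ToeplitzAlgebra.
Variable R : realType.
Local Notation B := (bop R affine).

Definition Tiso (y : affine) : B := shift_op R (@affineM_inj y).

Lemma Tiso_ebasis (x y : affine) :
  Tiso y (ebasis R x) = ebasis R (affineM y x).
Proof. exact: shift_ebasis. Qed.

Definition toeplitz : set B := cstar_generated (range Tiso).

Definition iso_s : B := Tiso (1%N, posnat1).

Definition iso_v (a : posnat) : B := Tiso (0%N, a).

Definition expi (x : R) : R[i] := cos x +i* sin x.

Arguments expi : simpl never.

(* p^(it) is written as exp(i t ln p) *)
Record toeplitz_dynamics (sigma : R -> B -> B) : Prop := ToeplitzDynamics {
  tdyn_dynamics : cstar_dynamics toeplitz sigma;
  tdyn_s : forall t, sigma t iso_s = iso_s;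
  tdyn_v : forall t (p : nat) (pP : prime p),
    sigma t (iso_v (posnat_prime pP)) =
    expi (t * ln p%:R) *: iso_v (posnat_prime pP) }.

(* The rest of the section shows that such a dynamics exists: it is implemented
   by the unitaries U_t e_(m,a) = a^(it) e_(m,a). *)

Lemma expiD (x y : R) : expi (x + y) = expi x * expi y.
Proof.
rewrite /expi cosD sinD; simpc; congr (_ +i* _).
by rewrite addrC mulrC (mulrC (sin y)).
Qed.

Lemma expi0 : expi 0 = 1. Proof. by rewrite /expi cos0 sin0. Qed.

Lemma normc_expi (x : R) : normc (expi x) = 1.
Proof. by rewrite /expi /= cos2Dsin2 sqrtr1. Qed.

Lemma conjc_expi (x : R) : conjc (expi x) = expi (- x).
Proof. by rewrite /expi cosN sinN. Qed.

Definition phase (t : R) (x : affine) : R[i] := expi (t * ln (x.2 : nat)%:R).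

Definition Uop (t : R) : B :=
  @diag_op R affine (phase t) (fun x => normc_expi _).

Definition ad (t : R) (x : B) : B := Uop t * x * star (Uop t).

Lemma star_Uop t : star (Uop t) = Uop (- t).
Proof.
apply: bop_ext => f; apply: l2_ext => x /=.
by rewrite /phase mulNr /expi cosN sinN.
Qed.

Lemma UopD t u : Uop (t + u) = Uop t * Uop u.
Proof.
apply: bop_ext => f; apply: l2_ext => x /=.
by rewrite mulrA /phase mulrDl expiD.
Qed.

Lemma Uop0 : Uop 0 = 1.
Proof.
apply: bop_ext => f; apply: l2_ext => x /=.
by rewrite /phase mul0r expi0 mul1r.
Qed.

Lemma starM (x y : B) : star (x * y) = star y * star x.
Proof. exact: bop_ext. Qed.

Lemma starK (x : B) : star (star x) = x.
Proof. exact: bop_ext. Qed.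

Lemma starD (x y : B) : star (x + y) = star x + star y.
Proof. exact: bop_ext. Qed.

Lemma opnormM (x y : B) : opnorm (x * y) <= opnorm x * opnorm y.
Proof.
apply: opnorm_le => [|f]; first by rewrite mulr_ge0 ?opnorm_ge0.
rewrite (le_trans (opnormP x _))// -mulrA ler_wpM2l ?opnorm_ge0//.
exact: opnormP.
Qed.

Lemma opnorm_Uop t : opnorm (Uop t) <= 1.
Proof. by apply: opnorm_le => // f; rewrite l2diag_norm mul1r. Qed.

Implicit Types x y : B.

Lemma adV t x : ad t x = Uop t * x * Uop (- t).
Proof. by rewrite /ad star_Uop. Qed.

Lemma opnorm_ad t x : opnorm (ad t x) <= opnorm x.
Proof.
have h1 := ler_pM (opnorm_ge0 _) (opnorm_ge0 _) (opnormM (Uop t) x)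
  (opnorm_Uop (- t)).
have h2 := ler_wpM2r (opnorm_ge0 x) (opnorm_Uop t).
rewrite adV; apply: le_trans (opnormM _ _) _; apply: le_trans h1 _.
by rewrite mulr1; apply: le_trans h2 _; rewrite mul1r.
Qed.

Lemma ad_linear t c x y : ad t (c *: x + y) = c *: ad t x + ad t y.
Proof.
by apply: bop_ext => f; exact: (bop_linear (Uop t)).
Qed.

Lemma adB t x y : ad t (x - y) = ad t x - ad t y.
Proof. by rewrite /ad mulrBr mulrBl. Qed.

Lemma adM t x y : ad t (x * y) = ad t x * ad t y.
Proof.
rewrite !adV !mulrA -(mulrA (Uop t * x) (Uop (- t)) (Uop t)).
by rewrite -UopD addNr Uop0 mulr1.
Qed.

Lemma ad_star t x : ad t (star x) = star (ad t x).
Proof. by rewrite /ad !starM starK mulrA. Qed.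

Lemma ad0 x : ad 0 x = x.
Proof. by rewrite adV oppr0 Uop0 mul1r mulr1. Qed.

Lemma adD t u x : ad (t + u) x = ad t (ad u x).
Proof. by rewrite !adV UopD opprD (addrC (- t)) UopD !mulrA. Qed.

Lemma ad_Tiso t (y : affine) :
  ad t (Tiso y) = expi (t * ln (y.2 : nat)%:R) *: Tiso y.
Proof.
apply: bop_ext => f; apply: l2_ext => x; rewrite bop_scaleE l2Z /=.
have [[z <-]|nx] := pselect (exists z, affineM y z = x); last first.
  by rewrite !push_out// !mulr0.
rewrite !push_at; [|exact: affineM_inj..].
rewrite mulrA; congr (_ * _); rewrite /phase.
rewrite -[Complex _ _]/(conjc (expi (t * ln (z.2 : nat)%:R))).
rewrite conjc_expi -expiD; congr expi.
rewrite /= natrM lnM ?posrE ?ltr0n ?posnat_gt0//; ring.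
Qed.

Lemma closedBP (A : set B) : (forall x, (forall e : R, 0 < e ->
    exists2 y, A y & opnorm (x - y) < e) -> A x) -> closed A.
Proof.
move=> h x clx; apply: h => e e0.
have /clx[y [Ay]] : nbhs x (ball x e%:C).
  by apply: nbhsx_ballx; rewrite ltcR.
by rewrite -ball_normE /ball_/= ltcR; exists y.
Qed.

Lemma closedB_approx (A : set B) x : closed A ->
  (forall e : R, 0 < e -> exists2 y, A y & opnorm (x - y) < e) -> A x.
Proof.
move=> clA h; apply: clA => V /nbhs_ballP[e /= e0 xV].
have eE : e = (Re e)%:C by case: (e) e0 => a b; rewrite ltcE /= => /andP[/eqP ->].
have [|y Ay xy] := h (Re e); first by rewrite -ltcR -eE.
exists y; split => //; apply: xV.
by rewrite -ball_normE /ball_/= eE ltcR.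
Qed.

Lemma toeplitz_cstar : cstar_subalgebra toeplitz.
Proof.
split.
- by move=> c x y Tx Ty A [CA GA]; have [h _ _ _] := CA; apply: h;
    [exact: Tx|exact: Ty].
- by move=> x y Tx Ty A [CA GA]; have [_ h _ _] := CA; apply: h;
    [exact: Tx|exact: Ty].
- by move=> x Tx A [CA GA]; have [_ _ h _] := CA; apply: h; exact: Tx.
- by apply: closed_bigI => A [[_ _ _]].
Qed.

Lemma toeplitz_Tiso (y : affine) : toeplitz (Tiso y).
Proof. by move=> A [_]; apply; exists y. Qed.

Lemma opnormN (x : B) : opnorm (- x) = opnorm x.
Proof. by rewrite -scaleN1r opnormZ normcN Normc.normc1 mul1r. Qed.

Lemma opnorm_star (x : B) : opnorm (star x) <= opnorm x.
Proof.
apply: opnorm_le => [|f]; first exact: opnorm_ge0.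
set y := star x f.
have [->|yN0] := eqVneq (l2norm y) 0.
  by rewrite mulr_ge0 ?opnorm_ge0 ?l2norm_ge0.
have y_gt0 : 0 < l2norm y by rewrite lt_neqAle eq_sym yN0 l2norm_ge0.
rewrite -(ler_pM2l y_gt0) -expr2.
have -> : l2norm y ^+ 2 = normc (inner (x y) f).
  by rewrite bop_adjE l2normE /= expr0n addr0 sqrtr_sqr ger0_norm// sqr_ge0.
rewrite (le_trans (inner_le _ _))// mulrA ler_wpM2r ?l2norm_ge0//.
by rewrite mulrC opnormP.
Qed.

Lemma ad_toeplitz t x : toeplitz x -> toeplitz (ad t x).
Proof.
have [Tl TM Ts Tc] := toeplitz_cstar.
move=> /(_ [set y | toeplitz (ad t y)]); apply; split; last first.
  move=> _ [y _ <-] /=; rewrite ad_Tiso -[X in toeplitz X]addr0.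
  apply: (Tl); first exact: toeplitz_Tiso.
  rewrite -(subrr (Tiso y)) addrC -scaleN1r.
  by apply: (Tl); exact: toeplitz_Tiso.
split => /=.
- by move=> c y z Ty Tz; rewrite ad_linear; exact: Tl.
- by move=> y z Ty Tz; rewrite adM; exact: TM.
- by move=> y Ty; rewrite ad_star; exact: Ts.
- apply: closedBP => y h /=; apply: (closedB_approx Tc) => e e0.
  have [z /= Tz yz] := h e e0; exists (ad t z) => //.
  by rewrite -adB (le_lt_trans (opnorm_ad _ _)).
Qed.

Let ad_cont (x : B) := forall t e : R, 0 < e ->
  \forall u \near t, opnorm (ad t x - ad u x) < e.

Lemma ad_contP x : ad_cont x -> continuous (fun t => ad t x).
Proof.
move=> h t; apply/cvgrPdist_lt => e e0.
have eE : e = (Re e)%:C by case: (e) e0 => a b; rewrite ltcE /= => /andP[/eqP ->].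
have := h t (Re e); rewrite -ltcR -eE => /(_ e0).
by apply: filterS => u; rewrite -ltcR -eE.
Qed.

Lemma expi_cont (l t e : R) : 0 < e ->
  \forall u \near t, normc (expi (t * l) - expi (u * l)) < e.
Proof.
move=> e0.
have cc : (fun u : R => cos (u * l)) @ t --> cos (t * l).
  apply: continuous_comp; last exact: continuous_cos.
  by apply: cvgMl; exact: cvg_id.
have cs : (fun u : R => sin (u * l)) @ t --> sin (t * l).
  apply: continuous_comp; last exact: continuous_sin.
  by apply: cvgMl; exact: cvg_id.
have e20 : 0 < e / 2 by rewrite divr_gt0.
move/cvgrPdist_lt: cc => /(_ _ e20) hc.
move/cvgrPdist_lt: cs => /(_ _ e20) hs.
near=> u.
rewrite -(@ltr_pXn2r _ 2)// ?nnegrE ?normc_ge0 ?(ltW e0)// normc2 /=.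
have : `|cos (t * l) - cos (u * l)| < e / 2 by near: u.
have : `|sin (t * l) - sin (u * l)| < e / 2 by near: u.
set a := cos _ - _; set b := sin _ - _.
rewrite -(real_normK (num_real a)) -(real_normK (num_real b)).
have := normr_ge0 a; have := normr_ge0 b.
move: `|a| `|b| => A C C0 A0 C1 A1; rewrite !expr2.
have : A * A <= e / 2 * (e / 2) by rewrite ler_pM// ltW.
have : C * C <= e / 2 * (e / 2) by rewrite ler_pM// ltW.
have : 0 < e * e by rewrite mulr_gt0.
lra.
Unshelve. all: by end_near. Qed.

Lemma ad_cont_toeplitz (a : B) : toeplitz a -> ad_cont a.
Proof.
move=> /(_ ad_cont); apply; split; last first.
  move=> _ [y _ <-] t e e0.
  set l : R := ln (y.2 : nat)%:R.
  have N0 : 0 < opnorm (Tiso y) + 1 by rewrite ltr_wpDl// opnorm_ge0.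
  have := @expi_cont l t (e / (opnorm (Tiso y) + 1)).
  rewrite divr_gt0// => /(_ isT); apply: filterS => u.
  rewrite !ad_Tiso -/l -scalerBl opnormZ ltr_pdivlMr//.
  apply: le_lt_trans; rewrite ler_wpM2l ?normc_ge0//.
  by rewrite lerDl.
split.
- move=> c x y cx cy t e e0.
  have N0 : 0 < normc c + 1 by rewrite ltr_wpDl// normc_ge0.
  have h1 := cx t (e / 2 / (normc c + 1)); have h2 := cy t (e / 2).
  have {}h1 := h1 (divr_gt0 (divr_gt0 e0 (ltr0Sn R 1)) N0).
  have {}h2 := h2 (divr_gt0 e0 (ltr0Sn R 1)).
  near=> u.
  rewrite !ad_linear opprD addrACA -scalerBr.
  rewrite (le_lt_trans (opnormD _ _))// (splitr e) ltr_leD//; last first.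
    by apply: ltW; near: u.
  rewrite opnormZ.
  have : opnorm (ad t x - ad u x) < e / 2 / (normc c + 1) by near: u.
  rewrite ltr_pdivlMr// mulrC; apply: le_lt_trans.
  by rewrite ler_wpM2r ?opnorm_ge0// lerDl.
- move=> x y cx cy t e e0.
  have Nx : 0 < opnorm x + 1 by rewrite ltr_wpDl// opnorm_ge0.
  have Ny : 0 < opnorm y + 1 by rewrite ltr_wpDl// opnorm_ge0.
  have h1 := cx t _ (divr_gt0 (divr_gt0 e0 (ltr0Sn R 1)) Ny).
  have h2 := cy t _ (divr_gt0 (divr_gt0 e0 (ltr0Sn R 1)) Nx).
  near=> u.
  rewrite !adM (_ : _ - _ = ad t x * (ad t y - ad u y) +
                            (ad t x - ad u x) * ad u y); last first.
    by rewrite mulrBr mulrBl addrA subrK.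
  rewrite (le_lt_trans (opnormD _ _))// (splitr e) ltrD//.
    have : opnorm (ad t y - ad u y) < e / 2 / (opnorm x + 1) by near: u.
    rewrite ltr_pdivlMr// mulrC; apply: le_lt_trans.
    rewrite (le_trans (opnormM _ _))// ler_wpM2r ?opnorm_ge0//.
    by rewrite (le_trans (opnorm_ad _ _))// lerDl.
  have : opnorm (ad t x - ad u x) < e / 2 / (opnorm y + 1) by near: u.
  rewrite ltr_pdivlMr//; apply: le_lt_trans.
  rewrite (le_trans (opnormM _ _))// ler_wpM2l ?opnorm_ge0//.
  by rewrite (le_trans (opnorm_ad _ _))// lerDl.
- move=> x cx t e e0; apply: filterS (cx t e e0) => u.
  apply: le_lt_trans; rewrite !ad_star.
  rewrite (_ : _ - _ = star (ad t x - ad u x)) ?opnorm_star//.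
  exact: bop_ext.
- apply: closedBP => x h t e e0.
  have e30 : 0 < e / 3 by rewrite divr_gt0.
  have [y cy xy] := h _ e30.
  apply: filterS (cy t _ e30) => u yu.
  rewrite (_ : _ - _ = ad t (x - y) + (ad t y - ad u y) + ad u (y - x));
    last by rewrite !adB !addrA subrK subrK.
  rewrite (le_lt_trans (opnormD _ _))//.
  have := opnormD (ad t (x - y)) (ad t y - ad u y).
  have := opnorm_ad t (x - y).
  have := opnorm_ad u (y - x); rewrite -(opnormN (y - x)) opprB.
  by move: xy yu => /=; lra.
Unshelve. all: by end_near. Qed.

Theorem toeplitz_dynamics_ad : toeplitz_dynamics ad.
Proof.
split; first split.
- exact: ad_toeplitz.
- by move=> *; exact: ad_linear.
- by move=> *; exact: adM.
- by move=> *; exact: ad_star.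
- by move=> *; exact: ad0.
- by move=> *; exact: adD.
- by move=> x /ad_cont_toeplitz/ad_contP.
- by move=> t; rewrite ad_Tiso ln1 mulr0 expi0 scale1r.
- by move=> t p pP; rewrite ad_Tiso.
Qed.

End ToeplitzAlgebra.

Arguments toeplitz R : clear implicits.
Arguments iso_s R : clear implicits.
Arguments iso_v R a : clear implicits.

(* Main.v *)
Require Import Defs.
From HB Require Import structures.
From mathcomp Require Import all_boot all_order all_algebra.
From mathcomp Require Import complex ring lra zify.
From mathcomp Require Import all_classical all_reals all_analysis.

(* Write T_x for the isometries, T_x' for their adjoints and L for the left
   kernel of phi. The vanishing condition says that phi is invariant under the
   dynamics and that T_y T_x' lies in L whenever the second component of x is
   not 1.

   If phi is a ground state, then phi(T_x sigma_z(T_y')) is phi(T_x T_y') times a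
   function of modulus b^(Im z), b the second component of y; being bounded it
   vanishes unless b = 1, and the other case follows by adjunction.

   Conversely, let d be in the linear span of the T_x T_y', which is a dense
   star-algebra. Modulo an element E with phi(E c) = 0 for all c, d is a finite
   sum of D_b with sigma_t(D_b) = b^(-it) D_b. For an entire extension f of
   t |-> sigma_t(c), the functions phi(D_b f(z)) and b^(iz) phi(D_b c) are entire
   and agree on the real line by invariance, hence phi(d f(z)) = phi(D(z) c) with
   D(z) = sum_b b^(iz) D_b. As phi(D_a D_b') = 0 for a <> b, phi(D(z) D(z)')
   is sum_b b^(-2 Im z) phi(D_b D_b') <= phi(d d') on the upper half-plane, and
   the Cauchy-Schwarz inequality bounds phi(d f(z)) by a multiple of |d| |c|. As
   phi is bounded, the estimate extends to all d.

   Uniqueness of continuation for a function g that is only assumed complex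
   differentiable and vanishes on the real line: by Goursat's lemma on
   [a, b] x [0, Y], with g multiplied by a holomorphic function that is nearly 1
   below the height s < Y and nearly 0 above it, and equal on both vertical
   sides, the integral of Im g(b + it) - Im g(a + it) over [0, s] is 0. So Im g
   depends on the height only, and Re g = 0 by the Cauchy-Riemann equations. *)

Set Implicit Arguments.
Unset Strict Implicit.
Unset Printing Implicit Defensive.
Import Order.TTheory GRing.Theory Num.Theory numFieldNormedType.Exports.

Local Open Scope classical_set_scope.
Local Open Scope ring_scope.
Local Open Scope complex_scope.

Local Notation Re := (@complex.Re _).
Local Notation Im := (@complex.Im _).
Local Notation normc := Normc.normc.

(** * Closed differential forms on rectangles *)

Section Goursat.
Variable R : realType.
Implicit Types (f g : R -> R) (a b c d w h x y lo : R).

(* The base point [lo] must lie to the left of the intervals of integration: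
   the derivative of [prim lo f] is [f] on the right of [lo] only. *)
Definition prim lo f x : R :=
  \int[@lebesgue_measure R]_(t in [set` Interval (BLeft lo) (BRight x)]) f t.

Lemma prim_derive lo f x : continuous f -> lo < x ->
  is_derive x (1 : R) (prim lo f) (f x).
Proof.
move=> cf lox.
have xu : x < x + 1 by rewrite ltrDl.
have intf : (@lebesgue_measure R).-integrable
    [set` Interval (BLeft lo) (BRight (x + 1))] (EFin \o f).
  apply: continuous_compact_integrable; first exact: segment_compact.
  exact/continuous_subspaceT.
have [dF FE] := continuous_FTC1_closed xu intf lox (cf x).
by apply: DeriveDef dF _; rewrite -FE derive1E.
Qed.

Definition bint lo f a b : R := prim lo f b - prim lo f a.

(** The mean value theorem for [prim lo f - G]. With a primitive of another function as [G] it
    compares two integrals at a single point; with an explicit [G] it evaluates or bounds an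
    integral. *)
Lemma bint_MVT lo f (G G' : R -> R) a b : continuous f -> lo < a -> a <= b ->
  (forall x, lo < x -> is_derive x (1 : R) G (G' x)) ->
  exists2 t, a <= t <= b & bint lo f a b - (G b - G a) = (f t - G' t) * (b - a).
Proof.
move=> cf loa ab dG.
have D x : a <= x -> is_derive x (1 : R) (prim lo f - G) (f x - G' x).
  move=> ax; have lox := lt_le_trans loa ax; have := dG x lox => ?; apply: is_deriveB.
  exact: prim_derive.
have [||t] := @MVT_segment R (prim lo f - G) (fun x => f x - G' x) a b ab.
- by move=> x; rewrite in_itv/= => /andP[/ltW ax _]; exact: D.
- apply: derivable_within_continuous => x; rewrite in_itv/= => /andP[ax _].
  by have [] := D x ax.
rewrite in_itv/= => tab tE; exists t => //.
rewrite -tE /bint.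
have E x : (prim lo f - G) x = prim lo f x - G x by [].
by rewrite !E; ring.
Qed.


(** The counterclockwise boundary integral of [P dx + Q dy]: bottom, top, right and left side, in
    this order. *)
Definition rect_bint lo (P Q : R -> R -> R) a b c d : R :=
  bint lo (P^~ c) a b - bint lo (P^~ d) a b + bint lo (Q b) c d
  - bint lo (Q a) c d.

(* The differential form P dx + Q dy is differentiable at (x, y), with
   dP/dy = dQ/dx. *)
Definition closed_at (P Q : R -> R -> R) x y :=
  exists A B C : R, forall e : R, 0 < e -> exists2 r : R, 0 < r &
    forall h k : R, `|h| < r -> `|k| < r ->
      `|P (x + h) (y + k) - P x y - A * h - C * k| <= e * (`|h| + `|k|) /\
      `|Q (x + h) (y + k) - Q x y - C * h - B * k| <= e * (`|h| + `|k|).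

Lemma lipschitz_cont f x (M r : R) : 0 < r ->
  (forall h, `|h| < r -> `|f (x + h) - f x| <= M * `|h|) ->
  {for x, continuous f}.
Proof.
move=> r0 fM; apply/cvgrPdist_lt => e e0.
have M0 : 0 < `|M| + 1 by rewrite ltr_wpDl.
near=> t.
have -> : t = x + (t - x) by ring.
have tr : `|t - x| < r by rewrite distrC; near: t; exact: cvgr_dist_lt.
have te : `|t - x| < e / (`|M| + 1).
  by rewrite distrC; near: t; apply: cvgr_dist_lt => //; rewrite divr_gt0.
rewrite distrC (le_lt_trans (fM _ tr))//.
rewrite ltr_pdivlMr// mulrC in te; apply: le_lt_trans te.
by rewrite ler_wpM2r// (le_trans (ler_norm _))// lerDl.
Unshelve. all: by end_near. Qed.

Lemma closed_at_cont P Q x y : closed_at P Q x y ->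
  {for x, continuous (P^~ y)} /\ {for y, continuous (Q x)}.
Proof.
move=> [A [B [C /(_ 1 ltr01)[r r0 H]]]].
have H0 h : `|0 : R| < r by rewrite normr0.
split.
- apply: (@lipschitz_cont _ _ (1 + `|A|) _ r0) => h hr.
  have [+ _] := H h 0 hr (H0 0); rewrite addr0 mulr0 subr0 normr0 addr0 mulrDl.
  have := ler_normD (P (x + h) y - P x y - A * h) (A * h).
  by rewrite subrK normrM; clear; lra.
- apply: (@lipschitz_cont _ _ (1 + `|B|) _ r0) => h hr.
  have [_ ] := H 0 h (H0 0) hr; rewrite addr0 mulr0 subr0 normr0 add0r mulrDl.
  have := ler_normD (Q x (y + h) - Q x y - B * h) (B * h).
  by rewrite subrK normrM; clear; lra.
Qed.


(** The affine part of the form at [(x, y)] is closed and contributes nothing; the remainder is at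
    most [e * (w + h)] on each side. *)
Lemma rect_bint_small lo P Q x y : (forall x y, closed_at P Q x y) ->
  forall e : R, 0 < e -> exists2 r : R, 0 < r & forall a c w h,
    lo < a -> lo < c -> 0 <= w < r -> 0 <= h < r ->
    a <= x <= a + w -> c <= y <= c + h ->
    `|rect_bint lo P Q a (a + w) c (c + h)| <= 2 * e * (w + h) ^+ 2.
Proof.
move=> PQ e e0; have [A [B [C /(_ e e0)[r r0 H]]]] := PQ x y.
exists r => // a c w h loa loc /andP[w0 wr] /andP[h0 hr].
move=> /andP[ax xa] /andP[cy yc].
have cP y' : continuous (P^~ y') by move=> x'; have [] := closed_at_cont (PQ x' y').
have cQ x' : continuous (Q x') by move=> y'; have [] := closed_at_cont (PQ x' y').
(* Opposite sides are paired: the difference of their integrals is a difference of values at a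
   common point [t] or [s], times the side length. *)
have [t /andP[t0 t1]] := @bint_MVT lo (P^~ c) (prim lo (P^~ (c + h)))
  (P^~ (c + h)) a (a + w) (cP _) loa (ltac:(lra)) (fun x' => prim_derive (cP _)).
have [s /andP[s0 s1]] := @bint_MVT lo (Q (a + w)) (prim lo (Q a))
  (Q a) c (c + h) (cQ _) loc (ltac:(lra)) (fun x' => prim_derive (cQ _)).
rewrite -/(bint lo (P^~ (c + h)) a (a + w)) -/(bint lo (Q a) c (c + h)) => EQ EP.
have -> : rect_bint lo P Q a (a + w) c (c + h) =
    (P t c - P t (c + h)) * w + (Q (a + w) s - Q a s) * h.
  by rewrite /rect_bint EP -addrA EQ; ring.
have H' x' y' : a <= x' <= a + w -> c <= y' <= c + h ->
    `|P x' y' - P x y - A * (x' - x) - C * (y' - y)| <= e * (w + h) /\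
    `|Q x' y' - Q x y - C * (x' - x) - B * (y' - y)| <= e * (w + h).
  move=> /andP[a1 a2] /andP[c1 c2].
  have dx : `|x' - x| <= w by rewrite ler_norml; apply/andP; split; lra.
  have dy : `|y' - y| <= h by rewrite ler_norml; apply/andP; split; lra.
  have [] := H (x' - x) (y' - y) (le_lt_trans dx wr) (le_lt_trans dy hr).
  rewrite !(addrC x) !(addrC y) !subrK => h1 h2.
  have le : e * (`|x' - x| + `|y' - y|) <= e * (w + h) by rewrite ler_pM2l// lerD.
  by split; [exact: le_trans h1 le|exact: le_trans h2 le].
have [P1 _] := H' t c (ltac:(lra)) (ltac:(lra)).
have [P2 _] := H' t (c + h) (ltac:(lra)) (ltac:(lra)).
have [_ Q1] := H' (a + w) s (ltac:(lra)) (ltac:(lra)).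
have [_ Q2] := H' a s (ltac:(lra)) (ltac:(lra)).
(* The linear terms add up to [C * h * w - C * w * h = 0]. This is where [P] and [Q] must share the
   coefficient [C]. *)
have -> : (P t c - P t (c + h)) * w + (Q (a + w) s - Q a s) * h =
   (P t c - P x y - A * (t - x) - C * (c - y)
     - (P t (c + h) - P x y - A * (t - x) - C * (c + h - y))) * w
   + (Q (a + w) s - Q x y - C * (a + w - x) - B * (s - y)
     - (Q a s - Q x y - C * (a - x) - B * (s - y))) * h by ring.
have bnd (u v m k : R) : 0 <= k -> `|u| <= m -> `|v| <= m ->
    `|(u - v) * k| <= (m + m) * k.
  move=> k0 um vm; rewrite normrM (ger0_norm k0) ler_wpM2r//.
  by rewrite (le_trans (ler_normB _ _))// lerD.
rewrite (le_trans (ler_normD _ _))//.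
apply: le_trans (lerD (bnd _ _ _ _ w0 P1 P2) (bnd _ _ _ _ h0 Q1 Q2)) _.
by rewrite le_eqVlt; apply/orP; left; apply/eqP; ring.
Qed.

(** The intervals from [x n] to [x n + W / 2 ^+ n] are nested, and the supremum of their left ends
    lies in all of them. *)
Lemma nested_dyadic (x : nat -> R) W :
  (forall n, x n <= x n.+1 <= x n + W / 2 ^+ n.+1) ->
  exists l, forall n, x n <= l <= x n + W / 2 ^+ n.
Proof.
move=> xW.
have E n : W / 2 ^+ n = W / 2 ^+ n.+1 + W / 2 ^+ n.+1.
  rewrite exprS; field.
  by rewrite expf_neq0.
have x_nd n m : x n <= x (n + m)%N.
  elim: m => [|m IH]; first by rewrite addn0.
  by rewrite (le_trans IH)// addnS; have /andP[] := xW (n + m)%N.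
have y_ni n m : x (n + m)%N + W / 2 ^+ (n + m) <= x n + W / 2 ^+ n.
  elim: m => [|m IH]; first by rewrite addn0.
  apply: le_trans IH; rewrite addnS; have /andP[_] := xW (n + m)%N.
  by rewrite (E (n + m)%N); lra.
have W0 n : 0 <= W / 2 ^+ n.
  have /andP[h1 h2] := xW n; have := le_trans h1 h2.
  by rewrite (E n); lra.
have ub n m : x m <= x n + W / 2 ^+ n.
  have h := y_ni n m; have := x_nd m n; rewrite addnC => h'.
  by have := W0 (n + m)%N; lra.
have hs : has_sup (range x).
  by split; [exists (x 0%N), 0%N|exists (x 0%N + W / 2 ^+ 0) => _ [m _ <-]].
exists (sup (range x)) => n; apply/andP; split.
  by apply: ub_le_sup; [case: hs|exists n].
by apply: ge_sup; [case: hs|move=> _ [m _ <-]].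
Qed.

Lemma dyadic_small (W r : R) : 0 < r -> exists N, forall n, (N <= n)%N ->
  W / 2 ^+ n < r.
Proof.
move=> r0; have [N] : exists N : nat, `|W| / r < N%:R.
  by exists (Num.bound (`|W| / r)); apply: archi_boundP; rewrite divr_ge0// ltW.
exists N => n Nn; rewrite ltr_pdivrMr ?exprn_gt0// mulrC -ltr_pdivrMr//.
apply: le_lt_trans (ler_wpM2r _ (ler_norm W)) _; first by rewrite invr_ge0 ltW.
apply: lt_le_trans p _; rewrite -natrX ler_nat.
by rewrite (leq_trans Nn)// ltnW// ltn_expl.
Qed.

(* By bisection: if the integral exceeds [e * (w + h) ^+ 2] in modulus on a
   [w] by [h] rectangle, it does so on one of its quarters. *)
Theorem goursat lo P Q a b c d : (forall x y, closed_at P Q x y) ->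
  lo < a -> a <= b -> lo < c -> c <= d -> rect_bint lo P Q a b c d = 0.
Proof.
move=> PQ loa ab loc cd.
set W := b - a; set H := d - c.
have W0 : 0 <= W by rewrite subr_ge0.
have H0 : 0 <= H by rewrite subr_ge0.
apply/eqP; rewrite -normr_eq0; apply/eqP/le_anti; rewrite normr_ge0 andbT.
apply/ler_addgt0Pl => e' e'0; rewrite addr0.
set e := e' / ((W + H) ^+ 2 + 1).
have D0 : 0 < (W + H) ^+ 2 + 1 by rewrite ltr_wpDl// sqr_ge0.
have e0 : 0 < e by rewrite divr_gt0.
have : e * (W + H) ^+ 2 <= e'.
  by rewrite /e mulrAC ler_pdivrMr// ler_wpM2l ?(ltW e'0)// lerDl.
apply: le_trans; rewrite leNgt; apply/negP => bad0.
pose bad n (p : R * R) := [/\ lo < p.1, lo < p.2 &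
  e * (W / 2 ^+ n + H / 2 ^+ n) ^+ 2 <
  `|rect_bint lo P Q p.1 (p.1 + W / 2 ^+ n) p.2 (p.2 + H / 2 ^+ n)|].
have step n p : exists q, bad n p -> bad n.+1 q /\
    p.1 <= q.1 <= p.1 + W / 2 ^+ n.+1 /\ p.2 <= q.2 <= p.2 + H / 2 ^+ n.+1.
  case: p => x y; set w := W / 2 ^+ n.+1; set h := H / 2 ^+ n.+1.
  have w0 : 0 <= w by rewrite divr_ge0// exprn_ge0.
  have h0 : 0 <= h by rewrite divr_ge0// exprn_ge0.
  have wE : W / 2 ^+ n = w + w by rewrite /w exprS; field; rewrite expf_neq0.
  have hE : H / 2 ^+ n = h + h by rewrite /h exprS; field; rewrite expf_neq0.
  (* If no [q] works, then [(x, y)] is bad and none of its four quarters is, which contradicts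
     additivity of the boundary integral. *)
  have [[q qP]|nq] := pselect (exists q, bad n (x, y) -> bad n.+1 q /\
    x <= q.1 <= x + w /\ y <= q.2 <= y + h); first by exists q.
  exists (x, y) => /= bn; exfalso.
  have [/= lox loy] := bn; rewrite wE hE => lb.
  have good x' y' : x <= x' <= x + w -> y <= y' <= y + h ->
      `|rect_bint lo P Q x' (x' + w) y' (y' + h)| <= e * (w + h) ^+ 2.
    move=> xx' yy'; rewrite leNgt; apply/negP => lt; apply: nq.
    exists (x', y') => _; split; last by split.
    split => /=; last exact: lt.
      by apply: lt_le_trans lox _; case/andP: xx'.
    by apply: lt_le_trans loy _; case/andP: yy'.
  have xw : x <= x <= x + w by rewrite lexx lerDl.
  have yh : y <= y <= y + h by rewrite lexx lerDl.
  have xw' : x <= x + w <= x + w by rewrite lexx lerDl andbT.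
  have yh' : y <= y + h <= y + h by rewrite lexx lerDl andbT.
  move: lb; apply/negP; rewrite -leNgt.
  have -> : rect_bint lo P Q x (x + (w + w)) y (y + (h + h)) =
      rect_bint lo P Q x (x + w) y (y + h)
      + rect_bint lo P Q (x + w) (x + w + w) y (y + h)
      + rect_bint lo P Q x (x + w) (y + h) (y + h + h)
      + rect_bint lo P Q (x + w) (x + w + w) (y + h) (y + h + h).
    by rewrite /rect_bint /bint !addrA; ring.
  have -> : e * (w + w + (h + h)) ^+ 2 = e * (w + h) ^+ 2 + e * (w + h) ^+ 2
    + e * (w + h) ^+ 2 + e * (w + h) ^+ 2 by ring.
  do 3 (apply: le_trans (ler_normD _ _) _; apply: lerD; last exact: good).
  exact: good.
have {step}[F FP] := choice (fun np : nat * (R * R) => step np.1 np.2).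
pose u := fix u n := if n is m.+1 then F (m, u m) else (a, c).
have bu n : bad n (u n).
  elim: n => [|n /(FP (n, _))[]//].
  split => //=; rewrite !expr0 !divr1.
  by rewrite (addrC a) (addrC c) !subrK.
have uS n := (FP (n, u n) (bu n)).2.
have [x xP] := @nested_dyadic (fun n => (u n).1) W (fun n => (uS n).1).
have [y yP] := @nested_dyadic (fun n => (u n).2) H (fun n => (uS n).2).
have e20 : 0 < e / 2 by rewrite divr_gt0.
have [r r0 small] := @rect_bint_small lo P Q x y PQ _ e20.
have [N1 N1P] := dyadic_small W r0; have [N2 N2P] := dyadic_small H r0.
set n := maxn N1 N2.
have [lox loy] := bu n; apply/negP; rewrite -leNgt.
rewrite (_ : e = 2 * (e / 2)); last by field.
apply: small => //.
- by rewrite divr_ge0 ?exprn_ge0//=; apply: N1P; exact: leq_maxl.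
- by rewrite divr_ge0 ?exprn_ge0//=; apply: N2P; exact: leq_maxr.
Qed.

End Goursat.

(** * Complex differentiation *)

Section ComplexDerivative.
Variable R : realType.
Implicit Types (f g : R[i] -> R[i]) (z A B c : R[i]).

Lemma le_Re_normc z : `|Re z| <= normc z.
Proof.
rewrite -(@ler_pXn2r _ 2)// ?nnegrE ?normc_ge0// normc2 -normrX ger0_norm ?sqr_ge0//.
by rewrite lerDl sqr_ge0.
Qed.

Lemma le_Im_normc z : `|Im z| <= normc z.
Proof.
rewrite -(@ler_pXn2r _ 2)// ?nnegrE ?normc_ge0// normc2 -normrX ger0_norm ?sqr_ge0//.
by rewrite lerDr sqr_ge0.
Qed.

Lemma normc_le z : normc z <= `|Re z| + `|Im z|.
Proof.
rewrite -(@ler_pXn2r _ 2)// ?nnegrE ?normc_ge0 ?addr_ge0// normc2.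
rewrite -(real_normK (num_real (Re z))) -(real_normK (num_real (Im z))).
have := normr_ge0 (Re z); have := normr_ge0 (Im z).
by move: `|_| `|_| => u v u0 v0; have := mulr_ge0 u0 v0; rewrite !expr2; lra.
Qed.

Lemma normc_real (x : R) : normc x%:C = `|x|.
Proof. by rewrite /= expr0n addr0 sqrtr_sqr. Qed.

Lemma normcB z A : normc (z - A) <= normc z + normc A.
Proof. by rewrite -(normcN A); exact: le_normcD. Qed.

(** Complex differentiability in the form without quotients, so that [h = 0] needs no separate
    treatment. *)
Definition cderiv f z A := forall e : R, 0 < e -> exists2 r : R, 0 < r &
  forall h, normc h < r -> normc (f (z + h) - f z - A * h) <= e * normc h.

Lemma cderiv_const c z : cderiv (fun=> c) z 0.
Proof.
move=> e e0; exists 1 => // h _.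
by rewrite subrr mul0r subrr Normc.normc0 mulr_ge0 ?normc_ge0// ltW.
Qed.

Lemma cderiv_affine c A z : cderiv (fun z => c + A * z) z A.
Proof.
move=> e e0; exists 1 => // h _.
rewrite (_ : _ - _ = 0); last by ring.
by rewrite Normc.normc0 mulr_ge0 ?normc_ge0// ltW.
Qed.

Lemma cderivB f g z A B : cderiv f z A -> cderiv g z B ->
  cderiv (fun z => f z - g z) z (A - B).
Proof.
move=> fA gB e e0; have e2 : 0 < e / 2 by rewrite divr_gt0.
have [r r0 fr] := fA _ e2; have [s s0 gs] := gB _ e2.
exists (Num.min r s) => [|h]; first by rewrite lt_min r0.
rewrite lt_min => /andP[/fr h1 /gs h2].
rewrite (_ : _ - _ = (f (z + h) - f z - A * h) - (g (z + h) - g z - B * h));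
  last by ring.
by apply: le_trans (normcB _ _) _; lra.
Qed.

Lemma cderiv_lipschitz f z A : cderiv f z A -> exists2 r : R, 0 < r &
  forall h, normc h < r -> normc (f (z + h) - f z) <= (normc A + 1) * normc h.
Proof.
move=> /(_ 1 ltr01)[r r0 fr]; exists r => // h /fr h1.
rewrite -[f _ - f z](subrK (A * h)) (le_trans (le_normcD _ _))// Normc.normcM.
by move: h1; clear; lra.
Qed.

Lemma cderivM f g z A B : cderiv f z A -> cderiv g z B ->
  cderiv (fun z => f z * g z) z (A * g z + f z * B).
Proof.
move=> fA gB e e0.
have [r2 r20 fl] := cderiv_lipschitz fA.
have [r3 r30 gl] := cderiv_lipschitz gB.
set K := normc (f z) + normc (g z) + 1.
have K0 : 0 < K by rewrite ltr_wpDl// addr_ge0// normc_ge0.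
set D := (normc A + 1) * (normc B + 1).
have D0 : 0 < D by rewrite mulr_gt0// ltr_wpDl// normc_ge0.
have e2 : 0 < e / 2 / K by rewrite !divr_gt0.
have [r r0 fr] := fA _ e2; have [s s0 gs] := gB _ e2.
(* The bound [e / 2 / D] takes care of the product of the two increments, which is at most
   [D * normc h ^+ 2]. *)
exists (Num.min (Num.min r s) (Num.min (Num.min r2 r3) (e / 2 / D))) => [|h].
  by rewrite !lt_min r0 s0 r20 r30 !divr_gt0.
rewrite !lt_min => /andP[/andP[/fr h1 /gs h2] /andP[/andP[/fl h3 /gl h4] h5]].
rewrite (_ : _ - _ = (f (z + h) - f z - A * h) * g z
  + f z * (g (z + h) - g z - B * h) + (f (z + h) - f z) * (g (z + h) - g z));
  last by ring.
apply: le_trans (le_normcD _ _) _.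
apply: le_trans (lerD (le_normcD _ _) (lexx _)) _; rewrite !Normc.normcM.
have n0 := @normc_ge0 R.
have m1 := ler_wpM2r (n0 (g z)) h1; have m2 := ler_wpM2l (n0 (f z)) h2.
have m3 := ler_pM (n0 _) (n0 _) h3 h4.
have m4 : normc h * D <= e / 2 by rewrite -ler_pdivlMr// ltW.
have m5 := ler_wpM2r (n0 h) m4.
have m6 : e / 2 / K * K = e / 2 by rewrite divfK// gt_eqF.
have m7 : e / 2 / K * normc h * (normc (g z) + normc (f z)) <= e / 2 * normc h.
  rewrite (_ : e / 2 * normc h = e / 2 / K * normc h * K); last first.
    by rewrite -{1}m6; ring.
  apply: ler_wpM2l; first by rewrite mulr_ge0// ltW.
  by rewrite /K (addrC (normc (g z))) lerDl.
rewrite /D in m5; rewrite mulrDr in m7.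
have m8 : (normc A + 1) * normc h * ((normc B + 1) * normc h) =
    normc h * ((normc A + 1) * (normc B + 1)) * normc h by ring.
rewrite m8 in m3; rewrite (mulrC (normc (f z)) (_ * _)) in m2.
by move: m1 m2 m3 m5 m7; clear; lra.
Qed.

Lemma cderiv_comp f g z A B : cderiv f (g z) A -> cderiv g z B ->
  cderiv (fun z => f (g z)) z (A * B).
Proof.
move=> fA gB e e0; have n0 := @normc_ge0 R.
have [r1 r10 gl] := cderiv_lipschitz gB.
set K := normc A + normc B + 1.
have K0 : 0 < K by rewrite ltr_wpDl// addr_ge0// normc_ge0.
have B0 : 0 < normc B + 1 by rewrite ltr_wpDl.
have e2 : 0 < e / 2 / K by rewrite !divr_gt0.
have [r r0 fr] := fA _ e2; have [s s0 gs] := gB _ e2.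
exists (Num.min (Num.min r1 s) (r / (normc B + 1))) => [|h].
  by rewrite !lt_min r10 s0 divr_gt0.
rewrite !lt_min => /andP[/andP[/gl h1 /gs h2] h3].
set k := g (z + h) - g z in h1 h2.
have kr : normc k < r.
  by apply: le_lt_trans h1 _; rewrite mulrC -ltr_pdivlMr.
have kE : g z + k = g (z + h) by rewrite /k; ring.
have := fr _ kr; rewrite kE => h4.
rewrite (_ : _ - _ = (f (g (z + h)) - f (g z) - A * k) + A * (k - B * h));
  last by ring.
apply: le_trans (le_normcD _ _) _; rewrite Normc.normcM.
have m1 := ler_wpM2l (n0 A) h2; have m2 := ler_wpM2l (ltW e2) h1.
have m6 : e / 2 / K * K = e / 2 by rewrite divfK// gt_eqF.
have m7 : e / 2 / K * normc h * (normc A + normc B + 1) = e / 2 * normc h.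
  by rewrite -{2}m6 /K; ring.
apply: le_trans (lerD (le_trans h4 m2) m1) _.
rewrite (_ : _ + _ = e / 2 * normc h); last by rewrite -m7; ring.
by rewrite ler_wpM2r// ler_pdivrMr// ler_peMr ?(ltW e0)// ler1n.
Qed.

(** The form is the real part of [f dz], and its closedness is one of the Cauchy-Riemann
    equations. *)
Lemma cderiv_closed f x y A : cderiv f (x +i* y) A ->
  closed_at (fun x y => Re (f (x +i* y))) (fun x y => - Im (f (x +i* y))) x y.
Proof.
move=> fA; exists (Re A), (- Re A), (- Im A) => e e0.
have [r r0 fr] := fA _ e0; exists (r / 2) => [|h k hr kr]; first by rewrite divr_gt0.
have hk := normc_le (h +i* k); rewrite [Re _]/= [Im _]/= in hk.
have hkr : `|h| + `|k| < r by move: hr kr; clear; lra.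
have {}fr := fr (h +i* k) (le_lt_trans hk hkr).
have {fr hk} := le_trans fr (ler_wpM2l (ltW e0) hk).
rewrite (_ : x +i* y + (h +i* k) = (x + h) +i* (y + k))//.
move: (f _) (f _) => u v; move: (e * _) => b ub.
have := le_trans (le_Re_normc _) ub; have := le_trans (le_Im_normc _) ub.
move: u v A {fA ub} => [u1 u2] [v1 v2] [A1 A2] /= h1 h2; split.
  by move: h2; congr (`|_| <= _); ring.
by rewrite -normrN; move: h1; congr (`|_| <= _); ring.
Qed.

End ComplexDerivative.

(** * The complex exponential *)

Section ComplexExponential.
Variable R : realType.
Implicit Types (z w : R[i]).

Lemma is_derive_epsP (f : R -> R) (x d : R) : is_derive x (1 : R) f d <->
  forall e : R, 0 < e -> exists2 r : R, 0 < r &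
    forall h, `|h| < r -> `|f (x + h) - f x - d * h| <= e * `|h|.
Proof.
have quot (h : R) : h != 0 -> `|d - h^-1 *: (f (h *: 1 + x) - f x)| * `|h| =
    `|f (x + h) - f x - d * h|.
  move=> h0; rewrite -normrM distrC.
  have -> : h *: (1 : R) = h by rewrite /GRing.scale/= mulr1.
  rewrite /GRing.scale/= (addrC h) mulrBl mulrAC mulVf// mul1r; congr `|_|; ring.
split=> [[df dE] e e0|H].
  subst d.
  move/cvgrPdist_le : df => /(_ e e0) /nbhs_ballP[r /= r0 rP].
  exists r => // h hr; have [->|h0] := eqVneq h 0.
    by rewrite addr0 subrr mulr0 subrr normr0 mulr0.
  rewrite -quot//; apply: ler_wpM2r => //; apply: rP => //.
  by rewrite -ball_normE /ball_/= sub0r normrN.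
have L : h^-1 *: ((f \o shift x) (h *: (1 : R)) - f x) @[h --> (0 : R)^'] --> d.
  apply/cvgrPdist_le => e e0; have [r r0 rP] := H _ e0.
  near=> h.
  have h0 : h != 0 by near: h; exact: nbhs_dnbhs_neq.
  rewrite -(@ler_pM2r _ `|h|) ?normr_gt0// quot//; apply: rP.
  by near: h; apply: dnbhs0_lt.
by apply: DeriveDef; [apply/cvg_ex; exists d|exact/cvg_lim].
Unshelve. all: by end_near. Qed.

Definition cexp z : R[i] := (expR (Re z))%:C * expi (Im z).

Lemma cexpD z w : cexp (z + w) = cexp z * cexp w.
Proof.
case: z w => [a b] [c d]; rewrite /cexp /= expRD expiD rmorphM; ring.
Qed.

Lemma cexp0 : cexp 0 = 1.
Proof. by rewrite /cexp /= expR0 expi0 mulr1. Qed.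

Lemma cexp_real (x : R) : cexp x%:C = (expR x)%:C.
Proof. by rewrite /cexp /= expi0 mulr1. Qed.

Lemma normc_cexp z : normc (cexp z) = expR (Re z).
Proof. by rewrite Normc.normcM normc_expi mulr1 normc_real ger0_norm ?expR_ge0. Qed.

Lemma cderiv_cexp0 : cderiv cexp 0 1.
Proof.
(* The five remainder terms below add up to at most [7 * k * n]. *)
move=> e e0; have [k [k0 k1 ke]] : exists k : R, [/\ 0 < k, k <= 1 & 8 * k <= e].
  exists (Num.min 1 (e / 8)); split; first by rewrite lt_min ltr01 divr_gt0.
    by rewrite ge_min lexx.
  by rewrite mulrC -ler_pdivlMr// ge_min lexx orbT.
have [r1 r10 h1] := (is_derive_epsP expR 0 _).1 (is_derive_expR 0) _ k0.
have [r2 r20 h2] := (is_derive_epsP cos 0 _).1 (is_derive_cos 0) _ k0.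
have [r3 r30 h3] := (is_derive_epsP sin 0 _).1 (is_derive_sin 0) _ k0.
exists (Num.min (Num.min r1 r2) (Num.min r3 k)) => [|[x y] hr].
  by rewrite !lt_min r10 r20 r30 k0.
set n := normc _ in hr *.
have xn : `|x| <= n := le_Re_normc (x +i* y).
have yn : `|y| <= n := le_Im_normc (x +i* y).
move: hr; rewrite !lt_min => /andP[/andP[n1 n2] /andP[n3 nk]].
have := h1 x (le_lt_trans xn n1); have := h2 y (le_lt_trans yn n2).
have := h3 y (le_lt_trans yn n3).
rewrite !add0r expR0 sin0 cos0 oppr0 mul0r !addr0 !subr0 !mul1r => {}h3 {}h2 {}h1.
rewrite cexp0; apply: le_trans (normc_le _) _.
have -> : Re (cexp (x +i* y) - 1 - (x +i* y)) =
    (expR x - 1 - x) * cos y + (1 + x) * (cos y - 1).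
  by rewrite /cexp /expi /=; ring.
have -> : Im (cexp (x +i* y) - 1 - (x +i* y)) =
    (expR x - 1 - x) * sin y + x * sin y + (sin y - y).
  by rewrite /cexp /expi /=; ring.
have cy : `|cos y| <= 1 by rewrite ler_norml cos_geN1 cos_le1.
have sy : `|sin y| <= 1 by rewrite ler_norml sin_geN1 sin_le1.
have sy' : `|sin y| <= 2 * n.
  rewrite -(subrK y (sin y)) (le_trans (ler_normD _ _))//.
  have := ler_wpM2r (normr_ge0 y) k1; move: h3 yn; clear. lra.
have n0 : 0 <= n := normc_ge0 _.
have t1 := ler_pM (normr_ge0 _) (normr_ge0 _) h1 cy.
have t2 : `|1 + x| * `|cos y - 1| <= 2 * (k * n).
  apply: ler_pM => //; last by apply: le_trans h2 _; rewrite ler_wpM2l// ltW.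
  by rewrite (le_trans (ler_normD _ _))// normr1; move: xn nk k1; clear; lra.
have t3 := ler_pM (normr_ge0 _) (normr_ge0 _) h1 sy.
have t4 : `|x| * `|sin y| <= k * (2 * n).
  by apply: ler_pM => //; exact: le_trans xn (ltW nk).
have t5 := ler_wpM2l (ltW k0) xn; have t6 := ler_wpM2l (ltW k0) yn.
have t7 := ler_wpM2r n0 ke; have t8 := mulr_ge0 (ltW k0) n0.
apply: le_trans (lerD (ler_normD _ _) (le_trans (ler_normD _ _) (lerD (ler_normD _ _) (lexx _)))) _.
rewrite !normrM.
move: t1 t2 t3 t4 t5 t6 t7 t8 h3; clear.
by rewrite -!mulrA !mulr1; lra.
Qed.

Lemma cderiv_cexp z : cderiv cexp z (cexp z).
Proof.
move=> e e0; have E0 := expR_gt0 (Re z).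
have [r r0 H] := cderiv_cexp0 (divr_gt0 e0 E0).
exists r => // h /H; rewrite add0r cexp0 mul1r cexpD => le.
rewrite (_ : _ - _ = cexp z * (cexp h - 1 - h)); last by ring.
rewrite Normc.normcM normc_cexp; apply: le_trans (ler_wpM2l (ltW E0) le) _.
by rewrite mulrA (mulrC (expR _)) divfK// gt_eqF.
Qed.

End ComplexExponential.

(** * Uniqueness of analytic continuation *)

Section Identity.
Variable R : realType.
Implicit Types (f w : R -> R) (a b s t x y lo N M : R).

Lemma bintE lo f (G : R -> R) a b : continuous f -> lo < a -> a <= b ->
  (forall x, lo < x -> is_derive x (1 : R) G (f x)) -> bint lo f a b = G b - G a.
Proof.
move=> cf loa ab dG; have [t _] := bint_MVT cf loa ab dG.
by rewrite subrr mul0r => /eqP; rewrite subr_eq0 => /eqP.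
Qed.

Lemma bintB lo f w a b : continuous f -> continuous w -> lo < a -> a <= b ->
  bint lo (fun t => f t - w t) a b = bint lo f a b - bint lo w a b.
Proof.
move=> cf cw loa ab.
have cfw : continuous (fun t => f t - w t).
  by move=> t; apply: cvgB; [exact: cf|exact: cw].
have dG x : lo < x -> is_derive x (1 : R) (prim lo f - prim lo w) (f x - w x).
  move=> lox; have := prim_derive cf lox; have := prim_derive cw lox.
  by move=> *; exact: is_deriveB.
have E x : (prim lo f - prim lo w) x = prim lo f x - prim lo w x by [].
by rewrite (bintE cfw loa ab dG) !E /bint; ring.
Qed.

Lemma bint_bound lo f (G G' : R -> R) a b : continuous f -> lo < a -> a <= b ->
  (forall x, lo < x -> is_derive x (1 : R) G (G' x)) ->
  (forall t, a <= t <= b -> `|f t| <= G' t) -> `|bint lo f a b| <= G b - G a.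
Proof.
move=> cf loa ab dG fG.
have b0 : 0 <= b - a by rewrite subr_ge0.
have [t tab tE] := bint_MVT cf loa ab dG.
have dN x : lo < x -> is_derive x (1 : R) (- G) (- G' x).
  by move=> /dG ?; exact: is_deriveN.
have [u uab uE] := bint_MVT cf loa ab dN.
have EN x : (- G) x = - G x by [].
rewrite !EN in uE.
have := fG _ tab; have := fG _ uab; rewrite !ler_norml => /andP[u1 u2] /andP[t1 t2].
apply/andP; split.
  have : 0 <= (f u - - G' u) * (b - a) by rewrite mulr_ge0//; move: u1; clear; lra.
  by rewrite -uE; lra.
have : 0 <= (G' t - f t) * (b - a) by rewrite mulr_ge0//; move: t2; clear; lra.
have -> : (G' t - f t) * (b - a) = - ((f t - G' t) * (b - a)) by ring.
by rewrite -tE; lra.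
Qed.

Lemma cont_bounded f a b : continuous f -> a <= b ->
  exists M, forall t, a <= t <= b -> `|f t| <= M.
Proof.
move=> cf ab; have cn : {within `[a, b], continuous (fun t => `|f t|)}.
  by apply: continuous_subspaceT => t; apply: cvg_norm; exact: cf.
have [c _ cP] := EVT_max ab cn.
by exists `|f c| => t tab; apply: cP; rewrite in_itv.
Qed.

(* As [N] grows this tends to the indicator function of [t < s]. *)
Definition step_kernel N s t : R := 1 - expR (- expR (N * (s - t))).

(** From [1 - exp(-u) <= u] with [u = exp(N (s - t))]. The bound decays above the height [s]. *)
Lemma step_kernel_le N s t :
  `|step_kernel N s t| <= expR (- (N * (t - s))).
Proof.
rewrite /step_kernel ger0_norm.
  rewrite (_ : - (N * _) = N * (s - t)); last by ring.
  by have := expR_ge1Dx (- expR (N * (s - t))); lra.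
by rewrite subr_ge0 -expR0 ler_expR oppr_le0 expR_ge0.
Qed.

(** From [exp(x) >= x] with [x = N (s - t)]. The bound decays below the height [s]. *)
Lemma step_kernel_ge N s t :
  `|1 - step_kernel N s t| <= expR (N * (t - s)).
Proof.
rewrite /step_kernel subKr ger0_norm ?expR_ge0// ler_expR.
by have := expR_ge1Dx (N * (s - t)); rewrite !mulrBr; lra.
Qed.

Lemma is_derive_expR_affine (M N s t : R) : N != 0 ->
  is_derive t (1 : R) (fun t => M / N * expR (N * (t - s)))
    (M * expR (N * (t - s))).
Proof.
move=> N0.
have d1 : is_derive t (1 : R) (fun t => N * (t - s)) N.
  by apply: is_derive_eq; rewrite /GRing.scale/= !(mul0r, addr0, subr0, mulr1).
have d2 : is_derive t (1 : R) (expR \o (fun t => N * (t - s))) (expR (N * (t - s)) * N).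
  exact: is_derive1_comp.
have -> : M * expR (N * (t - s)) = M / N * (expR (N * (t - s)) * N).
  by field.
exact: is_deriveZ.
Qed.

Lemma continuous_step_kernel N s : continuous (step_kernel N s).
Proof.
move=> t; apply: cvgB; first exact: cvg_cst.
apply: (@continuous_comp _ _ _ (fun t => - expR (N * (s - t))) expR); last exact: continuous_expR.
apply: cvgN; apply: (@continuous_comp _ _ _ (fun t => N * (s - t)) expR); last exact: continuous_expR.
by apply: cvgMr; apply: cvgB; [exact: cvg_cst|exact: cvg_id].
Qed.

(** The kernel differs from the indicator of [t < s] by at most [exp(-N |t - s|)], whose integral on
    either side of [s] is at most [1 / N]. *)
Lemma bint_step_kernel lo w N M s Y : continuous w -> lo < 0 -> 0 < N ->
  0 <= s <= Y -> (forall t, 0 <= t <= Y -> `|w t| <= M) ->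
  `|bint lo w 0 s| <=
    `|bint lo (fun t => step_kernel N s t * w t) 0 Y| + 2 * M / N.
Proof.
move=> cw lo0 N0 /andP[s0 sY] wM.
have M0 : 0 <= M by apply: le_trans (wM 0 _); rewrite ?normr_ge0// lexx (le_trans s0).
have NN : N != 0 by rewrite gt_eqF.
set k := step_kernel N s.
have ckw : continuous (fun t => k t * w t).
  by move=> t; apply: cvgM; [exact: continuous_step_kernel|exact: cw].
have ckw' : continuous (fun t => (1 - k t) * w t).
  by move=> t; apply: cvgM; [apply: cvgB; [exact: cvg_cst|exact: continuous_step_kernel]|exact: cw].
have E : bint lo w 0 s = bint lo (fun t => k t * w t) 0 Y +
    (bint lo (fun t => (1 - k t) * w t) 0 s - bint lo (fun t => k t * w t) s Y).
  rewrite (_ : (fun t => (1 - k t) * w t) = (fun t => w t - k t * w t)); last first.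
    by apply/funext => t; ring.
  by rewrite bintB// /bint; ring.
have B1 : `|bint lo (fun t => (1 - k t) * w t) 0 s| <= M / N.
  have d1 x (_ : lo < x) := is_derive_expR_affine M s x NN.
  apply: le_trans (bint_bound ckw' lo0 s0 d1 _) _ => /=.
    move=> t /andP[t0 ts]; rewrite normrM mulrC.
    apply: ler_pM => //; last exact: step_kernel_ge.
    by apply: wM; rewrite t0 (le_trans ts).
  rewrite subrr mulr0 expR0 mulr1 lerBlDr lerDl.
  by rewrite mulr_ge0 ?expR_ge0// divr_ge0// ltW.
have B2 : `|bint lo (fun t => k t * w t) s Y| <= M / N.
  have NN' : - N != 0 by rewrite oppr_eq0.
  have d1 x (_ : lo < x) := is_derive_expR_affine M s x NN'.
  apply: le_trans (bint_bound ckw (lt_le_trans lo0 s0) sY d1 _) _ => /=.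
    move=> t /andP[ts tY]; rewrite normrM mulrC.
    apply: ler_pM => //; last by rewrite mulNr; exact: step_kernel_le.
    by apply: wM; rewrite (le_trans s0 ts).
  rewrite subrr mulr0 expR0 mulr1 invrN mulrN mulNr opprK.
  by rewrite -[leRHS]add0r lerD2r oppr_le0 mulr_ge0 ?expR_ge0// divr_ge0// ltW.
rewrite E (le_trans (ler_normD _ _))// lerD2l (le_trans (ler_normB _ _))//.
by apply: le_trans (lerD B1 B2) _; rewrite -mulrDl; rewrite mulr_natl mulr2n.
Qed.

End Identity.

(** * Holomorphic functions that vanish on the real line *)

Section IdentityTheorem.
Variable R : realType.
Implicit Types (f g : R[i] -> R[i]) (z : R[i]).

Definition holomorphic g := forall z, exists A, cderiv g z A.

Lemma holomorphic_line g (z d : R[i]) : holomorphic g ->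
  continuous (fun t : R => Re (g (z + t%:C * d))) /\
  continuous (fun t : R => Im (g (z + t%:C * d))).
Proof.
move=> hg.
have H (t : R) : exists K, exists2 r : R, 0 < r & forall h : R, `|h| < r ->
    normc (g (z + (t + h)%:C * d) - g (z + t%:C * d)) <= K * `|h|.
  have [A /cderiv_lipschitz[r r0 rP]] := hg (z + t%:C * d).
  have d0 : 0 < normc d + 1 by rewrite ltr_wpDl// normc_ge0.
  exists ((normc A + 1) * normc d), (r / (normc d + 1)); first by rewrite divr_gt0.
  move=> h hr; have hd : normc (h%:C * d) = `|h| * normc d.
    by rewrite Normc.normcM normc_real.
  rewrite (_ : z + (t + h)%:C * d = z + t%:C * d + h%:C * d); last first.
    by rewrite rmorphD /=; ring.
  apply: le_trans (rP _ _) _; last by rewrite hd; rewrite mulrA (mulrAC _ _ `|h|).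
  rewrite hd; rewrite ltr_pdivlMr// in hr; apply: le_lt_trans hr.
  by rewrite ler_wpM2l// lerDl.
split=> t; have [K [r r0 rP]] := H t; apply: (@lipschitz_cont _ _ _ K _ r0) => h hr.
  apply: le_trans (rP h hr); apply: le_trans (le_Re_normc _).
  by case: (g _) (g _) => [? ?] [].
apply: le_trans (rP h hr); apply: le_trans (le_Im_normc _).
by case: (g _) (g _) => [? ?] [].
Qed.

Lemma holomorphic_vline g x : holomorphic g ->
  continuous (fun t => Re (g (x +i* t))) /\ continuous (fun t => Im (g (x +i* t))).
Proof.
move=> /(holomorphic_line (x +i* 0) (0 +i* 1)).
have E (t : R) : x +i* 0 + t%:C * (0 +i* 1) = x +i* t by simpc.
by under eq_fun do rewrite E; under [X in _ /\ continuous X]eq_fun do rewrite E.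
Qed.

Lemma holomorphic_hline g y : holomorphic g ->
  continuous (fun t => Re (g (t +i* y))) /\ continuous (fun t => Im (g (t +i* y))).
Proof.
move=> /(holomorphic_line (0 +i* y) 1).
have E (t : R) : 0 +i* y + t%:C * 1 = t +i* y by simpc.
by under eq_fun do rewrite E; under [X in _ /\ continuous X]eq_fun do rewrite E.
Qed.


Lemma holomorphicB f g : holomorphic f -> holomorphic g ->
  holomorphic (fun z => f z - g z).
Proof.
by move=> hf hg z; have [A fA] := hf z; have [B gB] := hg z; exists (A - B);
  exact: cderivB.
Qed.

Lemma holomorphicM f g : holomorphic f -> holomorphic g ->
  holomorphic (fun z => f z * g z).
Proof.
move=> hf hg z; have [A fA] := hf z; have [B gB] := hg z.
by exists (A * g z + f z * B); exact: cderivM.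
Qed.

Lemma holomorphic_cst c : holomorphic (fun=> c).
Proof. by move=> z; exists 0; exact: cderiv_const. Qed.

Lemma holomorphic_cexp c A : holomorphic (fun z => cexp (c + A * z)).
Proof.
move=> z; exists (cexp (c + A * z) * A).
exact: (cderiv_comp (cderiv_cexp _) (cderiv_affine c A z)).
Qed.

Lemma expi_2pin n : expi (n%:R * (pi *+ 2)) = 1 :> R[i].
Proof.
elim: n => [|n IH]; first by rewrite mul0r expi0.
by rewrite -natr1 mulrDl mul1r expiD IH mul1r /expi cos2pi sin2pi.
Qed.

(* A holomorphic version of [step_kernel]: its values on a vertical line on
   which [N * (x - a)] is a multiple of [2 * pi] are those of [step_kernel]. *)
Definition cstep_kernel (N s a : R) z : R[i] :=
  1 - cexp (0 + -1 * cexp ((N * s +i* - (N * a)) + (0 +i* N) * z)).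

Lemma holomorphic_cstep_kernel (N s a : R) : holomorphic (cstep_kernel N s a).
Proof.
apply: holomorphicB; first exact: holomorphic_cst.
move=> z; set h := fun z => cexp ((N * s +i* - (N * a)) + (0 +i* N) * z).
have [A hA] : exists A, cderiv h z A by exact: holomorphic_cexp.
exists (cexp (0 + -1 * h z) * -1 * A).
have d1 := cderiv_comp (cderiv_cexp _) (cderiv_affine 0 (-1) (h z)).
exact: (cderiv_comp d1 hA).
Qed.

Lemma cstep_kernel_inner (N s a x y : R) :
  cexp ((N * s +i* - (N * a)) + (0 +i* N) * (x +i* y)) =
  (expR (N * (s - y)))%:C * expi (N * (x - a)).
Proof.
have -> : (N * s +i* - (N * a)) + (0 +i* N) * (x +i* y) =
    (N * (s - y)) +i* (N * (x - a)) by simpc; congr (_ +i* _); ring.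
by [].
Qed.

Lemma cstep_kernel_side (N s a x t : R) : expi (N * (x - a)) = 1 ->
  cstep_kernel N s a (x +i* t) = (step_kernel N s t)%:C.
Proof.
move=> E; rewrite /cstep_kernel cstep_kernel_inner E mulr1 add0r mulN1r -rmorphN.
by rewrite cexp_real /step_kernel rmorphB.
Qed.

(** The kernel is [1 - exp(-u)] with [|u| = exp(N (s - y))]; the factor 2 is the Lipschitz constant
    [1 + 1] of [cexp] near 0. *)
Lemma cstep_kernel_top : exists2 r : R, 0 < r & forall N s a x y : R,
  expR (N * (s - y)) < r ->
  normc (cstep_kernel N s a (x +i* y)) <= 2 * expR (N * (s - y)).
Proof.
have [r r0 rP] := cderiv_lipschitz (@cderiv_cexp0 R).
exists r => // N s a x y lt.
rewrite /cstep_kernel cstep_kernel_inner add0r mulN1r.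
set u := _ * expi _.
have nu : normc (- u) = expR (N * (s - y)).
  by rewrite normcN Normc.normcM normc_expi mulr1 normc_real ger0_norm ?expR_ge0.
have := rP (- u); rewrite nu add0r cexp0 Normc.normc1 -normcN opprB => /(_ lt).
by rewrite (_ : 1 + 1 = 2).
Qed.

(* The boundary integral of [cstep_kernel N s a * g] has no contribution from
   the bottom side, and one of order [1 / N] from the top side. *)
Lemma bint_im_diff0 g (a b s lo : R) : holomorphic g ->
  (forall x : R, g x%:C = 0) -> a < b -> 0 < s -> lo < 0 -> lo < a ->
  bint lo (fun t => Im (g (b +i* t)) - Im (g (a +i* t))) 0 s = 0.
Proof.
move=> hg g0 ab s0 lo0 loa.
(* The top side is put one unit above [s], where the kernel is of size [exp(-N) <= 1 / N]. *)
have lob := lt_trans loa ab; have ab' := ltW ab.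
set w := fun t => _; set Y := s + 1.
have Y0 : 0 <= Y by rewrite addr_ge0// ltW.
have cw : continuous w.
  move=> t; apply: cvgB.
    by have [_] := holomorphic_vline b hg; exact.
  by have [_] := holomorphic_vline a hg; exact.
have [M wM] := cont_bounded cw Y0.
have M0 : 0 <= M by apply: le_trans (wM 0 _); rewrite ?normr_ge0// lexx.
have [cRe cIm] := holomorphic_hline Y hg.
have [M1 M1P] := cont_bounded cRe ab'; have [M2 M2P] := cont_bounded cIm ab'.
set K := M1 + M2.
have gK x : a <= x <= b -> normc (g (x +i* Y)) <= K.
  by move=> xab; apply: le_trans (normc_le _) _; apply: lerD; [exact: M1P|exact: M2P].
have K0 : 0 <= K by apply: le_trans (gK a _); rewrite ?normc_ge0// lexx.
have [r r0 rP] := cstep_kernel_top.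
(* For [N = n * T] the phase [N * (b - a)] is a multiple of [2 * pi], so the holomorphic kernel is
   real and the same on both vertical sides. *)
set T := (pi *+ 2) / (b - a).
have ba0 : 0 < b - a by rewrite subr_gt0.
have T0 : 0 < T by rewrite divr_gt0// mulrn_wgt0// pi_gt0.
have main n : (0 < n)%N -> 1 / (n%:R * T) < r ->
    `|bint lo w 0 s| <= (2 * K * (b - a) + 2 * M) / (n%:R * T).
  move=> n0; set N := n%:R * T => Nr.
  have N0 : 0 < N by rewrite mulr_gt0// ltr0n.
  apply: le_trans (bint_step_kernel (Y := Y) (M := M) cw lo0 N0 _ _) _ => //.
    by rewrite (ltW s0) lerDl ler01.
  rewrite [leRHS]mulrDl. rewrite lerD2r.
  have q1 : expR (N * (s - Y)) <= 1 / N.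
    rewrite (_ : N * (s - Y) = - N); last by rewrite /Y; ring.
    rewrite expRN div1r lef_pV2 ?posrE ?expR_gt0//.
    by apply: le_trans (expR_ge1Dx N); rewrite lerDr.
  pose e z := cstep_kernel N s a z * g z.
  have he : holomorphic e by apply: holomorphicM => //; exact: holomorphic_cstep_kernel.
  have closed x y : closed_at (fun x y => Re (e (x +i* y)))
      (fun x y => - Im (e (x +i* y))) x y.
    by have [A eA] := he (x +i* y); exact: cderiv_closed eA.
  have := goursat closed loa ab' lo0 Y0; rewrite /rect_bint.
  have side x : expi (N * (x - a)) = 1 ->
      (fun y => - Im (e (x +i* y))) = (fun t => - (step_kernel N s t * Im (g (x +i* t)))).
    move=> E; apply/funext => t; rewrite /e (cstep_kernel_side _ _ E).
    by case: (g _) => u v /=; rewrite mul0r addr0.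
  have Ea : expi (N * (a - a)) = 1 :> R[i] by rewrite subrr mulr0 expi0.
  have Eb : expi (N * (b - a)) = 1 :> R[i].
    by rewrite /N /T -mulrA divfK ?gt_eqF// expi_2pin.
  rewrite (side _ Ea) (side _ Eb).
  have -> : (fun x => Re (e (x +i* 0))) = (fun=> 0).
    by apply/funext => x; rewrite /e (g0 x) mulr0.
  have d0 x (_ : lo < x) : is_derive x (1 : R) (cst 0 : R -> R) 0 by exact: is_derive_cst.
  have c0 : continuous (fun _ : R => 0 : R) by exact: cst_continuous.
  rewrite (bintE c0 loa ab' d0) subrr.
  have ckI x : continuous (fun t => - (step_kernel N s t * Im (g (x +i* t)))).
    move=> t; apply: cvgN; apply: cvgM; first exact: continuous_step_kernel.
    by have [_] := holomorphic_vline x hg; exact.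
  rewrite sub0r -addrA -(bintB (ckI b) (ckI a) lo0 Y0).
  rewrite (_ : (fun t => _ - _) = (fun t => 0 - (step_kernel N s t * w t))); last first.
    by apply/funext => t; rewrite /w; ring.
  rewrite bintB//; last first.
    by move=> t; apply: cvgM; [exact: continuous_step_kernel|exact: cw].
  rewrite (bintE c0 lo0 Y0 d0) subrr sub0r.
  set X := bint lo _ a b; set Z := bint lo _ 0 Y => XZ.
  (* Goursat's identity equates the kernel-weighted integral [Z] of [w] with the top side, up to
     sign. *)
  have -> : Z = - X by move: XZ; clear; lra.
  rewrite normrN /X {X Z XZ}.
  have [cReE _] := holomorphic_hline Y he.
  set B := 2 * (1 / N) * K.
  have dB x (_ : lo < x) : is_derive x (1 : R) (fun x => B * x) B.
    by apply: is_derive_eq; rewrite /GRing.scale/= mulr1.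
  apply: le_trans (bint_bound cReE loa ab' dB _) _ => /=.
    move=> x xab; apply: le_trans (le_Re_normc _) _; rewrite Normc.normcM.
    apply: ler_pM; rewrite ?normc_ge0//; last exact: gK.
    apply: le_trans (rP _ _ _ _ _ (le_lt_trans q1 Nr)) _.
    by rewrite ler_wpM2l.
  by rewrite -mulrBr /B le_eqVlt; apply/orP; left; apply/eqP; field; rewrite gt_eqF.
clearbody T; set C := 2 * K * (b - a) + 2 * M in main *.
have C0 : 0 <= C by rewrite addr_ge0 ?mulr_ge0// ltW.
apply/eqP; rewrite -normr_eq0; apply/eqP/le_anti; rewrite normr_ge0 andbT.
apply/ler_addgt0Pl => e e0; rewrite addr0.
have C1 : 0 < C + 1 by rewrite ltr_wpDl.
(* Making [1 / (n * T)] smaller than [m] meets the smallness condition of [main] and brings its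
   bound below [e]. *)
have [m [m0 mr me]] : exists m : R, [/\ 0 < m, m <= r & m * (C + 1) <= e].
  exists (Num.min r (e / (C + 1))); split; first by rewrite lt_min r0 divr_gt0.
    by rewrite ge_min lexx.
  by rewrite -ler_pdivlMr// ge_min lexx orbT.
pose n := (Num.bound (1 / (m * T))).+1.
have nm : 1 / (n%:R * T) < m.
  have : 1 / (m * T) < n%:R.
    apply: lt_trans (archi_boundP _) _; first by rewrite divr_ge0// mulr_ge0// ltW.
    by rewrite ltr_nat.
  rewrite ltr_pdivrMr ?mulr_gt0// => lt1.
  by rewrite ltr_pdivrMr ?mulr_gt0 ?ltr0n// mulrCA.
apply: le_trans (main n isT (lt_le_trans nm mr)) _.
apply: le_trans me; rewrite (mulrC m); apply: ler_pM => //.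
- by rewrite invr_ge0 mulr_ge0// ltW.
- by rewrite lerDl ler01.
- by rewrite -div1r ltW.
Qed.

(* The imaginary part vanishes on differences of vertical lines, hence depends
   on the height only; by Cauchy-Riemann the real part does not. *)
Lemma holomorphic_Re_eq0 g (x y : R) : holomorphic g ->
  (forall x : R, g x%:C = 0) -> 0 <= y -> Re (g (x +i* y)) = 0.
Proof.
move=> hg g0; have Im_eq (a b t : R) : a < b -> 0 < t ->
    Im (g (b +i* t)) = Im (g (a +i* t)).
  move=> ab t0; apply/eqP; rewrite -subr_eq0; apply/negP => /negP nz.
  pose w u := Im (g (b +i* u)) - Im (g (a +i* u)).
  have cw : continuous w.
    move=> u; apply: cvgB.
      by have [_] := holomorphic_vline b hg; exact.
    by have [_] := holomorphic_vline a hg; exact.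
  have wt0 : 0 < `|w t| by rewrite normr_gt0.
  (* Near [t] the difference [w] has no zero; yet its integral from [t] to [t + d / 2] vanishes, so
     the mean value theorem yields a zero there. *)
  have /nbhs_ballP[d /= d0 dP] : \forall u \near t, `|w t - w u| < `|w t|.
    by move/cvgrPdist_lt: (cw t); apply.
  pose lo := Num.min a 0 - 1.
  have [loa lo0] : lo < a /\ lo < 0.
    by rewrite /lo; case: (leP a 0) => h; split; lra.
  have td0 : t < t + d / 2 by rewrite ltrDl divr_gt0.
  have dc u (_ : lo < u) : is_derive u (1 : R) (cst 0 : R -> R) 0 by exact: is_derive_cst.
  have lot := lt_trans lo0 t0.
  have [u /andP[tu ud]] := bint_MVT cw lot (ltW td0) dc.
  have -> : bint lo w t (t + d / 2) = bint lo w 0 (t + d / 2) - bint lo w 0 t.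
    by rewrite /bint; ring.
  rewrite !(bint_im_diff0 hg g0)//; last by rewrite (lt_trans t0).
  rewrite !subrr !subr0 => /esym/eqP; rewrite mulf_eq0 => /orP[/eqP wu|]; last first.
    by rewrite addrC addKr gt_eqF// divr_gt0.
  suff : ball t d u by move/dP; rewrite wu subr0 ltxx.
  rewrite -ball_normE /ball_/= distrC ger0_norm ?subr_ge0//.
  by rewrite ltrBlDl (le_lt_trans ud)// ltrD2l gtr_pMr// invf_lt1// ltr1n.
have dRe (t : R) : 0 < t -> is_derive t (1 : R) (fun t => Re (g (x +i* t))) 0.
  move=> t0; have [A gA] := hg (x +i* t).
  (* [Im g] is constant along the horizontal line, so horizontal difference quotients are real. The
     vertical derivative of [Re g] is [- Im A]. *)
  have A0 : Im A = 0.
    apply/eqP; rewrite -normr_eq0; apply/eqP/le_anti; rewrite normr_ge0 andbT.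
    apply/ler_addgt0Pl => e e0; rewrite addr0.
    have [r r0 rP] := gA e e0; pose h := r / 2.
    have h0 : 0 < h by rewrite divr_gt0.
    have := rP h%:C; rewrite normc_real gtr0_norm// => /(_ (ltac:(rewrite /h; lra))).
    move/(le_trans (le_Im_normc _)).
    have := Im_eq x (x + h) t; rewrite ltrDl => /(_ h0 t0).
    rewrite (_ : (x +i* t) + h%:C = (x + h) +i* t); last by simpc.
    case: (g _) (g _) A {gA rP} => [u1 u2] [v1 v2] [a1 a2] /= ->.
    rewrite subrr add0r mulr0 add0r normrN normrM (gtr0_norm h0).
    by rewrite ler_pM2r.
  apply/is_derive_epsP => e e0; have [r r0 rP] := gA e e0.
  exists r => // h hr; have nh : normc (0 +i* h) = `|h|.
    by rewrite /= expr0n add0r sqrtr_sqr.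
  have := rP (0 +i* h); rewrite nh => /(_ hr); move/(le_trans (le_Re_normc _)).
  rewrite (_ : (x +i* t) + (0 +i* h) = x +i* (t + h)); last by simpc.
  case: (g _) (g _) A A0 {gA rP} => [u1 u2] [v1 v2] [a1 a2] /= ->.
  by rewrite mulr0 !mul0r subr0.
rewrite le_eqVlt => /predU1P[<-|y0]; first by rewrite g0.
have := @MVT_segment R (fun t => Re (g (x +i* t))) (fun=> 0) 0 y (ltW y0).
case=> [t||t _].
- by rewrite in_itv/= => /andP[/dRe].
- by apply: continuous_subspaceT; have [] := holomorphic_vline x hg.
- by rewrite mul0r => /eqP; rewrite subr_eq0 => /eqP ->; rewrite g0.
Qed.

(** [Im g] is minus the real part of [i * g], so the result on real parts is applied to [g] and to
    [i * g]. *)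
Theorem holomorphic_eq0 g (x y : R) : holomorphic g ->
  (forall x : R, g x%:C = 0) -> 0 <= y -> g (x +i* y) = 0.
Proof.
move=> hg g0 y0; have := holomorphic_Re_eq0 x hg g0 y0.
have hg' : holomorphic (fun z => (0 +i* 1) * g z).
  by apply: holomorphicM => //; exact: holomorphic_cst.
have := @holomorphic_Re_eq0 _ x y hg' _ y0.
case: (g (x +i* y)) => u v /= h ->; congr (_ +i* _).
have : 0 * u - 1 * v = 0 by apply: h => t; rewrite g0 mulr0.
by rewrite mul0r sub0r mul1r => /eqP; rewrite oppr_eq0 => /eqP.
Qed.

End IdentityTheorem.

(** * Completeness of the bounded operators *)

Section Completeness.
Variable R : realType.

Lemma dyadic_le0 (a K : R) : (forall n, a <= K / 2 ^+ n) -> a <= 0.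
Proof.
move=> aK; rewrite leNgt; apply/negP => a0.
have [N /(_ N (leqnn N))] := dyadic_small K a0.
by rewrite ltNge aK.
Qed.

Lemma dyadicS (C : R) n : C / 2 ^+ n = C / 2 ^+ n.+1 + C / 2 ^+ n.+1.
Proof. by rewrite exprS; field; rewrite expf_neq0. Qed.

(** The intervals of radius [2 * C / 2 ^+ n] around [u n] are nested. *)
Lemma dyadic_cauchy_cvg (u : nat -> R) C :
  (forall n, `|u n.+1 - u n| <= C / 2 ^+ n) ->
  exists l, forall n, `|u n - l| <= 2 * C / 2 ^+ n.
Proof.
move=> uC; have [|l lP] := @nested_dyadic R (fun n => u n - 2 * C / 2 ^+ n) (4 * C).
  move=> n; have := uC n; rewrite ler_norml.
  have E (k : R) : k * C / 2 ^+ n.+1 = k / 2 * (C / 2 ^+ n).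
    by rewrite exprS; field; rewrite expf_neq0.
  rewrite !E -(mulrA 2 C).
  by move=> /andP[h1 h2]; apply/andP; split; move: h1 h2; set D := _ / _; lra.
exists l => n; have := lP n; rewrite -!mulrA; set D := C * _.
by move=> /andP[h1 h2]; rewrite ler_norml; apply/andP; split; lra.
Qed.

Variable I : choiceType.
Local Notation H := (l2 R I).
Local Notation B := (bop R I).

Lemma l2norm_ge_normc (x : H) i : normc (x i) <= l2norm x.
Proof.
rewrite -(@ler_pXn2r _ 2)// ?nnegrE ?normc_ge0 ?l2norm_ge0//.
rewrite /l2norm sqr_sqrtr ?nnsum_normc_ge0//.
apply: (nnsum_ge (u := fun i => normc (x i) ^+ 2)) => [j|]; first exact: sqr_ge0.
exact: l2P.
Qed.

Lemma l2norm_fsum_le (x : H) (X : set I) : finite_set X ->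
  \sum_(i \in X) normc (x i) ^+ 2 <= l2norm x ^+ 2.
Proof.
move=> fX; rewrite /l2norm sqr_sqrtr ?nnsum_normc_ge0//.
rewrite -lee_fin -nnsumE; [|by move=> j; exact: sqr_ge0|exact: l2P].
by apply: ereal_sup_ubound; exists X; rewrite //= !fsbig_finite// -sumEFin.
Qed.

Lemma l2_of_fsum_le (f : I -> R[i]) (D : R) :
  (forall X, finite_set X -> \sum_(i \in X) normc (f i) ^+ 2 <= D ^+ 2) ->
  0 <= D -> exists2 x : H, (forall i, x i = f i) & l2norm x <= D.
Proof.
move=> fD D0; have le : (\esum_(i in [set: I]) (normc (f i) ^+ 2)%:E <= (D ^+ 2)%:E)%E.
  apply: ge_ereal_sup => _ [X [fX _] <-].
  by rewrite fsbig_finite//= sumEFin lee_fin -fsbig_finite// fD.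
have sf : f \in @l2_pred R I.
  apply/asboolP; rewrite /sqsummable /rsummable /summable.
  rewrite (eq_esum (b := fun i => (normc (f i) ^+ 2)%:E)) => [|i _ /=].
    exact: le_lt_trans le (ltry _).
  by rewrite ger0_norm// sqr_ge0.
exists (L2 sf) => //; rewrite /l2norm -(ger0_norm D0) -sqrtr_sqr ler_wsqrtr//.
by rewrite -lee_fin -nnsumE//; [move=> j; exact: sqr_ge0|exact/asboolP].
Qed.

(** The coordinatewise limit exists; the norm estimate is proved on finite sets of coordinates first
    and passes to their supremum. *)
Lemma l2_dyadic_cauchy_cvg (u : nat -> H) (C : R) :
  (forall n, l2norm (u n.+1 - u n) <= C / 2 ^+ n) ->
  exists l, forall n, l2norm (l - u n) <= 2 * C / 2 ^+ n.
Proof.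
move=> uC.
have C0 : 0 <= C by have := le_trans (l2norm_ge0 _) (uC 0%N); rewrite expr0 divr1.
have lim i : exists l : R[i], forall n, normc (l - u n i) <= 4 * C / 2 ^+ n.
  have [|a aP] := @dyadic_cauchy_cvg (fun n => Re (u n i)) C.
    move=> n; apply: le_trans (uC n); apply: le_trans (l2norm_ge_normc _ i).
    by apply: le_trans (le_Re_normc _); rewrite l2D l2N; case: (u n i) (u n.+1 i) => ? ? [].
  have [|b bP] := @dyadic_cauchy_cvg (fun n => Im (u n i)) C.
    move=> n; apply: le_trans (uC n); apply: le_trans (l2norm_ge_normc _ i).
    by apply: le_trans (le_Im_normc _); rewrite l2D l2N; case: (u n i) (u n.+1 i) => ? ? [].
  exists (a +i* b) => n; apply: le_trans (normc_le _) _.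
  move: (aP n) (bP n); case: (u n i) => v w /=.
  by rewrite (distrC v) (distrC w) -!mulrA; set D := C * _; lra.
have [f fP] := choice lim.
have tel m n : l2norm (u (n + m)%N - u n) <= 2 * C / 2 ^+ n - 2 * C / 2 ^+ (n + m).
  elim: m => [|m IH]; first by rewrite addn0 !subrr l2norm0.
  rewrite addnS -(subrK (u (n + m)%N) (u _.+1)) -addrA.
  apply: le_trans (l2normD _ _) _; apply: le_trans (lerD (uC _) IH) _.
  rewrite -!mulrA (dyadicS C (n + m)); set D := C / 2 ^+ n; set E := C / 2 ^+ _.
  lra.
have fin n : exists2 x : H, (forall i, x i = f i - u n i) &
    l2norm x <= 2 * C / 2 ^+ n.
  have D0 : 0 <= 2 * C / 2 ^+ n by rewrite !mulr_ge0// invr_ge0 exprn_ge0.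
  apply: l2_of_fsum_le => // X fX; set D := 2 * C / 2 ^+ n in D0 *.
  rewrite -subr_le0 fsbig_finite//=; set s : seq I := finmap.enum_fset (fset_set X); pose N := (size s)%:R : R.
  have sums (x : H) : \sum_(i <- s) normc (x i) ^+ 2 <= l2norm x ^+ 2.
    by rewrite -fsbig_finite//; exact: l2norm_fsum_le.
  (* On [N] coordinates, replacing the limit by [u (n + m)] costs at most [N * (2 * D + 4 * C) * d],
     which tends to 0 as [m] grows. *)
  apply: (@dyadic_le0 _ (N * (2 * D + 4 * C) * (4 * C))) => m.
  have d0 : 0 <= 4 * C / 2 ^+ m by rewrite !mulr_ge0// invr_ge0 exprn_ge0.
  have d1 : 4 * C / 2 ^+ m <= 4 * C.
    by rewrite ler_piMr ?mulr_ge0// invf_le1 ?exprn_gt0// exprn_ege1// ler1n.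
  set d := 4 * C / 2 ^+ m in d0 d1.
  have tel' : l2norm (u (n + m)%N - u n) <= D.
    apply: le_trans (tel m n) _.
    by rewrite lerBlDr lerDl !mulr_ge0// invr_ge0 exprn_ge0.
  have pt i : normc (f i - u n i) ^+ 2 <=
      normc ((u (n + m)%N - u n) i) ^+ 2 + (2 * D + 4 * C) * d.
    have h1 : normc (f i - u n i) <= d + normc ((u (n + m)%N - u n) i).
      rewrite -(subrK (u (n + m)%N i) (f i)) -addrA.
      apply: le_trans (le_normcD _ _) _; rewrite l2D l2N lerD2r.
      apply: le_trans (fP i (n + m)%N) _; rewrite ler_wpM2l ?mulr_ge0//.
      by rewrite lef_pV2 ?posrE ?exprn_gt0// ler_weXn2l ?ler1n// leq_addl.
    have h2 := le_trans (l2norm_ge_normc (u (n + m)%N - u n) i) tel'.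
    move: h1 h2 (normc_ge0 (f i - u n i)) (normc_ge0 ((u (n + m)%N - u n) i)).
    set p := normc (f i - _); set q := normc _ => h1 h2 p0 q0.
    have h3 : p ^+ 2 <= (d + q) ^+ 2 by rewrite ler_pXn2r// nnegrE addr_ge0.
    have h4 : d * q <= d * D by rewrite ler_wpM2l.
    have h5 : d * d <= d * (4 * C) by rewrite ler_wpM2l.
    by apply: le_trans h3 _; rewrite !expr2; move: h4 h5; clear; lra.
  rewrite lerBlDr; apply: le_trans (ler_sum _ (fun i _ => pt i)) _.
  rewrite big_split /= big_const_seq count_predT iter_addr_0 -[_ *+ size s]mulr_natl addrC lerD//.
    by rewrite le_eqVlt; apply/orP; left; apply/eqP; rewrite /N /d; ring.
  by apply: (le_trans (sums (u (n + m)%N - u n))); rewrite ler_pXn2r// nnegrE l2norm_ge0.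
have [x0 x0E _] := fin 0%N.
exists (x0 + u 0%N) => n; have [x xE xn] := fin n.
by rewrite (_ : _ - _ = x)//; apply: l2_ext => i; rewrite !l2D l2N xE x0E; ring.
Qed.

End Completeness.

(** * Norm limits of operators and square roots in the Toeplitz algebra *)

Section OperatorCompleteness.
Variable R : realType.
Local Notation H := (l2 R affine).
Local Notation B := (bop R affine).
Implicit Types (A : nat -> B) (x y : H).

Lemma pointwise_dyadic_limit A C : (forall n, opnorm (A n.+1 - A n) <= C / 2 ^+ n) ->
  exists f : H -> H, forall n x, l2norm (f x - A n x) <= 2 * (C * l2norm x) / 2 ^+ n.
Proof.
move=> AC; suff /choice[f fP] : forall x, exists l : H,
    forall n, l2norm (l - A n x) <= 2 * (C * l2norm x) / 2 ^+ n by exists f.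
move=> x; apply: l2_dyadic_cauchy_cvg => n.
apply: le_trans (opnormP (A n.+1 - A n) x) _.
by rewrite mulrAC ler_wpM2r ?l2norm_ge0.
Qed.

Lemma l2norm_dyadic_eq0 x (K : R) : (forall n, l2norm x <= K / 2 ^+ n) -> x = 0.
Proof.
by move=> /dyadic_le0 h; apply: l2norm_eq0; apply/le_anti; rewrite h l2norm_ge0.
Qed.

Lemma l2normN x : l2norm (- x) = l2norm x.
Proof. by rewrite -scaleN1r l2normZ normcN Normc.normc1 mul1r. Qed.

(** The adjoints satisfy the same Cauchy estimate, and their pointwise limit [g] is the adjoint
    required of the limit [f]. *)
Lemma bop_dyadic_cauchy_cvg A C : (forall n, opnorm (A n.+1 - A n) <= C / 2 ^+ n) ->
  exists L : B, forall n, opnorm (L - A n) <= 2 * C / 2 ^+ n.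
Proof.
move=> AC.
have C0 : 0 <= C by have := le_trans (opnorm_ge0 _) (AC 0%N); rewrite expr0 divr1.
have [f fP] := pointwise_dyadic_limit AC.
have [|g gP] := @pointwise_dyadic_limit (fun n => star (A n)) C.
  move=> n; apply: le_trans (AC n); apply: le_trans (opnorm_star _).
  by rewrite (_ : star (A n.+1 - A n) = star (A n.+1) - star (A n))//; exact: bop_ext.
have lin : linear f.
  move=> c x y; apply/eqP; rewrite -subr_eq0; apply/eqP.
  apply: (@l2norm_dyadic_eq0 _ (2 * (C * l2norm (c *: x + y)) +
    normc c * (2 * (C * l2norm x)) + 2 * (C * l2norm y))) => n.
  rewrite (_ : f _ - _ = (f (c *: x + y) - A n (c *: x + y)) -
     c *: (f x - A n x) - (f y - A n y)); last first.
    rewrite (bop_linear (A n)) !scalerBr !opprB.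
    apply: l2_ext => i; rewrite !(l2D, l2N, l2Z); ring.
  apply: le_trans (l2normD _ _) _.
  apply: le_trans (lerD (l2normD _ _) (lexx _)) _.
  rewrite !l2normN l2normZ [leRHS]mulrDl [X in _ <= X + _]mulrDl.
  apply: lerD; last exact: fP.
  apply: lerD; first exact: fP.
  by rewrite -mulrA ler_wpM2l ?normc_ge0.
have bnd : exists M : R, forall x, l2norm (f x) <= M * l2norm x.
  exists (2 * C + opnorm (A 0%N)) => x; rewrite -(subrK (A 0%N x) (f x)).
  apply: le_trans (l2normD _ _) _; rewrite [leRHS]mulrDl; apply: lerD.
    by have := fP 0%N x; rewrite expr0 divr1 mulrA.
  exact: opnormP.
have adj x y : inner (f x) y = inner x (g y).
  apply/eqP; rewrite -subr_eq0; apply/eqP; apply: Normc.eq0_normc.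
  apply/le_anti; rewrite normc_ge0 andbT.
  apply: (@dyadic_le0 _ _ (2 * (C * l2norm x) * l2norm y + l2norm x * (2 * (C * l2norm y)))).
  move=> n.
  rewrite (_ : _ - _ = inner (f x - A n x) y - inner x (g y - star (A n) y)); last first.
    rewrite innerDl innerDr innerNl innerNr bop_adjE /=; ring.
  apply: le_trans (normcB _ _) _; rewrite [leRHS]mulrDl; apply: lerD.
    apply: le_trans (inner_le _ _) _; rewrite mulrAC.
    by rewrite ler_wpM2r ?l2norm_ge0.
  apply: le_trans (inner_le _ _) _; rewrite -mulrA.
  by rewrite ler_wpM2l ?l2norm_ge0// gP.
exists (Bop lin bnd adj) => n; apply: opnorm_le.
  by rewrite !mulr_ge0// invr_ge0 exprn_ge0.
by move=> x; apply: le_trans (fP n x) _; rewrite mulrA (mulrAC _ (l2norm x)).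
Qed.

Lemma opnorm_scale_real (k : R) (x : B) : 0 <= k -> opnorm (k%:C *: x) = k * opnorm x.
Proof. by move=> k0; rewrite opnormZ normc_real ger0_norm. Qed.

Lemma opnorm_dyadic_eq0 (x : B) (K : R) : (forall n, opnorm x <= K / 2 ^+ n) -> x = 0.
Proof.
by move=> /dyadic_le0 h; apply: opnorm_eq0; apply/le_anti; rewrite h opnorm_ge0.
Qed.

Lemma opnormB (x y : B) : opnorm (x - y) <= opnorm x + opnorm y.
Proof. by rewrite -(opnormN y); exact: opnormD. Qed.

Lemma starZ c (x : B) : star (c *: x) = conjc c *: star x.
Proof. exact: bop_ext. Qed.

Lemma star1 : star 1 = 1 :> B.
Proof. exact: bop_ext. Qed.

Lemma starB (x y : B) : star (x - y) = star x - star y.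
Proof. exact: bop_ext. Qed.

Lemma star0 : star 0 = 0 :> B.
Proof. by rewrite -(subrr (1 : B)) starB star1. Qed.

Lemma toeplitzD c (x y : B) : toeplitz R x -> toeplitz R y -> toeplitz R (c *: x + y).
Proof. by have [h _ _ _] := @toeplitz_cstar R; exact: h. Qed.

Lemma toeplitzM (x y : B) : toeplitz R x -> toeplitz R y -> toeplitz R (x * y).
Proof. by have [_ h _ _] := @toeplitz_cstar R; exact: h. Qed.

Lemma toeplitz_star (x : B) : toeplitz R x -> toeplitz R (star x).
Proof. by have [_ _ h _] := @toeplitz_cstar R; exact: h. Qed.

Lemma Tiso1 : Tiso R (0%N, posnat1) = 1.
Proof.
apply: bop_ext => f; apply: l2_ext => i; rewrite bop_oneE.
have {1}-> : i = affineM (0%N, posnat1) i.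
  by case: i => m a; congr pair; [rewrite /= add0n mul1n|apply: val_inj; rewrite /= mul1n].
exact: shift_at.
Qed.

Lemma toeplitz1 : toeplitz R 1.
Proof. by rewrite -Tiso1; exact: toeplitz_Tiso. Qed.

Lemma toeplitzZ c (x : B) : toeplitz R x -> toeplitz R (c *: x).
Proof.
move=> Tx; have T0 : toeplitz R 0.
  by rewrite -(addNr x) -scaleN1r; exact: toeplitzD.
by rewrite -[_ *: _]addr0; exact: toeplitzD.
Qed.

Lemma toeplitz_add (x y : B) : toeplitz R x -> toeplitz R y -> toeplitz R (x + y).
Proof. by move=> Tx Ty; rewrite -[x]scale1r; exact: toeplitzD. Qed.

Lemma toeplitzB (x y : B) : toeplitz R x -> toeplitz R y -> toeplitz R (x - y).
Proof. by move=> Tx Ty; rewrite addrC -scaleN1r; exact: toeplitzD. Qed.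

(* The square root is [1 - y], with [y] the fixed point of the contraction
   [y |-> (h + y^2) / 2] of the ball of radius 1/2. *)
Lemma toeplitz_sqrt (h : B) : toeplitz R h -> star h = h -> opnorm h <= 3 / 4 ->
  exists y : B, [/\ toeplitz R y, star y = y & y * y = 1 - h].
Proof.
move=> Th hh h34; pose half : R[i] := (2^-1 : R)%:C.
have half0 : 0 <= (2^-1 : R) by rewrite invr_ge0.
pose u := fix u n : B := if n is m.+1 then half *: (h + u m * u m) else 0.
have uS n : u n.+1 = half *: (h + u n * u n) by [].
have Tu n : toeplitz R (u n).
  elim: n => [|n IH] /=; first by rewrite -(scale0r (1 : B)); apply: toeplitzZ; exact: toeplitz1.
  by apply: toeplitzZ; apply: toeplitz_add => //; exact: toeplitzM.
have su n : star (u n) = u n.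
  elim: n => [|n IH] /=; first exact: bop_ext.
  by rewrite starZ starD starM IH hh /half conjc_real.
(* The constant [3 / 4] keeps the iterates in the ball: [(3 / 4 + 1 / 4) / 2 = 1 / 2]. *)
have nu n : opnorm (u n) <= 1 / 2.
  elim: n => [|n IH] /=.
    by rewrite -(scale0r (1 : B)) opnormZ Normc.normc0 mul0r divr_ge0.
  rewrite opnorm_scale_real//.
  have h1 := opnormD h (u n * u n); have h2 := opnormM (u n) (u n).
  have h3 := ler_pM (opnorm_ge0 (u n)) (opnorm_ge0 (u n)) IH IH.
  by move: h1 h2 h3 h34; clear; lra.
have half_sq (x y : B) : opnorm x <= 1 / 2 -> opnorm y <= 1 / 2 ->
    opnorm (half *: (h + x * x) - half *: (h + y * y)) <= opnorm (x - y) / 2.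
  move=> x2 y2; rewrite -scalerBr opnorm_scale_real//.
  rewrite (_ : _ - _ = x * (x - y) + (x - y) * y); last first.
    by rewrite mulrBr mulrBl addrA subrK opprD addrACA subrr add0r.
  have h1 := opnormD (x * (x - y)) ((x - y) * y).
  have h2 := opnormM x (x - y); have h3 := opnormM (x - y) y.
  have h4 := ler_wpM2r (opnorm_ge0 (x - y)) x2.
  have h5 := ler_wpM2l (opnorm_ge0 (x - y)) y2.
  by move: h1 h2 h3 h4 h5; clear; lra.
have cu n : opnorm (u n.+1 - u n) <= 1 / 2 ^+ n.
  elim: n => [|n IH].
    have := opnormB (u 1%N) (u 0%N); have := nu 0%N; have := nu 1%N.
    by rewrite expr0 divr1; clear; lra.
  have -> : u n.+2 - u n.+1 = half *: (h + u n.+1 * u n.+1) - half *: (h + u n * u n) by [].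
  apply: le_trans (half_sq (u n.+1) (u n) (nu n.+1) (nu n)) _.
  by rewrite exprS invfM; move: IH; clear; set D := (_ ^+ _)^-1; lra.
have [y yP] := bop_dyadic_cauchy_cvg cu.
have Ty : toeplitz R y.
  have [_ _ _ cl] := @toeplitz_cstar R; apply: (closedB_approx cl) => e e0.
  have [N NP] := dyadic_small 2 e0; exists (u N) => //.
  by apply: le_lt_trans (yP N) _; rewrite mulr1; exact: NP.
have sy : star y = y.
  apply/eqP; rewrite -subr_eq0; apply/eqP; apply: (@opnorm_dyadic_eq0 _ 4) => n.
  rewrite (_ : star y - y = star (y - u n) - (y - u n)); last first.
    by rewrite starB su opprB addrA subrK.
  apply: le_trans (opnormB _ _) _; have := opnorm_star (y - u n); have := yP n.
  by clear; rewrite mulr1; set D := (_ ^+ _)^-1; lra.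
have y2 : opnorm y <= 1 / 2.
  rewrite -subr_le0; apply: (@dyadic_le0 _ _ 2) => n.
  have := opnormD (y - u n) (u n); rewrite subrK; have := yP n; have := nu n.
  by clear; rewrite mulr1; set D := (_ ^+ _)^-1; lra.
have fix_y : y = half *: (h + y * y).
  apply/eqP; rewrite -subr_eq0; apply/eqP; apply: (@opnorm_dyadic_eq0 _ 4) => n.
  rewrite (_ : y - _ = (y - u n.+1) + (half *: (h + u n * u n) - half *: (h + y * y))); last first.
    by rewrite uS addrA subrK.
  apply: le_trans (opnormD _ _) _.
  have := half_sq _ _ (nu n) y2; have := yP n; have := yP n.+1.
  rewrite -(opnormN (u n - y)) opprB mulr1 exprS invfM.
  have : 0 <= (2 ^+ n)^-1 :> R by rewrite invr_ge0 exprn_ge0.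
  by clear; set D := (_ ^+ _)^-1; lra.
exists (1 - y); split.
- by apply: toeplitzB => //; exact: toeplitz1.
- by rewrite starB star1 sy.
have yy : y + y = h + y * y.
  rewrite {1 2}fix_y -scalerDl (_ : half + half = 1) ?scale1r//.
  by rewrite /half -rmorphD /=; congr _%:C; field.
have -> : (1 - y) * (1 - y) = 1 - (y + y) + y * y.
  by rewrite mulrBl mul1r mulrBr mulr1 opprB opprD !addrA addrAC.
by rewrite yy opprD addrA subrK.
Qed.

End OperatorCompleteness.

(** * States of the Toeplitz algebra *)

Section States.
Variable R : realType.
Local Notation B := (bop R affine).
Local Notation T := (toeplitz R).
Variable psi : B -> R[i].
Hypothesis psi_state : is_state T psi.
Implicit Types (x y : B) (c : R[i]).

Lemma bop_scalerAl c x y : (c *: x) * y = c *: (x * y).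
Proof. exact: bop_ext. Qed.

Lemma bop_scalerAr c x y : x * (c *: y) = c *: (x * y).
Proof. by apply: bop_ext => f; exact: bopZ. Qed.

Lemma toeplitz0 : T (0 : B).
Proof. by rewrite -(subrr (1 : B)); apply: toeplitzB; exact: toeplitz1. Qed.

Lemma state0 : psi 0 = 0.
Proof.
have := state_linear psi_state 1 toeplitz0 toeplitz0.
rewrite scale1r addr0 mul1r => /(congr1 (fun z => z - psi 0)).
by rewrite subrr addrK => <-.
Qed.

Lemma stateZ c x : T x -> psi (c *: x) = c * psi x.
Proof.
by move=> Tx; have := state_linear psi_state c Tx toeplitz0; rewrite !addr0 state0 addr0.
Qed.

Lemma stateD x y : T x -> T y -> psi (x + y) = psi x + psi y.
Proof. by move=> Tx Ty; have := state_linear psi_state 1 Tx Ty; rewrite scale1r mul1r. Qed.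

Lemma stateB x y : T x -> T y -> psi (x - y) = psi x - psi y.
Proof.
move=> Tx Ty; rewrite -scaleN1r addrC (state_linear psi_state)// mulN1r addrC//.
Qed.

Lemma toeplitz_sum (J : Type) (s : seq J) (F : J -> B) :
  (forall j, T (F j)) -> T (\sum_(j <- s) F j).
Proof.
move=> TF; elim: s => [|j s IH]; first by rewrite big_nil; exact: toeplitz0.
by rewrite big_cons; apply: toeplitz_add.
Qed.

Lemma state_sum (J : Type) (s : seq J) (F : J -> B) : (forall j, T (F j)) ->
  psi (\sum_(j <- s) F j) = \sum_(j <- s) psi (F j).
Proof.
move=> TF; elim: s => [|j s IH]; first by rewrite !big_nil state0.
by rewrite !big_cons stateD ?IH//; exact: toeplitz_sum.
Qed.

Lemma state_sqE x : T x ->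
  psi (star x * x) = (Re (psi (star x * x)))%:C /\ 0 <= Re (psi (star x * x)).
Proof.
by move=> /(state_ge0 psi_state); case: (psi _) => a b; rewrite lecE /= => /andP[/eqP -> ->].
Qed.

(** By positivity [psi] is real on [(x + c)' (x + c)] and on [x' x]; the cases [c = 1] and [c = i]
    give the two components. *)
Lemma state_star x : T x -> psi (star x) = conjc (psi x).
Proof.
move=> Tx; have Ts := toeplitz_star Tx; have T1 := @toeplitz1 R.
have H c : Im (c * psi (star x) + conjc c * psi x) = 0.
  have Txc : T (x + c *: (1 : B)) by apply: toeplitz_add => //; exact: toeplitzZ.
  have [+ _] := state_sqE Txc; have [+ _] := state_sqE Tx.
  have -> : star (x + c *: (1 : B)) * (x + c *: (1 : B)) =
      star x * x + (c *: star x + (conjc c *: x + (conjc c * c) *: (1 : B))).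
    rewrite starD starZ star1 mulrDl !mulrDr !bop_scalerAr !bop_scalerAl !mulr1 !mul1r.
    by rewrite scalerA -addrA (mulrC (conjc c)).
  have Txx := toeplitzM Ts Tx.
  have T1' : T (conjc c *: x + (conjc c * c) *: (1 : B)).
    by apply: toeplitz_add; exact: toeplitzZ.
  have T2 : T (c *: star x + (conjc c *: x + (conjc c * c) *: (1 : B))).
    by apply: toeplitz_add => //; exact: toeplitzZ.
  rewrite (stateD Txx T2) (stateD (toeplitzZ c Ts) T1').
  rewrite (stateD (toeplitzZ _ Tx) (toeplitzZ _ T1)).
  rewrite !stateZ// (state_one psi_state) mulr1.
  move=> /(congr1 Im) + /(congr1 Im).
  move: (psi (star x * x)) (psi (star x)) (psi x) => [p1 p2] [a1 a2] [b1 b2].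
  by move: c {Txc T1' T2} => [c1 c2] /=; lra.
have := H 1; have := H 'i.
move: (psi x) (psi (star x)) => [a1 a2] [b1 b2] /= h1 h2.
by congr (_ +i* _); lra.
Qed.


Lemma state_cauchy_schwarz x y : T x -> T y ->
  normc (psi (star y * x)) ^+ 2 <=
  Re (psi (star x * x)) * Re (psi (star y * y)).
Proof.
move=> Tx Ty; have Tsx := toeplitz_star Tx; have Tsy := toeplitz_star Ty.
have [pE p0] := state_sqE Tx; have [qE q0] := state_sqE Ty.
have Txx := toeplitzM Tsx Tx; have Tyy := toeplitzM Tsy Ty.
have Tyx := toeplitzM Tsy Tx; have Txy := toeplitzM Tsx Ty.
have sE : psi (star x * y) = conjc (psi (star y * x)).
  by rewrite -state_star// starM starK.
set s := psi (star y * x) in sE *; set p := Re _ in pE p0 *; set q := Re _ in qE q0 *.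
set n := normc s ^+ 2.
(* Positivity on [c x + y] with [c = - t * conj s]. If [p > 0], the value at [t = 1 / p] gives the
   claim. *)
have H (t : R) : 0 <= t ^+ 2 * n * p - 2 * t * n + q.
  pose c := - t%:C * conjc s.
  have Tz : T (c *: x + y) by apply: toeplitz_add => //; exact: toeplitzZ.
  have [_] := state_sqE Tz.
  have -> : star (c *: x + y) * (c *: x + y) =
      (conjc c * c) *: (star x * x) + (conjc c *: (star x * y) +
        (c *: (star y * x) + star y * y)).
    rewrite starD starZ mulrDl !mulrDr !bop_scalerAr !bop_scalerAl scalerA.
    by rewrite -addrA (mulrC c).
  have T1 := toeplitz_add (toeplitzZ c Tyx) Tyy.
  have T2 := toeplitz_add (toeplitzZ (conjc c) Txy) T1.
  rewrite (stateD (toeplitzZ _ Txx) T2) (stateD (toeplitzZ _ Txy) T1).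
  rewrite (stateD (toeplitzZ _ Tyx) Tyy) !stateZ// sE pE qE -/s /n normc2 /c.
  by case: (s) => s1 s2 /=; congr (0 <= _); ring.
have n0 : 0 <= n by rewrite sqr_ge0.
move: p0; rewrite le_eqVlt => /predU1P[p0|p0].
  rewrite -p0 mul0r; move: n0; rewrite le_eqVlt => /predU1P[<-//|n0].
  (* For [p = 0] the polynomial is affine in [t] and takes the value [-1] here. *)
  have := H ((q + 1) / (2 * n)); rewrite -p0 mulr0 add0r.
  rewrite (_ : 2 * _ * n = q + 1); first by lra.
  by field; rewrite gt_eqF.
have := H p^-1; rewrite (_ : _ - _ = - (n / p)); last by field; rewrite gt_eqF.
by rewrite addrC subr_ge0 ler_pdivrMr// mulrC.
Qed.

(** With [k = 3 / (4 |x|^2)], [1 - k x' x] is the square of a self-adjoint element of the algebra,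
    so [psi] is non-negative on it. This gives the constant [4 / 3], rounded up to 2. *)
Lemma state_sq_le x : T x -> Re (psi (star x * x)) <= 2 * opnorm x ^+ 2.
Proof.
move=> Tx; have Txx := toeplitzM (toeplitz_star Tx) Tx.
have [x0|xN0] := eqVneq (opnorm x) 0.
  rewrite x0 (opnorm_eq0 x0) (_ : star 0 * 0 = 0 :> B); last by exact: mulr0.
  by rewrite state0 expr0n mulr0.
have x_gt0 : 0 < opnorm x by rewrite lt_neqAle eq_sym xN0 opnorm_ge0.
set k := 3 / 4 / opnorm x ^+ 2.
have k0 : 0 < k by rewrite !divr_gt0// exprn_gt0.
have Th : T (k%:C *: (star x * x)) by exact: toeplitzZ.
have [||y [Ty sy yE]] := toeplitz_sqrt Th.
- by rewrite starZ starM starK conjc_real.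
- rewrite opnorm_scale_real ?(ltW k0)//.
  apply: le_trans (ler_wpM2l (ltW k0) (opnormM _ _)) _.
  have -> : 3 / 4 = k * opnorm x ^+ 2 by rewrite /k; field; exact: xN0.
  by rewrite ler_wpM2l ?(ltW k0)// expr2 ler_wpM2r ?opnorm_ge0// opnorm_star.
have [_] := state_sqE Ty; rewrite sy yE (stateB (@toeplitz1 R) Th) stateZ//.
rewrite (state_one psi_state); have [-> _] := state_sqE Tx.
set a := Re (psi _); rewrite /= mul0r subr0 subr_ge0 /k => h.
have E : a = 3 / 4 / opnorm x ^+ 2 * a * (4 / 3 * opnorm x ^+ 2) by field; exact: xN0.
have x2 : 0 <= opnorm x ^+ 2 by rewrite sqr_ge0.
rewrite E; apply: le_trans (ler_wpM2r _ h) _; first by rewrite mulr_ge0// divr_ge0.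
by move: x2; clear; lra.
Qed.

Lemma state_le x : T x -> normc (psi x) <= 2 * opnorm x.
Proof.
move=> Tx; have := state_cauchy_schwarz Tx (@toeplitz1 R).
rewrite star1 !mul1r (state_one psi_state) /= mulr1 => h.
rewrite -(@ler_pXn2r _ 2)// ?nnegrE ?normc_ge0 ?mulr_ge0 ?opnorm_ge0//.
apply: le_trans h _; apply: le_trans (state_sq_le Tx) _.
by rewrite exprMn ler_wpM2r ?sqr_ge0// expr2; lra.
Qed.

End States.

(** * Monomials *)

Section Monomials.
Variable R : realType.
Local Notation B := (bop R affine).
Local Notation T := (toeplitz R).
Local Notation Tiso := (Tiso R).
Implicit Types (x y z : affine) (X Y : B).

Lemma affine_eqP x y : x.1 = y.1 -> (x.2 : nat) = y.2 -> x = y.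
Proof. by case: x y => [m a] [n b] /= -> /val_inj ->. Qed.

Lemma affineMA : associative affineM.
Proof.
move=> x y z; apply: affine_eqP => /=; first by rewrite mulnDr addnA mulnA.
by rewrite mulnA.
Qed.

(* The semigroup is quasi-lattice ordered, [affineM z q = affineM y p] being the
   least common right multiple of [y] and [z]. *)
Lemma affine_lcm y z : (forall u t : affine, affineM z u <> affineM y t) \/
  exists p q, forall u t : affine, affineM z u = affineM y t <->
    exists w : affine, u = affineM q w /\ t = affineM p w.
Proof.
have [ex|nex] := pselect (exists ut : nat * nat, z.1 + z.2 * ut.1 = y.1 + y.2 * ut.2)%N; last first.
  left=> u t [e _]; apply: nex; exists (u.1, t.1); exact: e.
right; pose P t0 := `[< exists u0, z.1 + z.2 * u0 = y.1 + y.2 * t0 >]%N.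
(* The least solution [(u0, t0)] of the equation of first components is the base point; any other
   one exceeds it by a multiple of [(b', c')]. *)
have exP : exists t0, P t0 by case: ex => -[u0 t0] /= e; exists t0; apply/asboolP; exists u0.
case: (ex_minnP exP) => t0 /asboolP[u0 e0] t0min.
have y0 := posnat_gt0 y.2; have z0 := posnat_gt0 z.2.
set b : nat := y.2 in e0 y0 *; set c : nat := z.2 in e0 z0 *.
set g := gcdn b c.
have g0 : (0 < g)%N by rewrite gcdn_gt0 y0.
have [b' bg] : exists b', b = (b' * g)%N by apply/dvdnP; exact: dvdn_gcdl.
have [c' cg] : exists c', c = (c' * g)%N by apply/dvdnP; exact: dvdn_gcdr.
have b'0 : (0 < b')%N by move: y0; rewrite bg muln_gt0 => /andP[].
have c'0 : (0 < c')%N by move: z0; rewrite cg muln_gt0 => /andP[].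
have cop : coprime b' c'.
  by rewrite /coprime -(eqn_pmul2r g0) muln_gcdl -bg -cg mul1n.
exists (t0, Posnat c'0), (u0, Posnat b'0) => u t; split; last first.
  case=> w [-> ->]; rewrite !affineMA; congr affineM.
  apply: affine_eqP => //=; rewrite -/b -/c.
  by move: bg cg; clear => -> ->; lia.
have divisor (k l : nat) : (b * k = c * l)%N ->
    exists w, k = (c' * w)%N /\ l = (b' * w)%N.
  rewrite bg cg => kl; have {}kl : (b' * k = c' * l)%N.
    by apply/eqP; rewrite -(eqn_pmul2r g0) mulnAC kl mulnAC.
  have /dvdnP[w wE] : (c' %| k)%N.
    by rewrite -(@Gauss_dvdr _ b') 1?coprime_sym// kl dvdn_mulr.
  exists w; rewrite mulnC; split=> //; apply/eqP; rewrite -(eqn_pmul2l c'0) -kl wE.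
  by apply/eqP; clear; lia.
move=> e; have /= e1 := congr1 fst e; have /= e2 := congr1 (fun v : affine => v.2 : nat) e.
have t0t : (t0 <= t.1)%N by apply: t0min; apply/asboolP; exists u.1.
have cancel (m n p q r s : nat) : (m + p = n + q -> m + r = n + s -> q <= s ->
    p <= r /\ s - q = r - p)%N by lia.
have bt : (b * t0 <= b * t.1)%N by rewrite leq_mul2l t0t orbT.
have [cu sub] := cancel _ _ _ _ _ _ e0 e1 bt.
have u0u : (u0 <= u.1)%N by rewrite -(leq_pmul2l z0).
have [w1 [k1 l1]] : exists w, (t.1 - t0 = c' * w /\ u.1 - u0 = b' * w)%N.
  by apply: divisor; rewrite !mulnBr.
have [w2 [k2 l2]] : exists w, ((t.2 : nat) = c' * w /\ (u.2 : nat) = b' * w)%N.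
  by apply: divisor; rewrite -/b -/c e2.
have w20 : (0 < w2)%N.
  by have := posnat_gt0 t.2; rewrite k2 muln_gt0 => /andP[].
exists (w1, Posnat w20); split; apply: affine_eqP => //=.
  by rewrite -l1 subnKC.
by rewrite -k1 subnKC.
Qed.

Lemma Tiso_at x (f : l2 R affine) y : Tiso x f (affineM x y) = f y.
Proof. exact: shift_at. Qed.

Lemma Tiso_out x (f : l2 R affine) y : (forall z, affineM x z <> y) -> Tiso x f y = 0.
Proof. by move=> xy; apply: shift_out => -[z]; exact: xy. Qed.

Lemma TisoM x y : Tiso x * Tiso y = Tiso (affineM x y).
Proof.
apply: bop_ext => f; apply: l2_ext => i; rewrite bop_mulE.
have [[j <-]|nj] := pselect (exists j, affineM x j = i); last first.
  rewrite Tiso_out ?Tiso_out// => z e; apply: nj; last by exists z.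
  by exists (affineM y z); rewrite affineMA.
rewrite Tiso_at; have [[k <-]|nk] := pselect (exists k, affineM y k = j).
  by rewrite Tiso_at affineMA Tiso_at.
rewrite Tiso_out ?Tiso_out// => z e; apply: nk; exists z => //.
by apply: (@affineM_inj x); rewrite affineMA.
Qed.

(** Nica covariance: the product is 0 if [y] and [z] have no common right multiple, and otherwise
    [p], [q] come from the least one, [z q = y p]. Hence products of monomials are monomials or
    0. *)
Lemma star_Tiso_mul y z : star (Tiso y) * Tiso z = 0 \/
  exists p q, star (Tiso y) * Tiso z = Tiso p * star (Tiso q).
Proof.
have starE x (f : l2 R affine) i : star (Tiso x) f i = f (affineM x i) by [].
have [none|[p [q pq]]] := affine_lcm y z; [left|right; exists p, q];
  apply: bop_ext => f; apply: l2_ext => t; rewrite bop_mulE starE.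
  by rewrite Tiso_out// => u; exact: none.
rewrite bop_mulE.
have [[w wE]|nw] := pselect (exists w, affineM p w = t).
  rewrite -wE Tiso_at starE.
  have -> : affineM y (affineM p w) = affineM z (affineM q w).
    by apply/esym/pq; exists w.
  exact: Tiso_at.
rewrite Tiso_out ?Tiso_out// => [w e|u /pq[w [_ e]]]; apply: nw; exists w => //.
Qed.

Lemma iso_monomial m n (a b : posnat) :
  iso_s R ^+ m * iso_v R a * star (iso_v R b) * star (iso_s R) ^+ n =
  Tiso (m, a) * star (Tiso (n, b)).
Proof.
have sE k : iso_s R ^+ k = Tiso (k, posnat1).
  elim: k => [|k IH]; first by rewrite expr0 Tiso1.
  rewrite exprS IH TisoM; congr Tiso; apply: affine_eqP => //=.
  by rewrite mul1n.
have svE k c : iso_s R ^+ k * iso_v R c = Tiso (k, c).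
  rewrite sE TisoM; congr Tiso; apply: affine_eqP => /=; last by rewrite mul1n.
  by rewrite muln0 addn0.
rewrite svE -mulrA; congr (_ * _); rewrite -svE starM; congr (_ * _).
elim: n => [|n IH]; first by rewrite !expr0 star1.
by rewrite exprSr IH exprS starM.
Qed.

End Monomials.

(** * The dense star-algebra spanned by the monomials *)

Section Density.
Variable R : realType.
Local Notation B := (bop R affine).
Local Notation T := (toeplitz R).
Local Notation Tiso := (Tiso R).
Implicit Types (x y z : affine) (X Y : B) (c : R[i]).

Definition monomial x y : B := Tiso x * star (Tiso y).

Inductive monomial_span : B -> Prop :=
| MonomialSpan0 : monomial_span 0
| MonomialSpanD c x y X : monomial_span X -> monomial_span (c *: monomial x y + X).

Lemma toeplitz_monomial x y : T (monomial x y).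
Proof. by apply: toeplitzM; [|apply: toeplitz_star]; exact: toeplitz_Tiso. Qed.

Lemma toeplitz_monomial_span X : monomial_span X -> T X.
Proof.
elim=> [|c x y Y _ TY]; first exact: toeplitz0.
exact: (toeplitzD c (toeplitz_monomial x y) TY).
Qed.

Lemma monomial_spanD c X Y :
  monomial_span X -> monomial_span Y -> monomial_span (c *: X + Y).
Proof.
move=> SX SY; elim: SX => [|d x y Z _ IH]; first by rewrite scaler0 add0r.
by rewrite scalerDr scalerA -addrA; exact: MonomialSpanD.
Qed.

Lemma monomial_span1 x y : monomial_span (monomial x y).
Proof.
by rewrite -[monomial x y]scale1r -[_ *: _]addr0; exact/MonomialSpanD/MonomialSpan0.
Qed.

Lemma star_monomial x y : star (monomial x y) = monomial y x.
Proof. by rewrite /monomial starM starK. Qed.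

Lemma monomial_spanM X Y : monomial_span X -> monomial_span Y -> monomial_span (X * Y).
Proof.
have mm x y z w : monomial_span (monomial x y * monomial z w).
  rewrite /monomial -mulrA (mulrA (star _)).
  have [->|[p [q ->]]] := star_Tiso_mul R y z.
    by rewrite mul0r mulr0; exact: MonomialSpan0.
  rewrite -mulrA -starM !mulrA !TisoM -/(monomial _ _); exact: monomial_span1.
move=> SX SY; elim: SX => [|c x y Z _ IH]; first by rewrite mul0r; exact: MonomialSpan0.
rewrite mulrDl bop_scalerAl; apply: monomial_spanD => // {IH}.
elim: SY => [|d z w W _ IH]; first by rewrite mulr0; exact: MonomialSpan0.
by rewrite mulrDr bop_scalerAr; apply: monomial_spanD.
Qed.

Lemma monomial_span_star X : monomial_span X -> monomial_span (star X).
Proof.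
elim=> [|c x y Y _ IH]; first by rewrite star0; exact: MonomialSpan0.
by rewrite starD starZ star_monomial; apply: monomial_spanD => //; exact: monomial_span1.
Qed.

(** The closure of the span is a C*-subalgebra containing the generators, and the Toeplitz algebra
    is the smallest such. *)
Lemma toeplitz_dense X (e : R) : T X -> 0 < e ->
  exists2 Y, monomial_span Y & opnorm (X - Y) < e.
Proof.
move=> TX; move: e; pose cl := [set X : B | forall e : R, 0 < e ->
  exists2 Y, monomial_span Y & opnorm (X - Y) < e].
apply: (TX cl); split; last first.
  move=> _ [y _ <-] e e0; exists (monomial y (0%N, posnat1)); first exact: monomial_span1.
  by rewrite /monomial Tiso1 star1 mulr1 subrr -(scale0r (1 : B)) opnormZ Normc.normc0 mul0r.
split.
- move=> c X1 X2 cl1 cl2 e e0.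
  have N0 : 0 < normc c + 1 by rewrite ltr_wpDl// normc_ge0.
  have [Y1 S1 d1] := cl1 _ (divr_gt0 (divr_gt0 e0 (ltr0Sn R 1)) N0).
  have [Y2 S2 d2] := cl2 _ (divr_gt0 e0 (ltr0Sn R 1)).
  exists (c *: Y1 + Y2); first exact: monomial_spanD.
  rewrite opprD addrACA -scalerBr (le_lt_trans (opnormD _ _))// (splitr e).
  apply: ler_ltD => //; rewrite opnormZ.
  move: d1; rewrite ltr_pdivlMr// mulrC => /ltW; apply: le_trans.
  by rewrite ler_wpM2r ?opnorm_ge0// lerDl.
- move=> X1 X2 cl1 cl2 e e0.
  have N2 : 0 < opnorm X2 + 1 by rewrite ltr_wpDl// opnorm_ge0.
  have [Y1 S1 d1] := cl1 _ (divr_gt0 (divr_gt0 e0 (ltr0Sn R 1)) N2).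
  have N1 : 0 < opnorm Y1 + 1 by rewrite ltr_wpDl// opnorm_ge0.
  have [Y2 S2 d2] := cl2 _ (divr_gt0 (divr_gt0 e0 (ltr0Sn R 1)) N1).
  exists (Y1 * Y2); first exact: monomial_spanM.
  rewrite (_ : _ - _ = (X1 - Y1) * X2 + Y1 * (X2 - Y2)); last first.
    by rewrite mulrBr mulrBl addrA subrK.
  rewrite (le_lt_trans (opnormD _ _))// (splitr e); apply: ltr_leD.
    move: d1; rewrite ltr_pdivlMr//; apply: le_lt_trans.
    by apply: le_trans (opnormM _ _) _; rewrite ler_wpM2l ?opnorm_ge0// lerDl.
  move: d2; rewrite ltr_pdivlMr// mulrC => /ltW; apply: le_trans.
  by apply: le_trans (opnormM _ _) _; rewrite ler_wpM2r ?opnorm_ge0// lerDl.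
- move=> X1 cl1 e e0; have [Y S1 d1] := cl1 e e0.
  exists (star Y); first exact: monomial_span_star.
  by rewrite -starB; apply: le_lt_trans (opnorm_star _) _.
- apply: closedBP => X1 h e e0; have e2 : 0 < e / 2 by rewrite divr_gt0.
  have [X2 cl2 d1] := h _ e2; have [Y SY d2] := cl2 _ e2; exists Y => //.
  by rewrite -(subrK X2 X1) -addrA (le_lt_trans (opnormD _ _))// (splitr e) ltrD.
Qed.

End Density.

(** * Eigenvectors of the dynamics *)

Section Dynamics.
Variable R : realType.
Local Notation B := (bop R affine).
Local Notation T := (toeplitz R).
Local Notation Tiso := (Tiso R).
Variable sigma : R -> B -> B.
Hypothesis dyn : toeplitz_dynamics sigma.
Implicit Types (x y : affine) (X Y : B) (c : R[i]).

Definition weight (l : R) X := forall t, sigma t X = expi (t * l) *: X.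

Let dynT := tdyn_dynamics dyn.

Lemma dynZ t c X : T X -> sigma t (c *: X) = c *: sigma t X.
Proof.
move=> TX; have T0 := @toeplitz0 R.
have s0 : sigma t 0 = 0.
  have := dyn_linear dynT t 1 T0 T0; rewrite !scale1r addr0.
  by move=> /(congr1 (fun Y => Y - sigma t 0)); rewrite subrr addrK => <-.
by have := dyn_linear dynT t c TX T0; rewrite s0 !addr0.
Qed.

Lemma star_TisoK x : star (Tiso x) * Tiso x = 1.
Proof.
by apply: bop_ext => f; apply: l2_ext => i; rewrite bop_mulE bop_oneE; exact: Tiso_at.
Qed.

Lemma weightM l k X Y : T X -> T Y -> weight l X -> weight k Y -> weight (l + k) (X * Y).
Proof.
move=> TX TY wX wY t; rewrite (dyn_mul dynT)// wX wY bop_scalerAl bop_scalerAr.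
by rewrite scalerA -expiD mulrDr.
Qed.

(** The dynamics is prescribed on [s] and on the [v_p] only. Weights add up in products, and
    [T_(m,a)] is a product of these isometries. *)
Lemma weight_Tiso x : weight (ln (x.2 : nat)%:R) (Tiso x).
Proof.
(* Invariance of the unit follows from [1 = s' s]. *)
have w1 : weight 0 1.
  move=> t; rewrite mulr0 expi0 scale1r.
  have T1 := @toeplitz_Tiso R (1%N, posnat1).
  rewrite -(star_TisoK (1%N, posnat1)) (dyn_mul dynT)//; last exact: toeplitz_star.
  by rewrite (dyn_star dynT)// (tdyn_s dyn).
have ws n : weight 0 (Tiso (n, posnat1)).
  elim: n => [|n IH]; first by rewrite Tiso1.
  have -> : Tiso (n.+1, posnat1) = Tiso (1%N, posnat1) * Tiso (n, posnat1).
    by rewrite TisoM; congr Tiso; apply: affine_eqP => //=; rewrite mul1n.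
  rewrite -(addr0 0); apply: weightM => //; try exact: toeplitz_Tiso.
  by move=> t; rewrite mulr0 expi0 scale1r (tdyn_s dyn).
have wv (a : posnat) : weight (ln (a : nat)%:R) (Tiso (0%N, a)).
  have [n] := ubnP (a : nat); elim: n => // n IH in a *; rewrite ltnS => an.
  have [a1|a1] := leqP a 1.
    have -> : a = posnat1 by apply: val_inj; apply/eqP; rewrite eqn_leq a1 posnat_gt0.
    by rewrite Tiso1 ln1.
  have pP := pdiv_prime a1; set p := pdiv a in pP *.
  have pa : (p %| a)%N := pdiv_dvd a.
  have q0 : (0 < a %/ p)%N by rewrite divn_gt0 ?prime_gt0// dvdn_leq// posnat_gt0.
  have aE : (a : nat) = (p * (a %/ p))%N by rewrite mulnC divnK.
  have -> : Tiso (0%N, a) = Tiso (0%N, posnat_prime pP) * Tiso (0%N, Posnat q0).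
    by rewrite TisoM; congr Tiso; apply: affine_eqP => //=; rewrite ?muln0.
  have -> : ln (a : nat)%:R = ln p%:R + ln (a %/ p)%:R :> R.
    by rewrite {1}aE natrM lnM ?posrE ?ltr0n// prime_gt0.
  apply: weightM; try exact: toeplitz_Tiso.
    by move=> t; exact: tdyn_v.
  by apply: IH => /=; apply: leq_trans an; rewrite ltn_Pdiv ?prime_gt1// posnat_gt0.
case: x => m a /=; rewrite -[ln _]add0r.
have -> : Tiso (m, a) = Tiso (m, posnat1) * Tiso (0%N, a).
  by rewrite TisoM; congr Tiso; apply: affine_eqP => /=; rewrite ?muln0 ?addn0 ?mul1n.
by apply: weightM => //; exact: toeplitz_Tiso.
Qed.

Lemma weight_star l X : T X -> weight l X -> weight (- l) (star X).
Proof.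
by move=> TX wX t; rewrite (dyn_star dynT)// wX starZ conjc_expi mulrN.
Qed.

Lemma weightD l c X Y : T X -> T Y -> weight l X -> weight l Y -> weight l (c *: X + Y).
Proof.
by move=> TX TY wX wY t; rewrite (dyn_linear dynT)// wX wY scalerDr !scalerA mulrC.
Qed.

Lemma weight_monomial x y :
  weight (ln (x.2 : nat)%:R - ln (y.2 : nat)%:R) (monomial R x y).
Proof.
apply: weightM; try exact: weight_Tiso; try exact: toeplitz_Tiso.
  by apply: toeplitz_star; exact: toeplitz_Tiso.
by apply: weight_star; [exact: toeplitz_Tiso|exact: weight_Tiso].
Qed.

End Dynamics.

(** * Ground states *)

Section VectorDerivative.
Variable R : realType.
Local Notation B := (bop R affine).
Local Notation T := (toeplitz R).

Lemma derivable_bopP (f : R[i] -> B) (z : R[i]) :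
  derivable (f : R[i]^o -> B) z 1 <->
  exists L : B, forall e : R, 0 < e -> exists2 r : R, 0 < r & forall h : R[i],
    normc h < r -> opnorm (f (z + h) - f z - h *: L) <= e * normc h.
Proof.
have quot (L : B) (h : R[i]) : h != 0 ->
    opnorm (L - h^-1 *: (f (h *: (1 : R[i]^o) + z) - f z)) * normc h =
    opnorm (f (z + h) - f z - h *: L).
  move=> h0; rewrite mulrC -opnormZ scalerBr scalerA mulfV// scale1r.
  rewrite (_ : h *: (1 : R[i]^o) + z = z + h).
    by rewrite -opnormN opprB.
  by rewrite /GRing.scale/= mulr1 addrC.
have toR (e : R[i]) : 0 < e -> e = (Re e)%:C /\ 0 < Re e.
  by case: e => a b; rewrite ltcE /= => /andP[/eqP -> ->].
split=> [/cvg_ex[/= L]|[L HL]].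
  move=> /cvgrPdist_le H; exists L => e e0.
  have e0' : 0 < e%:C :> R[i] by rewrite ltcR.
  have /nbhs_ballP[r0 /= r00 rP] := H _ e0'.
  have [r0E r0'] := toR _ r00.
  exists (Re r0) => // h hr; have [->|h0] := eqVneq h 0.
    by rewrite addr0 subrr scale0r subrr -(scale0r (1 : B)) opnormZ Normc.normc0 mul0r mulr0.
  rewrite -quot//; apply: ler_wpM2r; first exact: normc_ge0.
  have := rP h; rewrite -ball_normE /ball_/= sub0r normrN normcC r0E ltcR => /(_ hr h0).
  by rewrite lecR.
apply/cvg_ex; exists L; apply/cvgrPdist_le => e e0.
have [eE e0'] := toR _ e0; have [r r0 rP] := HL _ e0'.
apply/nbhs_ballP; exists r%:C => /=; first by rewrite ltcR.
move=> h; rewrite -ball_normE /ball_/= sub0r normrN normcC ltcR => hr h0.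
rewrite eE lecR.
have h0' : 0 < normc h.
  by rewrite lt_neqAle normc_ge0 andbT eq_sym; apply: contra_neq h0; exact: Normc.eq0_normc.
by rewrite -(ler_pM2r h0') quot//; exact: rP.
Qed.

Lemma entire_scale (g : R[i] -> R[i]) (X : B) : holomorphic g ->
  entire (fun z => g z *: X).
Proof.
move=> hg z; apply/derivable_bopP; have [A gA] := hg z.
exists (A *: X) => e e0; have N0 : 0 < opnorm X + 1 by rewrite ltr_wpDl// opnorm_ge0.
have [r r0 rP] := gA _ (divr_gt0 e0 N0); exists r => // h /rP le.
rewrite scalerA -!scalerBl opnormZ (mulrC h).
apply: le_trans (ler_wpM2r (opnorm_ge0 X) le) _.
rewrite mulrAC ler_wpM2r ?normc_ge0// mulrAC ler_pdivrMr//.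
by rewrite ler_wpM2l ?(ltW e0)// lerDl ler01.
Qed.

(* The derivative of a [T]-valued function is a limit of difference quotients,
   hence lies in the closed subalgebra [T], where [psi] is bounded. *)
Lemma holomorphic_state psi (D : B) (f : R[i] -> B) : is_state T psi -> T D ->
  (forall z, T (f z)) -> entire f -> holomorphic (fun z => psi (D * f z)).
Proof.
move=> st TD Tf ef z; have /derivable_bopP[L HL] := ef z.
have TL : T L.
  have [_ _ _ cl] := @toeplitz_cstar R; apply: (closedB_approx cl) => e e0.
  have e2 : 0 < e / 2 by rewrite divr_gt0.
  have [r r0 rP] := HL _ e2; pose h := r / 2.
  have h0 : 0 < h by rewrite divr_gt0.
  exists ((h%:C)^-1 *: (f (z + h%:C) - f z)).
    by apply: toeplitzZ; apply: toeplitzB.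
  have hn : h%:C != 0 :> R[i] by rewrite gt_eqF// ltcR.
  have := rP h%:C; rewrite normc_real gtr0_norm// /h => /(_ (ltac:(lra))) le.
  rewrite -[X in opnorm (X - _)](scale1r L) -(mulVf hn) -scalerA -scalerBr.
  rewrite opnormZ Normc.normcV normc_real gtr0_norm// mulrC ltr_pdivrMr//.
  rewrite -opnormN opprB; apply: le_lt_trans le _.
  by rewrite ltr_pM2r// ltr_pdivrMr// ltr_pMr// ltr1n.
exists (psi (D * L)) => e e0.
have N0 : 0 < 2 * (opnorm D + 1) by rewrite mulr_gt0// ltr_wpDl// opnorm_ge0.
have [r r0 rP] := HL _ (divr_gt0 e0 N0); exists r => // h /rP le.
have T1 := toeplitzM TD (Tf (z + h)); have T2 := toeplitzM TD (Tf z).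
have T3 := toeplitzM TD TL; have T4 := toeplitzZ h T3.
have T5 := toeplitzB T1 T2.
rewrite (mulrC _ h) -(stateZ st h T3) -(stateB st T1 T2) -(stateB st T5 T4).
rewrite -bop_scalerAr -!mulrBr.
have T6 : T (D * (f (z + h) - f z - h *: L)).
  by apply: toeplitzM => //; apply: toeplitzB; [exact: toeplitzB|exact: toeplitzZ].
apply: le_trans (state_le st T6) _.
have h1 := opnormM D (f (z + h) - f z - h *: L).
have h2 := ler_wpM2l (opnorm_ge0 D) le.
apply: (@le_trans _ _ (2 * (opnorm D + 1) * (e / (2 * (opnorm D + 1)) * normc h))).
  have h3 : 0 <= e / (2 * (opnorm D + 1)) * normc h.
    by rewrite mulr_ge0 ?normc_ge0// ltW// divr_gt0.
  by move: h1 h2 h3; clear; set k := _ / _ * _; rewrite !mulrDr !mulrDl; lra.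
by rewrite mulrA (mulrC (2 * _) (_ / _)) divfK// gt_eqF.
Qed.

End VectorDerivative.

(** * Ground states and the vanishing condition *)

Section GroundStates.
Variable R : realType.
Local Notation B := (bop R affine).
Local Notation T := (toeplitz R).
Local Notation Tiso := (Tiso R).
Local Notation mono := (monomial R).
Variables (sigma : R -> B -> B) (phi : B -> R[i]).
Hypothesis dyn : toeplitz_dynamics sigma.
Hypothesis st : is_state T phi.
Implicit Types (x y : affine) (X Y : B) (c d : B).

Let dynT := tdyn_dynamics dyn.
Local Notation lnn n := (ln n%:R : R).

Lemma cexp_imaginary (l t : R) : cexp (0 + (0 +i* l) * t%:C) = expi (t * l).
Proof.
rewrite (_ : 0 + _ = 0 +i* (t * l)); last by simpc; rewrite mulrC.
by rewrite /cexp /= expR0 mul1r.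
Qed.

Lemma weight_entire_extension (l : R) X : T X -> weight sigma l X ->
  entire_extension T sigma X (fun z => cexp (0 + (0 +i* l) * z) *: X).
Proof.
move=> TX wX; split.
- by move=> z; exact: toeplitzZ.
- by move=> t; rewrite wX cexp_imaginary.
- by apply: entire_scale; exact: holomorphic_cexp.
Qed.

Lemma ground_state_vanish : ground_state T sigma phi -> forall x y,
  y.2 != posnat1 -> phi (mono x y) = 0.
Proof.
move=> [_ gs] x y y1; pose l := lnn y.2.
have y2 : (1 < (y.2 : nat))%N.
  rewrite ltn_neqAle posnat_gt0 andbT eq_sym; apply: contra y1 => /eqP e.
  by apply/eqP/val_inj.
have l0 : 0 < l by rewrite ln_gt0// ltr1n.
have TX := @toeplitz_Tiso R x; have TY := toeplitz_star (@toeplitz_Tiso R y).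
have eX := weight_entire_extension TX (weight_Tiso dyn x).
have eY := weight_entire_extension TY
  (weight_star dyn (@toeplitz_Tiso R y) (weight_Tiso dyn y)).
have [||M MP] := gs _ (Tiso x) _ _ _ eY.
- by split=> //; eexists; exact: eY.
- by split=> //; eexists; exact: eX.
have TXY := @toeplitz_monomial R x y.
apply: Normc.eq0_normc; apply/eqP; rewrite eq_le normc_ge0 andbT leNgt.
apply/negP => n0; set n := normc _ in n0.
have M0 : 0 <= M by apply: le_trans (MP 'i ltr01); exact: normc_ge0.
(* At height [h] the factor [exp(l h)] is at least [1 + l h = M / n + 2], which exceeds the
   bound. *)
pose h := (M / n + 1) / l.
have h0 : 0 < h by rewrite divr_gt0// ltr_wpDl// divr_ge0// ltW.
have := MP (0 +i* h) h0; rewrite bop_scalerAr (stateZ st _ TXY) Normc.normcM -/n.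
rewrite normc_cexp; apply/negP; rewrite -ltNge -ltr_pdivrMr//.
apply: lt_le_trans (expR_ge1Dx _).
rewrite /= -/l mulNr (mulrC l) /h divfK ?gt_eqF//; lra.
Qed.

Hypothesis vanish : forall x y, x.2 != posnat1 \/ y.2 != posnat1 ->
  phi (mono x y) = 0.

(** Cauchy-Schwarz: one factor is [phi (T_x T_y' T_y T_x') = phi (T_x T_x')], which vanishes by
    hypothesis. *)
Lemma phi_left_kernel x y c : x.2 != posnat1 -> T c -> phi (mono x y * c) = 0.
Proof.
move=> x1 Tc; have := state_cauchy_schwarz st Tc (@toeplitz_monomial R y x).
rewrite star_monomial /monomial.
rewrite (_ : _ * (Tiso y * star (Tiso x)) = mono x x); last first.
  by rewrite mulrA -(mulrA (Tiso x)) star_TisoK mulr1.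
rewrite vanish; last by left.
rewrite mulr0 => h; apply: Normc.eq0_normc; apply/eqP; rewrite -sqrf_eq0.
by rewrite eq_le h sqr_ge0.
Qed.

(** Monomials outside the kernel of [phi] have weight 0. The identity extends from the span by
    density, as [phi] and its composite with [sigma t] are both states, hence bounded. *)
Lemma phi_invariant t X : T X -> phi (sigma t X) = phi X.
Proof.
move=> TX; have st' : is_state T (fun X => phi (sigma t X)).
  split.
  - move=> k Y Z TY TZ; rewrite (dyn_linear dynT)//.
    by apply: (state_linear st); exact: (dyn_stable dynT).
  - move=> Y TY; rewrite (dyn_mul dynT)//; last exact: toeplitz_star.
    by rewrite (dyn_star dynT)//; apply: (state_ge0 st); exact: (dyn_stable dynT).
  - have := weight_Tiso dyn (0%N, posnat1) t.
    by rewrite Tiso1 ln1 mulr0 expi0 scale1r => ->; exact: state_one st.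
have spanE Y : monomial_span Y -> phi (sigma t Y) = phi Y.
  elim=> [|k x y Z SZ IH]; first by rewrite (state0 st') (state0 st).
  have TZ := toeplitz_monomial_span SZ; have Txy := @toeplitz_monomial R x y.
  rewrite (state_linear st' k Txy TZ) (state_linear st k Txy TZ) IH.
  congr (_ * _ + _); rewrite (weight_monomial dyn) (stateZ st _ Txy).
  have [x1|] := boolP (x.2 != posnat1); first by rewrite vanish ?mulr0//; left.
  rewrite negbK => /eqP x1.
  have [y1|] := boolP (y.2 != posnat1); first by rewrite vanish ?mulr0//; right.
  by rewrite negbK => /eqP y1; rewrite x1 y1 subrr mulr0 expi0 mul1r.
apply/eqP; rewrite -subr_eq0; apply/eqP/Normc.eq0_normc/le_anti.
rewrite normc_ge0 andbT; apply/ler_addgt0Pl => e e0; rewrite addr0.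
have e4 : 0 < e / 4 by rewrite divr_gt0.
have [Y SY XY] := toeplitz_dense TX e4.
have TY := toeplitz_monomial_span SY; have TB := toeplitzB TX TY.
have := state_le st' TB; have := state_le st TB; rewrite /= (stateB st' TX TY).
rewrite (stateB st TX TY) (spanE Y SY) => h1 h2.
rewrite -(subrK (phi Y) (phi (sigma t X))) -addrA.
apply: le_trans (le_normcD _ _) _; rewrite -(normcN (phi Y - phi X)) opprB.
by move: XY h1 h2; clear; lra.
Qed.

(** At time [pi / l] the eigenvalue is [-1], and [phi] is invariant. *)
Lemma phi_weight_eq0 (l : R) X : T X -> weight sigma l X -> l != 0 -> phi X = 0.
Proof.
move=> TX wX l0; have := phi_invariant (pi / l) TX.
rewrite wX (stateZ st _ TX) divfK// /expi cospi sinpi.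
by case: (phi X) => u v [h1 h2]; congr (_ +i* _); lra.
Qed.

Lemma phi_weight_entire (l : R) D c f z : T D -> weight sigma (- l) D -> T c ->
  entire_extension T sigma c f -> 0 <= Im z ->
  phi (D * f z) = cexp (0 + (0 +i* l) * z) * phi (D * c).
Proof.
move=> TD wD Tc [Tf fE ef] z0; apply/eqP; rewrite -subr_eq0; apply/eqP.
case: z z0 => u v /= v0.
pose g z := phi (D * f z) - cexp (0 + (0 +i* l) * z) * phi (D * c).
apply: (@holomorphic_eq0 R g) => //.
  apply: holomorphicB; first exact: holomorphic_state.
  by apply: holomorphicM; [exact: holomorphic_cexp|exact: holomorphic_cst].
move=> t; rewrite /g fE.
(* Invariance moves the dynamics from [c] to the eigenvector [D], where it acts as a scalar. *)
have -> : D * sigma t c = sigma t (sigma (- t) D * c).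
  rewrite (dyn_mul dynT)//; last exact: (dyn_stable dynT).
  by rewrite -(dyn_add dynT)// subrr (dyn_zero dynT).
rewrite phi_invariant; last by apply: toeplitzM => //; exact: (dyn_stable dynT).
rewrite wD bop_scalerAl (stateZ st _ (toeplitzM TD Tc)) mulrNN.
by rewrite cexp_imaginary subrr.
Qed.


(** Monomials [T_x T_y'] with [x.2 = 1] are collected in [D b] with [b + 1 = y.2]; the others go
    into [E]. *)
Lemma spectral_decomposition X : monomial_span X -> exists M (D : nat -> B) E,
  [/\ forall b, T (D b), forall b, weight sigma (- lnn b.+1) (D b),
      T E & forall c, T c -> phi (E * c) = 0] /\
  X = \sum_(b < M) D b + E.
Proof.
(* The vanishing of [D b] from [M] on allows the range of summation to grow in the induction. *)
move=> SX; suff [M [D [E [P D0 XE]]]] : exists M (D : nat -> B) E,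
    [/\ [/\ forall b, T (D b), forall b, weight sigma (- lnn b.+1) (D b),
      T E & forall c, T c -> phi (E * c) = 0],
      forall b, (M <= b)%N -> D b = 0 & X = \sum_(b < M) D b + E].
  by exists M, D, E.
have T0 := @toeplitz0 R.
elim: SX => [|k x y Y _ [M [D [E [[TD wD TE E0] D0 YE]]]]].
  exists 0%N, (fun=> 0), 0; split=> //; last by rewrite big_ord0 addr0.
  split=> // [b t|c Tc]; last by rewrite mul0r (state0 st).
  by rewrite scaler0 -(scale0r (1 : B)) (dynZ dyn) ?scale0r//; exact: toeplitz1.
have Txy := @toeplitz_monomial R x y.
have [x1|] := boolP (x.2 != posnat1).
  exists M, D, (k *: mono x y + E); split=> //; last by rewrite YE addrCA.
  split=> // [|c Tc]; first exact: toeplitzD.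
  rewrite mulrDl bop_scalerAl (state_linear st) ?E0//; try exact: toeplitzM.
  by rewrite phi_left_kernel// mulr0 addr0.
rewrite negbK => /eqP x1.
have y0 := posnat_gt0 y.2; set b := (y.2 : nat).-1.
have bE : b.+1 = y.2 by rewrite /b prednK.
have wxy : weight sigma (- lnn b.+1) (mono x y).
  have := weight_monomial dyn x y; rewrite x1 ln1 sub0r bE; exact.
pose D' j := if j == b then k *: mono x y + D j else D j.
exists (maxn M b.+1), D', E; split; first split=> //.
- by move=> j; rewrite /D'; case: eqP => // _; exact: toeplitzD.
- by move=> j; rewrite /D'; case: eqP => // ->; exact: weightD.
- move=> j; rewrite geq_max => /andP[Mj bj].
  by rewrite /D' gtn_eqF// D0.
have -> : \sum_(j < maxn M b.+1) D' j = k *: mono x y + \sum_(j < maxn M b.+1) D j.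
  rewrite (bigD1 (Ordinal (leq_maxr M b.+1)))//= [in RHS](bigD1 (Ordinal (leq_maxr M b.+1)))//=.
  rewrite /D' eqxx -addrA; congr (_ + (_ + _)); apply: eq_bigr => j jb.
  by case: eqP => // e; case/eqP: jb; exact: val_inj.
rewrite YE addrA; congr (_ + _ + _).
rewrite (big_ord_widen (maxn M b.+1) (fun j => D j) (leq_maxl M b.+1)) big_mkcond.
by apply: eq_bigr => j _; case: ltnP => // /D0.
Qed.

Lemma star_sum (J : Type) (s : seq J) (F : J -> B) :
  star (\sum_(j <- s) F j) = \sum_(j <- s) star (F j).
Proof.
elim: s => [|j s IH]; first by rewrite !big_nil star0.
by rewrite !big_cons starD IH.
Qed.

(** For [b != j], [D b * star (D j)] has the non-zero weight [ln (j + 1) - ln (b + 1)], so [phi]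
    kills the cross terms. *)
Lemma phi_orthogonal_sum M (D : nat -> B) (u : nat -> R[i]) :
  (forall b, T (D b)) -> (forall b, weight sigma (- lnn b.+1) (D b)) ->
  let S := \sum_(b < M) u b *: D b in
  phi (S * star S) = \sum_(b < M) (normc (u b) ^+ 2)%:C * phi (D b * star (D b)).
Proof.
move=> TD wD S.
have TS b : T (star (D b)) by exact: toeplitz_star.
have TDD b j : T (D b * star (D j)) by exact: toeplitzM.
rewrite {2}/S star_sum mulr_suml (state_sum st); last first.
  move=> b; apply: toeplitzM; first exact: toeplitzZ.
  by apply: toeplitz_sum => j; rewrite starZ; exact: toeplitzZ.
apply: eq_bigr => b _.
rewrite mulr_sumr (state_sum st); last first.
  by move=> j; rewrite starZ; apply: toeplitzM; exact: toeplitzZ.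
rewrite (bigD1 b)//= big1 ?addr0 => [|j jb]; last first.
  rewrite starZ bop_scalerAl bop_scalerAr !(stateZ st)//; last exact: toeplitzZ.
  have w := weightM dyn (TD b) (TS j) (wD b) (weight_star dyn (TD j) (wD j)).
  rewrite (phi_weight_eq0 (TDD b j) w) ?mulr0//.
  rewrite opprK addrC subr_eq0; apply: contra jb => /eqP/ln_inj.
  rewrite !posrE !ltr0n => /(_ isT isT)/eqP; rewrite eqr_nat eqSS => /eqP e.
  exact/eqP/val_inj.
rewrite starZ bop_scalerAl bop_scalerAr !(stateZ st)//; last exact: toeplitzZ.
rewrite mulrA; congr (_ * _); rewrite normc2.
by case: (u b) => v w /=; simpc; congr (_ +i* _); ring.
Qed.

Lemma phi_span_entire_le X c f z : monomial_span X -> T c ->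
  entire_extension T sigma c f -> 0 <= Im z ->
  normc (phi (X * f z)) <= 2 * opnorm X * opnorm c.
Proof.
move=> SX Tc ef z0; have [Tf _ _] := ef.
have TX := toeplitz_monomial_span SX.
have [M [D [E [[TD wD TE E0] XE]]]] := spectral_decomposition SX.
pose u b := cexp (0 + (0 +i* lnn b.+1) * z).
have u1 b : normc (u b) <= 1.
  rewrite normc_cexp -[leRHS]expR0 ler_expR; case: (z) z0 => v w /= w0.
  by rewrite add0r mul0r sub0r oppr_le0 mulr_ge0// ln_ge0// ler1n.
(* [S1] is written with coefficients 1 so that [phi_orthogonal_sum] applies to both sums and they
   can be compared term by term. *)
pose S := \sum_(b < M) u b *: D b; pose S1 := \sum_(b < M) (1 : R[i]) *: D b.
have TS : T S by apply: toeplitz_sum => b; exact: toeplitzZ.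
have TS1 : T S1 by apply: toeplitz_sum => b; exact: toeplitzZ.
have XS1 : X = S1 + E by rewrite XE; congr (_ + _); apply: eq_bigr => b _; rewrite scale1r.
have TSs := toeplitz_star TS; have TS1s := toeplitz_star TS1.
have -> : phi (X * f z) = phi (star (star S) * c).
  rewrite starK XE mulrDl (stateD st); try exact: toeplitzM; last first.
    by apply: toeplitzM => //; exact: toeplitz_sum.
  rewrite E0// addr0 !mulr_suml !(state_sum st); try by move=> b; exact: toeplitzM.
    apply: eq_bigr => b _.
    rewrite (@phi_weight_entire (lnn b.+1) _ c)// bop_scalerAl (stateZ st)//.
    exact: toeplitzM.
  by move=> b; apply: toeplitzM => //; exact: toeplitzZ.
have SS : Re (phi (S * star S)) <= Re (phi (X * star X)).
  (* [E] as a left factor is killed by [phi]; [star E] as a right factor is killed by adjunction. *)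
  have -> : phi (X * star X) = phi (S1 * star S1).
    have TXs := toeplitz_star TX; have TEs := toeplitz_star TE.
    rewrite {1}XS1 mulrDl (stateD st) ?E0 ?addr0//; try exact: toeplitzM.
    rewrite XS1 starD mulrDr (stateD st); try exact: toeplitzM.
    rewrite -[S1 * star E]starK starM starK (state_star st); last exact: toeplitzM.
    by rewrite E0// conjc0 addr0.
  rewrite (phi_orthogonal_sum M u TD wD) (phi_orthogonal_sum M (fun=> 1) TD wD).
  rewrite !raddf_sum; apply: ler_sum => b _.
  rewrite [leRHS](_ : _ = Re (phi (D b * star (D b)))); last first.
    by rewrite Normc.normc1 expr1n mul1r.
  have := state_sqE st (toeplitz_star (TD b)); rewrite starK => -[-> p0].
  move: (normc (u b)) (normc_ge0 (u b)) (u1 b) => w w0 w1 /=.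
  by rewrite mul0r subr0 ler_piMl// exprn_ile1.
have := state_cauchy_schwarz st Tc TSs; rewrite starK => h.
rewrite -(@ler_pXn2r _ 2)// ?nnegrE ?normc_ge0 ?mulr_ge0 ?opnorm_ge0//.
apply: le_trans h _.
have [_ p1] := state_sqE st Tc.
have [_] := state_sqE st TSs; rewrite starK => p2.
have q1 := state_sq_le st Tc; have := state_sq_le st (toeplitz_star TX).
rewrite starK => q2.
apply: le_trans (ler_pM p1 p2 q1 (le_trans SS q2)) _.
have nX : opnorm (star X) ^+ 2 <= opnorm X ^+ 2.
  by rewrite ler_pXn2r ?nnegrE ?opnorm_ge0// opnorm_star.
rewrite (_ : (2 * _ * _) ^+ 2 = 2 * opnorm c ^+ 2 * (2 * opnorm X ^+ 2)); last by ring.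
by apply: ler_wpM2l; [rewrite mulr_ge0// sqr_ge0|exact: ler_wpM2l].
Qed.

Lemma phi_entire_le d c f z : T d -> T c ->
  entire_extension T sigma c f -> 0 <= Im z ->
  normc (phi (d * f z)) <= 2 * opnorm d * opnorm c.
Proof.
move=> Td Tc ef z0; have [Tf _ _] := ef.
apply/ler_addgt0Pl => e e0.
(* Replacing [d] by [X] costs [2 * opnorm (f z)] times the distance under [phi] and [2 * opnorm c]
   times it in the bound. *)
set N := 2 * opnorm (f z) + 2 * opnorm c + 1.
have N0 : 0 < N by rewrite ltr_wpDl// addr_ge0// mulr_ge0// opnorm_ge0.
have [X SX dX] := toeplitz_dense Td (divr_gt0 e0 N0).
have TX := toeplitz_monomial_span SX; have TdX := toeplitzB Td TX.
rewrite -{1}(subrK X d) mulrDl (stateD st); try exact: toeplitzM.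
apply: le_trans (le_normcD _ _) _.
have h1 := state_le st (toeplitzM TdX (Tf z)).
have h2 := opnormM (d - X) (f z).
have h3 := phi_span_entire_le SX Tc ef z0.
have h4 : opnorm X <= opnorm d + opnorm (d - X).
  by rewrite -{1}(subKr d X); exact: opnormB.
have h5 := ler_wpM2r (opnorm_ge0 c) h4.
move: dX; rewrite ltr_pdivlMr// /N => h6.
have h7 := opnorm_ge0 (d - X).
apply: le_trans (lerD h1 h3) _.
move: h2 h5 h6 h7; clear; rewrite !mulrDr !mulrDl; set k := opnorm (d - X).
by rewrite -!mulrA; lra.
Qed.

End GroundStates.

Theorem lemma8p4 (R : realType) (sigma : R -> bop R affine -> bop R affine)
    (phi : bop R affine -> R[i]) :
  toeplitz_dynamics sigma -> is_state (toeplitz R) phi ->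
  ground_state (toeplitz R) sigma phi <->
  (forall (m n : nat) (a b : posnat), a != posnat1 \/ b != posnat1 ->
     phi (iso_s R ^+ m * iso_v R a * star (iso_v R b) * star (iso_s R) ^+ n)
     = 0).
Proof.
move=> dyn st; split=> [gs m n a b ab|H].
  rewrite iso_monomial -/(monomial R _ _).
  case: ab => [a1|b1]; last by rewrite (ground_state_vanish dyn st gs).
  (* Adjunction exchanges the two indices and reduces to the case [b != 1]. *)
  rewrite -star_monomial (state_star st); last exact: toeplitz_monomial.
  by rewrite (ground_state_vanish dyn st gs)// conjc0.
have vanish x y : x.2 != posnat1 \/ y.2 != posnat1 -> phi (monomial R x y) = 0.
  case: x y => [m a] [n b] /= ab.
  by rewrite /monomial -iso_monomial H.
split=> // c d f [Tc _] [Td _] ef; exists (2 * opnorm d * opnorm c) => z z0.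
exact: (phi_entire_le dyn st vanish Td Tc ef (ltW z0)).
Qed.
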